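(* For the approximation problem ${\rm APP}=\{{\rm APP}_d\}_{d\in\mathbb N}$ in the average case setting with the absolute error criterion: (i) ${\rm APP}$ is ALG-PT for $\Lambda^{\rm all}$ if and only if it is ALG-PT for $\Lambda^{\rm std}$; (ii) ${\rm APP}$ is ALG-SPT for $\Lambda^{\rm all}$ if and only if it is ALG-SPT for $\Lambda^{\rm std}$, and in this case the exponents coincide: ${\rm ALG}\text{-}p^{\rm ABS}(\Lambda^{\rm all})={\rm ALG}\text{-}p^{\rm ABS}(\Lambda^{\rm std})$.
   Context: Setting (average case approximation). For each $d\in\mathbb N$: $D_d\subset\mathbb R^d$ is a Borel set of positive Lebesgue measure, $\rho_d$ is a probability density on $D_d$, and $G_d=L_2(D_d,\rho_d(x)\,dx)$. $F_d$ is a separable Banach space of real-valued functions on $D_d$, continuously embedded in $G_d$, such that every point evaluation $f\mapsto f(x)$, $x\in D_d$, is a continuous linear functional on $F_d$; $F_d$ carries a zero-mean Gaussian measure $\mu_d$. ${\rm APP}_d:F_d\to G_d$, ${\rm APP}_d f=f$. $\Lambda^{\rm all}$ is the class of all continuous linear functionals on $F_d$, $\Lambda^{\rm std}$ the class of point evaluations. For $\Lambda\in\{\Lambda^{\rm all},\Lambda^{\rm std}\}$, an algorithm is $A_{n,d}f=\phi_{n,d}(L_1(f),\dots,L_n(f))$ with $L_i\in\Lambda$ and $\phi_{n,d}:\mathbb R^n\to G_d$ measurable; its average case error is $e^{\rm avg}(A_{n,d})=\big(\int_{F_d}\|f-A_{n,d}f\|_{G_d}^2\,\mu_d(df)\big)^{1/2}$,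 and $e^{\rm avg}(n,d;\Lambda)$ is the infimum of $e^{\rm avg}(A_{n,d})$ over all such algorithms using $n$ functionals from $\Lambda$ (for $n=0$, $A_{0,d}=0$). Absolute-error information complexity: $n^{\rm ABS}(\varepsilon,d;\Lambda)=\min\{n\ge0:\ e^{\rm avg}(n,d;\Lambda)\le\varepsilon\}$. ALG-PT for $\Lambda$: there exist $C>0$, $p,q\ge0$ with $n^{\rm ABS}(\varepsilon,d;\Lambda)\le Cd^q\varepsilon^{-p}$ for all $d\in\mathbb N$, $\varepsilon\in(0,1)$. ALG-SPT: the same with $q=0$, i.e. $n^{\rm ABS}(\varepsilon,d;\Lambda)\le C\varepsilon^{-p}$ for all $d,\varepsilon$; the exponent ${\rm ALG}\text{-}p^{\rm ABS}(\Lambda)$ is the infimum of all $p$ for which such a bound holds with some $C$. *)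

(* Defs.v *)
From HB Require Import structures.
From mathcomp Require Import all_boot all_order all_algebra.
From mathcomp Require Import all_classical all_reals all_analysis.
Set Implicit Arguments. Unset Strict Implicit. Unset Printing Implicit Defensive.
Import Order.TTheory GRing.Theory Num.Theory.
Import numFieldNormedType.Exports.
Local Open Scope classical_set_scope.
Local Open Scope ring_scope.

Definition Rd (R : realType) (d : nat) := g_sigma_algebraType (@open 'rV[R]_d).

Definition Fb (R : realType) (F : normedModType R) := g_sigma_algebraType (@open F).

Definition coord (R : realType) (d : nat) (x : Rd R d) (i : 'I_d) : R :=
  @fun_of_matrix R 1 d x ord0 i.

(* lam is Lebesgue measure on the Borel sets of R^d: it gives every closed
   box its volume (this determines it uniquely). *)
Definition is_lebesgue (R : realType) (d : nat)
  (lam : {measure set (Rd R d) -> \bar R}) : Prop :=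
  forall a b : Rd R d, (forall i, coord a i <= coord b i) ->
    lam [set x : Rd R d | forall i, coord a i <= coord x i <= coord b i]
    = (\prod_(i < d) (coord b i - coord a i))%:E.

Definition G2 (R : realType) (d : nat) (D : set (Rd R d)) (rho : Rd R d -> R)
  (lam : {measure set (Rd R d) -> \bar R}) (h : Rd R d -> R) : \bar R :=
  (\int[lam]_(x in D) ((h x ^+ 2 * rho x)%:E))%E.

Definition inG (R : realType) (d : nat) (D : set (Rd R d)) (rho : Rd R d -> R)
  (lam : {measure set (Rd R d) -> \bar R}) (h : Rd R d -> R) : Prop :=
  measurable_fun D h /\ (G2 D rho lam h < +oo)%E.

Definition clf (R : realType) (F : normedModType R) (L : F -> R) : Prop :=
  (forall (a : R) (f g : F), L (a *: f + g) = a * L f + L g) /\ continuous L.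

Definition centered_normal (R : realType) (s : R) (A : set R) : \bar R :=
  if s == 0 then dirac (0 : R) A else normal_prob 0 s A.

Definition centered_gaussian (R : realType) (F : normedModType R)
  (mu : probability (Fb F) R) : Prop :=
  forall L : F -> R, clf L ->
    exists s : R, 0 <= s /\
      forall A : set R, measurable A -> mu (L @^-1` A) = centered_normal s A.

Definition APP_setting (R : realType)
  (D : forall d : nat, set (Rd R d)) (rho : forall d : nat, Rd R d -> R)
  (lam : forall d : nat, {measure set (Rd R d) -> \bar R})
  (F : nat -> completeNormedModType R) (ev : forall d : nat, F d -> Rd R d -> R)
  (mu : forall d : nat, probability (Fb (F d)) R) : Prop :=
  forall d : nat, (0 < d)%N ->
  (is_lebesgue (lam d) /\ measurable (D d) /\ (0 < lam d (D d))%E) /\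
  (measurable_fun (D d) (rho d) /\ (forall x, D d x -> 0 <= rho d x) /\
     (\int[lam d]_(x in D d) (rho d x)%:E = 1)%E) /\
  (* F_d separable Banach space of functions on D_d, with linear
     evaluation ev and continuous point evaluations *)
  ((exists S : set (F d), countable S /\ closure S = setT) /\
   (forall (a : R) (f g : F d) x, ev d (a *: f + g) x = a * ev d f x + ev d g x) /\
   (forall f g : F d, (forall x, D d x -> ev d f x = ev d g x) -> f = g) /\
   (forall x, D d x -> continuous (fun f : F d => ev d f x))) /\
  ((forall f : F d, inG (D d) (rho d) (lam d) (ev d f)) /\
   (exists C : R, forall f : F d,
       (G2 (D d) (rho d) (lam d) (ev d f) <= (C * `|f| ^+ 2)%:E)%E)) /\
  centered_gaussian (mu d).

Inductive info_class := Lall | Lstd.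

Definition admissible (R : realType) (D : forall d : nat, set (Rd R d))
  (F : nat -> completeNormedModType R) (ev : forall d : nat, F d -> Rd R d -> R)
  (c : info_class) (d : nat) (L : F d -> R) : Prop :=
  match c with
  | Lall => clf L
  | Lstd => exists x, D d x /\ L = (fun f => ev d f x)
  end.

(* phi : R^n -> G_d is Borel measurable (G_d is a separable metric space,
   so its Borel sets are generated by open balls). *)
Definition G_measurable (R : realType) (n d : nat) (D : set (Rd R d))
  (rho : Rd R d -> R) (lam : {measure set (Rd R d) -> \bar R})
  (phi : Rd R n -> Rd R d -> R) : Prop :=
  (forall y, inG D rho lam (phi y)) /\
  (forall g, inG D rho lam g -> forall r : R,
     measurable [set y : Rd R n | (G2 D rho lam (fun x => (phi y x - g x)%R) < r%:E)%E]).

Definition algorithms (R : realType)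
  (D : forall d : nat, set (Rd R d)) (rho : forall d : nat, Rd R d -> R)
  (lam : forall d : nat, {measure set (Rd R d) -> \bar R})
  (F : nat -> completeNormedModType R) (ev : forall d : nat, F d -> Rd R d -> R)
  (c : info_class) (n d : nat) : set (F d -> Rd R d -> R) :=
  [set A | (n = 0%N /\ A = (fun _ _ => 0)) \/
     ((0 < n)%N /\ exists (L : 'I_n -> F d -> R) (phi : Rd R n -> Rd R d -> R),
        [/\ forall i, admissible D ev c (L i),
            G_measurable (D d) (rho d) (lam d) phi
          & A = (fun f => phi (\row_i L i f))])].

Definition err2 (R : realType)
  (D : forall d : nat, set (Rd R d)) (rho : forall d : nat, Rd R d -> R)
  (lam : forall d : nat, {measure set (Rd R d) -> \bar R})
  (F : nat -> completeNormedModType R) (ev : forall d : nat, F d -> Rd R d -> R)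
  (mu : forall d : nat, probability (Fb (F d)) R)
  (d : nat) (A : F d -> Rd R d -> R) : \bar R :=
  (\int[mu d]_(f in setT) G2 (D d) (rho d) (lam d) (fun x => (ev d f x - A f x)%R))%E.

Definition sqrte (R : realType) (x : \bar R) : \bar R :=
  match x with
  | EFin r => (Num.sqrt r)%:E
  | EPInf => +oo%E
  | ENInf => 0%E
  end.

Definition e_avg (R : realType)
  (D : forall d : nat, set (Rd R d)) (rho : forall d : nat, Rd R d -> R)
  (lam : forall d : nat, {measure set (Rd R d) -> \bar R})
  (F : nat -> completeNormedModType R) (ev : forall d : nat, F d -> Rd R d -> R)
  (mu : forall d : nat, probability (Fb (F d)) R)
  (c : info_class) (n d : nat) : \bar R :=
  ereal_inf [set sqrte (err2 D rho lam ev mu A) | A in @algorithms R D rho lam F ev c n d].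

(* n^ABS(eps,d;Lambda) <= X, i.e. min{n | e^avg(n,d) <= eps} <= X *)
Definition nABS_le (R : realType)
  (D : forall d : nat, set (Rd R d)) (rho : forall d : nat, Rd R d -> R)
  (lam : forall d : nat, {measure set (Rd R d) -> \bar R})
  (F : nat -> completeNormedModType R) (ev : forall d : nat, F d -> Rd R d -> R)
  (mu : forall d : nat, probability (Fb (F d)) R)
  (c : info_class) (eps : R) (d : nat) (X : R) : Prop :=
  exists n : nat, n%:R <= X /\ (e_avg D rho lam ev mu c n d <= eps%:E)%E.

Definition ALG_PT (R : realType)
  (D : forall d : nat, set (Rd R d)) (rho : forall d : nat, Rd R d -> R)
  (lam : forall d : nat, {measure set (Rd R d) -> \bar R})
  (F : nat -> completeNormedModType R) (ev : forall d : nat, F d -> Rd R d -> R)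
  (mu : forall d : nat, probability (Fb (F d)) R) (c : info_class) : Prop :=
  exists C p q : R, [/\ 0 < C, 0 <= p, 0 <= q &
    forall d : nat, (0 < d)%N -> forall eps : R, 0 < eps < 1 ->
      nABS_le D rho lam ev mu c eps d (C * (d%:R `^ q) * (eps `^ (- p)))].

Definition ALG_SPT_with (R : realType)
  (D : forall d : nat, set (Rd R d)) (rho : forall d : nat, Rd R d -> R)
  (lam : forall d : nat, {measure set (Rd R d) -> \bar R})
  (F : nat -> completeNormedModType R) (ev : forall d : nat, F d -> Rd R d -> R)
  (mu : forall d : nat, probability (Fb (F d)) R) (c : info_class) (p : R) : Prop :=
  0 <= p /\ exists C : R, 0 < C /\
    forall d : nat, (0 < d)%N -> forall eps : R, 0 < eps < 1 ->
      nABS_le D rho lam ev mu c eps d (C * (eps `^ (- p))).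

Definition ALG_SPT (R : realType)
  (D : forall d : nat, set (Rd R d)) (rho : forall d : nat, Rd R d -> R)
  (lam : forall d : nat, {measure set (Rd R d) -> \bar R})
  (F : nat -> completeNormedModType R) (ev : forall d : nat, F d -> Rd R d -> R)
  (mu : forall d : nat, probability (Fb (F d)) R) (c : info_class) : Prop :=
  exists p : R, ALG_SPT_with D rho lam ev mu c p.

Definition ALG_p_ABS (R : realType)
  (D : forall d : nat, set (Rd R d)) (rho : forall d : nat, Rd R d -> R)
  (lam : forall d : nat, {measure set (Rd R d) -> \bar R})
  (F : nat -> completeNormedModType R) (ev : forall d : nat, F d -> Rd R d -> R)
  (mu : forall d : nat, probability (Fb (F d)) R) (c : info_class) : R :=
  inf [set p : R | ALG_SPT_with D rho lam ev mu c p].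

(* Main.v *)
Require Import Defs.
From HB Require Import structures.
From mathcomp Require Import all_boot all_order all_algebra all_fingroup.
From mathcomp Require Import polyrcf.
From mathcomp Require Import all_classical all_reals all_analysis.
From mathcomp Require Import measurable_realfun.
From mathcomp Require Import ring lra.
Set Implicit Arguments. Unset Strict Implicit. Unset Printing Implicit Defensive.
Import Order.TTheory GRing.Theory Num.Theory.
Import numFieldNormedType.Exports Defs.
Local Open Scope classical_set_scope.
Local Open Scope ring_scope.

(** For each fixed [d], if [n] continuous functionals achieve the error [eps],
then at most [2 * n] function values achieve the error [22 * eps]; hence the
same exponents are admissible for both classes.  Regard the evaluations
[u x : f |-> f x] as elements of [L2 mu].  Since [mu] is Gaussian, linear
functions of [L_1, ..., L_n] predict [f] as well as arbitrary ones, so the [u x]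
are on average close to an [n]-dimensional space.  Choose [m] nodes with
probability proportional to the Gram determinant of their evaluations (volume
sampling): the expected squared distance of [u x] to the span of the chosen
evaluations is a ratio of consecutive principal-minor sums, and for some
[m <= 2 * n] this ratio is at most a constant multiple of the squared error.
The orthogonal projection of [u x] to that span is an algorithm using only
function values. *)

(** * Volume sampling *)

(** Volume sampling concerns finitely many vectors, whereas [x] ranges over a continuum, so the
    probability measure is first replaced by a weighted quadrature rule. The obstacle is that the
    projection is chosen after the nodes, hence the rule must serve all projections at once. For a
    field [x |-> \sum_l e l x *: M l] of finite rank, the squared residual under any such projection
    is a combination of the finitely many functions [e l * e l'], with coefficients bounded
    independently of the projection. A field of this kind close to the evaluations exists because
    the squared norm has a finite mean, which must be derived from Gaussianity. The predictor [phi]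
    is an arbitrary measurable map whose coefficients need not be square-integrable in [f]. Its
    comparison with linear prediction therefore starts from bounded test functions [sin (s * M)],
    for which joint normality gives exact identities, and reaches events and then truncated
    functions by limits. *)

Lemma det_add_rank1_unit (R : idomainType) n (M : 'M[R]_n) (v : 'cV[R]_n)
    (w : 'rV[R]_n) : \det M != 0 ->
  \det (M + v *m w) = \det M + (w *m \adj M *m v) 0 0.
Proof.
(* The Schur complements with respect to the two diagonal blocks give the two sides. Scaling by
   [\det M] keeps the adjugate in place of an inverse; the factor is cancelled at the end. *)
move=> M0; set P := block_mx M v (- w) (1%:M : 'M[R]_1).
have E1 : \det P = \det (M + v *m w).
  have <- : \det (P *m block_mx 1%:M 0 w 1%:M) = \det P.
    by rewrite det_mulmx det_lblock !det1 !mulr1.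
  by rewrite mulmx_block !mulmx1 !mulmx0 !mul1mx !add0r addNr det_ublock det1 mulr1.
have E2 : \det P * \det M = \det M * (\det M + (w *m \adj M *m v) 0 0).
  have := det_mulmx P (block_mx 1%:M (- (\adj M *m v)) 0 (\det M)%:M).
  rewrite det_ublock det1 mul1r det_scalar1 => <-.
  rewrite mulmx_block !mulmx1 !mulmx0 !mul1mx !addr0 !mulmxN !mulmxA mul_mx_adj.
  rewrite mul_scalar_mx mul_mx_scalar addNr det_lblock; congr (_ * _).
  by rewrite det_mx11 !mulNmx opprK addrC !mxE eqxx mulr1n.
by apply: (mulfI M0); rewrite -E2 E1 mulrC.
Qed.

(** Over polynomials, ['X + M] has a monic and so nonzero determinant; the previous identity holds
    there and is evaluated at [0]. *)
Lemma det_add_rank1 (R : idomainType) n (M : 'M[R]_n) (v : 'cV[R]_n)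
    (w : 'rV[R]_n) :
  \det (M + v *m w) = \det M + (w *m \adj M *m v) 0 0.
Proof.
pose C := @polyC R; pose Mp := char_poly_mx (- M).
have H := @det_add_rank1_unit _ n Mp (map_mx C v) (map_mx C w).
have Mp0 : \det Mp != 0 by apply/monic_neq0/char_poly_monic.
have ev (x : {poly R}) : horner_eval 0 x = x.[0] by [].
move: (congr1 (horner_eval 0) (H Mp0)).
have EM : map_mx (horner_eval 0) Mp = M.
  apply/matrixP => i j; rewrite !mxE ev !hornerE hornerMn hornerX.
  by rewrite mul0rn add0r opprK.
have EC m1 m2 (A : 'M[R]_(m1, m2)) : map_mx (horner_eval 0) (map_mx C A) = A.
  by apply/matrixP => i j; rewrite !mxE ev hornerC.
rewrite rmorphD /= -!det_map_mx map_mxD map_mxM !EM !EC => ->; congr (_ + _).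
have -> (A : 'M[{poly R}]_1) : horner_eval 0 (A 0 0) = (map_mx (horner_eval 0) A) 0 0.
  by rewrite mxE.
by rewrite !map_mxM map_mx_adj EM !EC.
Qed.

Section DetGram.
Variable R : rcfType.

Lemma row_sqr_ge0 n (x : 'rV[R]_n) : 0 <= (x *m x^T) 0 0.
Proof. by rewrite mxE sumr_ge0 // => i _; rewrite !mxE -expr2 sqr_ge0. Qed.

Lemma row_sqr_eq0 n (x : 'rV[R]_n) : (x *m x^T) 0 0 = 0 -> x = 0.
Proof.
rewrite mxE => /eqP; rewrite psumr_eq0; last by move=> i _; rewrite mxE -expr2 sqr_ge0.
move=> /allP H; apply/rowP => i; rewrite mxE.
have := H i (mem_index_enum _); rewrite mxE mulf_eq0 orbb => /eqP; exact.
Qed.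

(* [det (G + t)] is a monic polynomial in [t] without positive root, because
   [G + t] is definite for [t > 0]. *)
Lemma det_gram_ge0 n p (U : 'M[R]_(n, p)) : 0 <= \det (U *m U^T).
Proof.
set M := U *m U^T; pose q := char_poly (- M).
have qE t : q.[t] = \det (M + t%:M).
  rewrite /q /char_poly -[LHS]/(horner_eval t _) -det_map_mx; congr (\det _).
  apply/matrixP => i j; rewrite !mxE -[LHS]/(_.[t]) !hornerE hornerMn hornerX.
  by rewrite opprK addrC.
have nroot t : 0 < t -> q.[t] != 0.
  move=> t0; rewrite qE; apply/det0P => -[x x0 /(congr1 (fun y => (y *m x^T) 0 0))].
  rewrite mulmxDr mulmxDl mul_mx_scalar -scalemxAl /M mulmxA -mulmxA -trmx_mul.
  rewrite [in RHS]mul0mx => /eqP.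
  rewrite mxE [X in _ + X]mxE [X in _ == X]mxE.
   rewrite paddr_eq0; [|exact: row_sqr_ge0|].
    move=> /andP[_]; rewrite mulf_eq0 gt_eqF //= => /eqP /row_sqr_eq0 xe.
    by rewrite xe eqxx in x0.
  by rewrite mulr_ge0 ?row_sqr_ge0 // ltW.
have -> : \det M = q.[0].
  by rewrite qE; congr (\det _); apply/matrixP => i j; rewrite !mxE mul0rn addr0.
rewrite leNgt; apply/negP => q0.
have lq : 0 < lead_coef q by rewrite (monicP (char_poly_monic _)) ltr01.
have [b Hb] := poly_pinfty_gt_lc lq.
pose c := Num.max 1 b.
have c0 : 0 < c by rewrite lt_max ltr01.
have qc : 0 < q.[c] by apply: lt_le_trans lq (Hb _ _); rewrite le_max lexx orbT.
have [x xI /eqP rx] : {x | x \in `]0, c[ & root q x}.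
  by apply: poly_ivtoo; [exact: ltW | rewrite nmulr_rlt0].
by have := nroot x; rewrite rx eqxx; move: xI; rewrite in_itv /= => /andP[-> _] /(_ isT).
Qed.

(** Deleting column [l] of [V] subtracts a rank-one term from [M] and leaves a Gram matrix. Its
    determinant is nonnegative and is computed by [det_add_rank1]. *)
Lemma adj_quad_le_det n p k (W : 'M[R]_(n, p)) (V : 'M[R]_(n, k)) (l : 'I_k)
    (M : 'M[R]_n) : M = W *m W^T + V *m V^T ->
  ((col l V)^T *m \adj M *m col l V) 0 0 <= \det M.
Proof.
move=> ME; pose V' := \matrix_(i, j) (if j == l then 0 else V i j).
have E : row_mx W V' *m (row_mx W V')^T = M + (- col l V) *m (col l V)^T.
  rewrite tr_row_mx mul_row_col ME -addrA; congr (_ + _).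
  apply/matrixP => i j; rewrite !mxE (bigD1 l) //= [in RHS](bigD1 l) //= big_ord1.
  rewrite !mxE eqxx mul0r add0r addrC addrA mulNr addNr add0r.
  by apply: eq_bigr => s sl; rewrite !mxE (negbTE sl).
have := det_gram_ge0 (row_mx W V'); rewrite E det_add_rank1.
by rewrite mulmxN [X in _ + X]mxE subr_ge0.
Qed.

(** [\tr (\adj M *m M)] is [n * \det M], and each of the [k] columns of [V] takes away at most one
    [\det M]. *)
Lemma tr_adj_gram_ge n p k (W : 'M[R]_(n, p)) (V : 'M[R]_(n, k))
    (M : 'M[R]_n) : M = W *m W^T + V *m V^T ->
  (n%:R - k%:R) * \det M <= \tr (\adj M *m (W *m W^T)).
Proof.
move=> ME; have E : \tr (\adj M *m M) = n%:R * \det M.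
  by rewrite mul_adj_mx mxtrace_scalar mulr_natl.
have -> : \adj M *m (W *m W^T) = \adj M *m M - \adj M *m (V *m V^T).
  by rewrite -mulmxBr ME addrK.
rewrite linearB /= E mulrBl lerB // mulmxA mxtrace_mulC mulmxA /mxtrace.
have -> : k%:R * \det M = \sum_(l < k) \det M by rewrite sumr_const card_ord mulr_natl.
apply: ler_sum => l _; apply: le_trans (adj_quad_le_det l ME).
rewrite le_eqVlt; apply/orP; left; apply/eqP.
rewrite [LHS]mxE [RHS]mxE; apply: eq_bigr => j _; rewrite [(col l V) j 0]mxE; congr (_ * _).
by rewrite !mxE; apply: eq_bigr => i _; rewrite !mxE.
Qed.

End DetGram.

Section SetRow.
Variable R : comNzRingType.

Definition set_row m n (A : 'M[R]_(m, n)) (i : 'I_m) (r : 'rV[R]_n) : 'M[R]_(m, n) :=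
  \matrix_(k, l) (if k == i then r 0 l else A k l).

Lemma set_row_mul m n p (A : 'M[R]_(m, n)) i r (B : 'M[R]_(n, p)) :
  set_row A i r *m B = set_row (A *m B) i (r *m B).
Proof.
apply/matrixP => k l; rewrite !mxE; case: ifP => ki.
  by apply: eq_bigr => j _; rewrite mxE ki.
by apply: eq_bigr => j _; rewrite mxE ki.
Qed.

Lemma det_set_row n (A : 'M[R]_n) i r :
  \det (set_row A i r) = \sum_j r 0 j * cofactor A i j.
Proof.
rewrite (expand_det_row _ i); apply: eq_bigr => j _; rewrite !mxE eqxx.
congr (_ * (_ * \det _)); apply/matrixP => k l; rewrite !mxE.
by rewrite eq_sym (negbTE (neq_lift _ _)).
Qed.

Lemma det_set_row_sum n (A : 'M[R]_n) i (I : finType) (s : I -> R) (r : I -> 'rV[R]_n) :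
  \det (set_row A i (\sum_a s a *: r a)) = \sum_a s a * \det (set_row A i (r a)).
Proof.
rewrite det_set_row.
under [RHS]eq_bigr do rewrite det_set_row mulr_sumr.
rewrite exchange_big; apply: eq_bigr => j _ /=.
rewrite summxE mulr_suml; apply: eq_bigr => a _; by rewrite mxE mulrA.
Qed.

Lemma row'_set_row_same m n (A : 'M[R]_(m, n)) i r : row' i (set_row A i r) = row' i A.
Proof. by apply/matrixP => k l; rewrite !mxE eq_sym (negbTE (neq_lift _ _)). Qed.

Lemma row'_set_row m n (A : 'M[R]_(m, n)) i k r :
  row' i (set_row A (lift i k) r) = set_row (row' i A) k r.
Proof. by apply/matrixP => a l; rewrite !mxE (inj_eq (@lift_inj _ i)). Qed.

(* The matrix [A] has equal columns [i] and [j]: exchanging them turns the minor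
   of [adj A i j] into that of [adj A j j]. *)
Lemma adj_eq_col n (A : 'M[R]_n) i j : i != j -> (forall k, A k i = A k j) ->
  \adj A i j = - \adj A j j.
Proof.
move=> ij Aij.
have E k : \adj A k j = \det (set_row A j (delta_mx 0 k)).
  rewrite det_set_row (bigD1 k) //= big1 ?addr0 => [|l lk].
    by rewrite !mxE !eqxx mul1r.
  by rewrite mxE (negbTE lk) andbF mul0r.
rewrite !E -[X in _ = - X]mul1r -mulNr.
have -> : set_row A j (delta_mx 0 j) =
          set_row A j (delta_mx 0 i) *m tperm_mx i j.
  rewrite -xcolE; apply/matrixP => k l; rewrite !mxE.
  case: (k == j).
    by rewrite -(inj_eq (@perm_inj _ (tperm i j)) l j) tpermR.
  by case: tpermP => [->|->|_ _] //; rewrite Aij.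
by rewrite det_mulmx det_perm odd_tperm ij /= expr1 mulrN1 mulN1r opprK.
Qed.

End SetRow.

Section OffDiagonal.
Variable R : rcfType.

Lemma set_rowC m n (A : 'M[R]_(m, n)) i j r s : i != j ->
  set_row (set_row A i r) j s = set_row (set_row A j s) i r.
Proof.
move=> ij; apply/matrixP => k l; rewrite !mxE.
by case: (k =P i) => [->|//]; rewrite (negbTE ij).
Qed.

Lemma row'_col'_gram n p (Y : 'M[R]_(n, p)) i j :
  row' j (col' i (Y *m Y^T)) = row' j Y *m (row' i Y)^T.
Proof.
by apply/matrixP => k l; rewrite !mxE; apply: eq_bigr => q _; rewrite !mxE.
Qed.

Lemma det_set_row_mul_sum n p (P Q : 'M[R]_(n, p)) i (I : finType) (s : I -> R)
    (u : I -> 'rV[R]_p) :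
  \sum_a s a * \det (set_row P i (u a) *m Q^T) =
  \det (set_row P i (\sum_a s a *: u a) *m Q^T).
Proof.
rewrite set_row_mul mulmx_suml.
under [in RHS]eq_bigr do rewrite -scalemxAl.
by rewrite det_set_row_sum; apply: eq_bigr => a _; rewrite set_row_mul.
Qed.

(** Deleting row [j] and column [i] of the Gram matrix keeps [u a] only in the left factor and [u b]
    only in the right one, so the adjugate entry is bilinear in them. The double sum is its value
    when both rows equal [t], and this is minus a Gram determinant. *)
Lemma adj_gram_sum_le0 n p (Z : 'M[R]_(n, p)) i j (I : finType) (s : I -> R)
    (u : I -> 'rV[R]_p) : i != j ->
  \sum_a \sum_b s a * s b * (let Y := set_row (set_row Z i (u a)) j (u b) in
     \adj (Y *m Y^T) i j) <= 0.
Proof.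
move=> ij; pose sg : R := (-1) ^+ (j + i).
have [i' iE] : exists i', i = lift j i'.
  by case: (unliftP j i) => [i' ->|ije]; [exists i' | rewrite ije eqxx in ij].
have [j' jE] : exists j', j = lift i j'.
  by case: (unliftP i j) => [j' ->|ije]; [exists j' | rewrite ije eqxx in ij].
pose P r := set_row (row' j Z) i' r; pose Q r := set_row (row' i Z) j' r.
have E r t : let Y := set_row (set_row Z i r) j t in
    \adj (Y *m Y^T) i j = sg * \det (P r *m (Q t)^T).
  move=> Y; rewrite mxE /cofactor row'_col'_gram; congr (_ * \det (_ *m _^T)).
    by rewrite /Y row'_set_row_same {1}iE row'_set_row.
  by rewrite /Y set_rowC // row'_set_row_same {1}jE row'_set_row.
pose t := \sum_a s a *: u a.
have -> : \sum_a \sum_b s a * s b * (let Y := set_row (set_row Z i (u a)) j (u b) in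
     \adj (Y *m Y^T) i j) = sg * \det (P t *m (Q t)^T).
  transitivity (sg * \sum_b s b * \sum_a s a * \det (P (u a) *m (Q (u b))^T)).
    rewrite exchange_big mulr_sumr; apply: eq_bigr => b _.
    rewrite !mulr_sumr; apply: eq_bigr => a _; cbv zeta; rewrite E; ring.
  congr (_ * _); rewrite -det_tr trmx_mul trmxK -det_set_row_mul_sum.
  apply: eq_bigr => b _; rewrite det_set_row_mul_sum; congr (_ * _).
  by rewrite -det_tr trmx_mul trmxK.
rewrite -E adj_eq_col //.
  rewrite mxE /cofactor row'_col'_gram -signr_odd oddD addbb expr0 mul1r oppr_le0.
  exact: det_gram_ge0.
move=> k; rewrite !mxE; apply: eq_bigr => q _; rewrite !mxE !eqxx.
by rewrite (negbTE ij).
Qed.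

End OffDiagonal.

Section VolumeSampling.
Variable R : rcfType.

Definition upd (aT : finType) (rT : Type) (X : {ffun aT -> rT}) i a : {ffun aT -> rT} :=
  [ffun k => if k == i then a else X k].

Lemma upd_same (aT : finType) (rT : Type) (X : {ffun aT -> rT}) i : upd X i (X i) = X.
Proof. by apply/ffunP => k; rewrite ffunE; case: eqP => [->|]. Qed.

Lemma upd_upd (aT : finType) (rT : Type) (X : {ffun aT -> rT}) i a b :
  upd (upd X i a) i b = upd X i b.
Proof. by apply/ffunP => k; rewrite !ffunE; case: eqP. Qed.

Lemma sum_upd (aT rT : finType) (h : {ffun aT -> rT} -> R) i :
  \sum_X \sum_a h (upd X i a) = #|rT|%:R * \sum_X h X.
Proof.
(* Exchanging the old value at [i] with the new one is an involution. *)
rewrite pair_bigA /= (reindex (fun q : {ffun aT -> rT} * rT => (upd q.1 i q.2, q.1 i))) /=; last first.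
  exists (fun q : {ffun aT -> rT} * rT => (upd q.1 i q.2, q.1 i)) => [[X a]|[X a]] _ /=;
    by rewrite upd_upd upd_same ffunE eqxx.
under eq_bigr do rewrite upd_upd upd_same.
rewrite -(pair_bigA _ (fun X a => h X)) mulr_sumr; apply: eq_bigr => X _ /=.
by rewrite sumr_const mulr_natl.
Qed.

(** Tuples with a repeated entry contribute zero, so this is [m] factorial times the sum of the
    principal minors of order [m] of [U *m U^T], an elementary symmetric function of its
    eigenvalues. *)
Definition vol N p m (U : 'M[R]_(N, p)) : R :=
  \sum_(X : {ffun 'I_m -> 'I_N}) \det (rowsub X U *m (rowsub X U)^T).

Lemma rowsub_upd N p m (U : 'M[R]_(N, p)) (X : {ffun 'I_m -> 'I_N}) i a :
  rowsub (upd X i a) U = set_row (rowsub X U) i (row a U).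
Proof. by apply/matrixP => k l; rewrite !mxE ffunE; case: eqP. Qed.

Lemma vol_offdiag N p q m (U : 'M[R]_(N, p)) (W : 'M[R]_(N, q)) i j : i != j ->
  \sum_(X : {ffun 'I_m -> 'I_N})
     \adj (rowsub X U *m (rowsub X U)^T) i j * (W *m W^T) (X j) (X i) <= 0.
Proof.
move=> ij; have [N0|N0] := posnP N.
  by rewrite big1 // => X _; exfalso; case: (X i) => ?; rewrite N0.
have Np : 0 < (#|'I_N|%:R : R) by rewrite card_ord ltr0n.
(* Resampling the coordinates [i] and [j] costs a positive factor; each column of [W] then supplies
   the weights of [adj_gram_sum_le0]. *)
rewrite -(pmulr_rle0 _ Np) -(sum_upd _ j) -(pmulr_rle0 _ Np) -(sum_upd _ i).
apply: sumr_le0 => X _.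
rewrite (eq_bigr (fun a => \sum_b \sum_c (W a c * W b c *
  (let Y := set_row (set_row (rowsub X U) i (row a U)) j (row b U) in
    \adj (Y *m Y^T) i j)))); last first.
  move=> a _; apply: eq_bigr => b _; rewrite !rowsub_upd !ffunE !eqxx (negbTE ij).
  rewrite [(W *m W^T) _ _]mxE mulr_sumr; apply: eq_bigr => c _.
  by rewrite [W^T _ _]mxE /= mulrC [W b c * _]mulrC.
under eq_bigr do rewrite exchange_big /=.
rewrite exchange_big /=; apply: sumr_le0 => c _.
exact: (adj_gram_sum_le0 _ (fun a => W a c) (fun a => row a U) ij).
Qed.

Lemma sum_ffun_lift (N m : nat) (i : 'I_m.+1) (f : {ffun 'I_m -> 'I_N} -> R) (g : 'I_N -> R) :
  \sum_(X : {ffun 'I_m.+1 -> 'I_N}) f [ffun k => X (lift i k)] * g (X i) =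
  (\sum_Y f Y) * (\sum_a g a).
Proof.
rewrite mulr_suml; under [RHS]eq_bigr do rewrite mulr_sumr.
rewrite pair_bigA /=.
rewrite (reindex (fun q : {ffun 'I_m -> 'I_N} * 'I_N =>
   [ffun k => if unlift i k is Some k' then q.1 k' else q.2])) /=; last first.
  exists (fun X : {ffun 'I_m.+1 -> 'I_N} => ([ffun k => X (lift i k)], X i)).
    move=> [Y a] _ /=; congr (_, _); last by rewrite ffunE unlift_none.
    by apply/ffunP => k; rewrite !ffunE liftK.
  move=> X _; apply/ffunP => k; rewrite ffunE; case: unliftP => [k' ->|-> //].
  by rewrite ffunE.
apply: eq_bigr => -[Y a] _ /=; rewrite ffunE unlift_none; congr (f _ * _).
by apply/ffunP => k; rewrite !ffunE liftK.
Qed.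

(** A diagonal entry of the adjugate is the Gram determinant of the tuple without coordinate [i],
    which can therefore be summed independently. *)
Lemma vol_diag N p q m (U : 'M[R]_(N, p)) (W : 'M[R]_(N, q)) i :
  \sum_(X : {ffun 'I_m.+1 -> 'I_N})
     \adj (rowsub X U *m (rowsub X U)^T) i i * (W *m W^T) (X i) (X i) =
  vol m U * \tr (W *m W^T).
Proof.
rewrite /vol /mxtrace -(sum_ffun_lift i (fun Y => \det _) (fun a => (W *m W^T) a a)).
apply: eq_bigr => X _; congr (_ * _).
rewrite mxE /cofactor row'_col'_gram -signr_odd oddD addbb expr0 mul1r.
have -> // : row' i (rowsub X U) = rowsub [ffun k => X (lift i k)] U.
by apply/matrixP => k l; rewrite !mxE ffunE.
Qed.

Lemma rowsub_row_mx N p q m (f : 'I_m -> 'I_N) (V : 'M[R]_(N, p)) (W : 'M[R]_(N, q)) :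
  rowsub f (row_mx V W) = row_mx (rowsub f V) (rowsub f W).
Proof. by apply/matrixP => k l; rewrite !mxE; case: fintype.split => l'; rewrite mxE. Qed.

(* Replacing one coordinate of a tuple by a fresh index at a time, the diagonal
   terms give [m.+1] copies of the right-hand side and the others are [<= 0]. *)
Lemma vol_ratio N p k m (W : 'M[R]_(N, p)) (V : 'M[R]_(N, k)) :
  (m.+1%:R - k%:R) * vol m.+1 (row_mx W V) <=
  m.+1%:R * \tr (W *m W^T) * vol m (row_mx W V).
Proof.
set U := row_mx W V; rewrite mulr_sumr.
pose M X := rowsub (X : {ffun 'I_m.+1 -> 'I_N}) U *m (rowsub X U)^T.
apply: (@le_trans _ _ (\sum_(X : {ffun 'I_m.+1 -> 'I_N}) \sum_i \sum_j
    \adj (M X) i j * (W *m W^T) (X j) (X i))).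
  apply: ler_sum => X _.
  have ME : M X = rowsub X W *m (rowsub X W)^T + rowsub X V *m (rowsub X V)^T.
    by rewrite /M /U rowsub_row_mx tr_row_mx mul_row_col.
  apply: le_trans (tr_adj_gram_ge ME) _; rewrite le_eqVlt; apply/orP; left; apply/eqP.
  apply: eq_bigr => i _; rewrite mxE; apply: eq_bigr => j _; congr (_ * _).
  by rewrite !mxE; apply: eq_bigr => l _; rewrite !mxE.
rewrite exchange_big /= -mulrA [_ * vol _ _]mulrC.
have -> (c : R) : m.+1%:R * c = \sum_(i < m.+1) c by rewrite sumr_const card_ord mulr_natl.
apply: ler_sum => i _; rewrite exchange_big /= (bigD1 i) //= vol_diag gerDl /M.
by apply: sumr_le0 => j ji; apply: vol_offdiag; rewrite eq_sym.
Qed.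

End VolumeSampling.

Section Selection.
Variable R : rcfType.

Lemma sum_ffun_ext (N m : nat) (f : {ffun 'I_m.+1 -> 'I_N} -> R) :
  \sum_X f X = \sum_(Y : {ffun 'I_m -> 'I_N}) \sum_a
     f [ffun k => if unlift ord0 k is Some k' then Y k' else a].
Proof.
rewrite pair_bigA /= (reindex (fun q : {ffun 'I_m -> 'I_N} * 'I_N =>
   [ffun k => if unlift ord0 k is Some k' then q.1 k' else q.2])) //=.
exists (fun X : {ffun 'I_m.+1 -> 'I_N} => ([ffun k => X (lift ord0 k)], X ord0)).
  move=> [Y a] _ /=; congr (_, _); last by rewrite ffunE unlift_none.
  by apply/ffunP => k; rewrite !ffunE liftK.
move=> X _; apply/ffunP => k; rewrite ffunE; case: unliftP => [k' ->|-> //].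
by rewrite ffunE.
Qed.

(** Base times height: the last factor, a Schur complement, is the squared distance from [u] to the
    row space of [Z]. *)
Lemma det_gram_col_mx m p (u : 'rV[R]_p) (Z : 'M[R]_(m, p)) :
  Z *m Z^T \in unitmx ->
  \det (col_mx u Z *m (col_mx u Z)^T) = \det (Z *m Z^T) *
    (u *m u^T - u *m Z^T *m invmx (Z *m Z^T) *m (Z *m u^T)) 0 0.
Proof.
set G := Z *m Z^T => Gu; set b := u *m Z^T; set c := Z *m u^T.
rewrite tr_col_mx mul_col_row.
have <- : \det (block_mx (u *m u^T) b c G *m block_mx 1%:M 0 (- (invmx G *m c)) 1%:M)
        = \det (block_mx (u *m u^T) b c G).
  by rewrite det_mulmx det_lblock !det1 !mulr1.
rewrite mulmx_block !mulmx1 !mulmx0 !add0r !mulmxN (mulmxA G) mulmxV // mul1mx.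
by rewrite subrr det_ublock det_mx11 mulrC mulmxA.
Qed.

Lemma rowsub_ext N p m (U : 'M[R]_(N, p)) (Y : {ffun 'I_m -> 'I_N}) a :
  rowsub [ffun k => if unlift ord0 k is Some k' then Y k' else a] U =
  col_mx (row a U) (rowsub Y U).
Proof.
apply/matrixP => k l; rewrite [RHS]mxE [LHS]mxE ffunE.
case: split_ordP => k' ->.
  by rewrite (_ : lshift m k' = ord0) ?unlift_none ?mxE //; apply: val_inj; rewrite /= ord1.
rewrite (_ : rshift 1 k' = lift ord0 k') ?liftK ?mxE //; exact: val_inj.
Qed.

Lemma vol_ge0 N p m (U : 'M[R]_(N, p)) : 0 <= vol m U.
Proof. by apply: sumr_ge0 => X _; exact: det_gram_ge0. Qed.

Lemma vol0 N p (U : 'M[R]_(N, p)) : vol 0 U = 1.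
Proof.
rewrite /vol (eq_bigr (fun=> 1)) => [|X _]; last by rewrite det_mx00.
by rewrite sumr_const card_ffun !card_ord expn0.
Qed.

(** Take the largest [m <= 2k] of positive volume. If [m < 2k], the next volume vanishes; if
    [m = 2k], [vol_ratio] gives the factor [(2k + 1) / (k + 1) <= 2]. This is where twice as many
    nodes as functionals come from. *)
Lemma vol_select N p k (W : 'M[R]_(N, p)) (V : 'M[R]_(N, k)) :
  exists m, [/\ (m <= k.*2)%N, 0 < vol m (row_mx W V) &
    vol m.+1 (row_mx W V) <= 2 * \tr (W *m W^T) * vol m (row_mx W V)].
Proof.
set U := row_mx W V.
pose P m := (m <= k.*2)%N && (0 < vol m U).
have exP : exists m, P m by exists 0; rewrite /P vol0 ltr01.
have ubP m : P m -> (m <= k.*2)%N by case/andP.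
have [m /andP[mk vm] mmax] := ex_maxnP exP ubP.
exists m; split => //.
have tr0 : 0 <= \tr (W *m W^T).
  apply: sumr_ge0 => i _; rewrite mxE; apply: sumr_ge0 => j _.
  by rewrite !mxE -expr2 sqr_ge0.
move: mk; rewrite leq_eqVlt => /orP[/eqP mk|mk].
  have := vol_ratio m W V; rewrite -/U mk => H.
  have k0 : 0 < k.*2.+1%:R - k%:R :> R by rewrite subr_gt0 ltr_nat ltnS -addnn leq_addr.
  rewrite -(ler_pM2l k0); apply: le_trans H _.
  rewrite !mulrA ler_wpM2r ?vol_ge0 // ler_wpM2r //.
  have kE : k.*2.+1%:R = k%:R + k%:R + 1 :> R by rewrite -addnn -natr1 natrD.
  have := ler0n R k; rewrite kE; lra.
have -> : vol m.+1 U = 0; last by rewrite mulr_ge0 ?vol_ge0 ?mulr_ge0.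
apply/eqP; rewrite eq_le vol_ge0 andbT leNgt; apply/negP => v1.
by have := mmax m.+1; rewrite /P mk v1 ltnn => /(_ isT).
Qed.

(** Averaging: the sums [s Y] add up to [vol m.+1 U], so some tuple of positive determinant
    satisfies the bound weighted by that determinant. Division by it turns [s Y] into a sum of
    squared distances. *)
Lemma volume_sampling N p k (W : 'M[R]_(N, p)) (V : 'M[R]_(N, k)) (U := row_mx W V) :
  exists m (X : 'I_m -> 'I_N), let Z := rowsub X U in
    [/\ (m <= k.*2)%N, Z *m Z^T \in unitmx &
    \sum_a (row a U *m (row a U)^T -
       row a U *m Z^T *m invmx (Z *m Z^T) *m (Z *m (row a U)^T)) 0 0 <=
    2 * \tr (W *m W^T)].
Proof.
have [m [mk vm v1]] := vol_select W V; exists m.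
pose G (Y : {ffun 'I_m -> 'I_N}) := rowsub Y U *m (rowsub Y U)^T.
pose s (Y : {ffun 'I_m -> 'I_N}) := \sum_a
  \det (col_mx (row a U) (rowsub Y U) *m (col_mx (row a U) (rowsub Y U))^T).
have s0 Y : 0 <= s Y by apply: sumr_ge0 => a _; exact: det_gram_ge0.
have v1E : vol m.+1 U = \sum_Y s Y.
  rewrite /vol sum_ffun_ext; apply: eq_bigr => Y _; apply: eq_bigr => a _.
  by rewrite rowsub_ext.
have [Y /andP[dY sY]] : exists Y, (0 < \det (G Y)) && (s Y <= 2 * \tr (W *m W^T) * \det (G Y)).
  apply/existsP; apply: contraT; rewrite negb_exists => /forallP H.
  have tr0 : 0 <= \tr (W *m W^T).
    apply: sumr_ge0 => i _; rewrite mxE; apply: sumr_ge0 => j _.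
    by rewrite !mxE -expr2 sqr_ge0.
  have le Y : 2 * \tr (W *m W^T) * \det (G Y) <= s Y.
    have := H Y; rewrite negb_and -leNgt -ltNge => /orP[d0|/ltW//].
    have -> : \det (G Y) = 0 by apply/eqP; rewrite eq_le d0 det_gram_ge0.
    by rewrite mulr0.
  (* If every tuple failed, this one would make the summed inequality strict, against [v1]. *)
  have [Y dY] : exists Y, 0 < \det (G Y).
    apply/existsP; apply: contraLR vm; rewrite negb_exists => /forallP dY.
    by rewrite -leNgt; apply: sumr_le0 => Y _; rewrite leNgt dY.
  have := v1; rewrite -/U v1E mulr_sumr (bigD1 Y) //= [X in _ <= X](bigD1 Y) //=.
  have := H Y; rewrite dY /= -ltNge => lt1.
  rewrite leNgt ltr_leD //.
  by apply: ler_sum => Y' _; exact: le.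
exists Y => Z; have Zu : Z *m Z^T \in unitmx by rewrite unitmxE unitfE gt_eqF.
split => //; rewrite -(ler_pM2l dY) mulr_sumr [leRHS]mulrC.
by apply: le_trans sY; apply: ler_sum => a _; rewrite det_gram_col_mx.
Qed.

End Selection.

(** * Projections in pre-Hilbert spaces *)

(* The inner product is only required to behave on a linear subset [S], so that
   square-integrable functions need not be packed into a type of their own. *)
Section PreHilbert.
Variables (R : rcfType) (V : lmodType R) (S : V -> Prop) (ip : V -> V -> R).

Definition lin_closed (P : V -> Prop) :=
  P 0 /\ forall (a : R) u v, P u -> P v -> P (a *: u + v).

Definition pre_ip :=
  [/\ forall u v, S u -> S v -> ip u v = ip v u,
      forall a u v w, S u -> S v -> S w -> ip (a *: u + v) w = a * ip u w + ip v w &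
      forall u, S u -> 0 <= ip u u].

Hypothesis lS : lin_closed S.
Hypothesis Hip : pre_ip.

Lemma lin_closedZ P a u : lin_closed P -> P u -> P (a *: u).
Proof. by move=> [P0 PD] Pu; rewrite -[_ *: _]addr0; exact: PD. Qed.

Lemma lin_closedD P u v : lin_closed P -> P u -> P v -> P (u + v).
Proof. by move=> [P0 PD] Pu Pv; rewrite -[u]scale1r; exact: PD. Qed.

Lemma lin_closedB P u v : lin_closed P -> P u -> P v -> P (u - v).
Proof. by move=> [P0 PD] Pu Pv; rewrite addrC -scaleN1r; exact: PD. Qed.

Lemma lin_closed_sum P (I : Type) (r : seq I) (c : I -> R) (u : I -> V) :
  lin_closed P -> (forall i, P (u i)) -> P (\sum_(i <- r) c i *: u i).
Proof.
move=> lP Pu; elim: r => [|i r IH]; first by rewrite big_nil; case: lP.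
by rewrite big_cons; case: lP => _; apply.
Qed.

Lemma ipC u v : S u -> S v -> ip u v = ip v u.
Proof. by case: Hip => H _ _; exact: H. Qed.

Lemma ip_ge0 u : S u -> 0 <= ip u u.
Proof. by case: Hip => _ _; exact. Qed.

Lemma ipDl u v w : S u -> S v -> S w -> ip (u + v) w = ip u w + ip v w.
Proof.
by case: Hip => _ H _ Su Sv Sw; rewrite -[u]scale1r H // scale1r mul1r.
Qed.

Lemma ip0l w : S w -> ip 0 w = 0.
Proof.
move=> Sw; have S0 : S 0 by case: lS.
by have := ipDl S0 S0 Sw; rewrite addr0 => /eqP; rewrite -subr_eq subrr => /eqP.
Qed.

Lemma ipZl a u w : S u -> S w -> ip (a *: u) w = a * ip u w.
Proof.
case: Hip => _ H _ Su Sw; have S0 : S 0 by case: lS.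
by rewrite -[a *: u]addr0 H // ip0l // addr0.
Qed.

Lemma ipDr u v w : S u -> S v -> S w -> ip w (u + v) = ip w u + ip w v.
Proof.
move=> Su Sv Sw; have Suv := lin_closedD lS Su Sv.
by rewrite ipC // ipDl // !(ipC Sw).
Qed.

Lemma ipZr a u w : S u -> S w -> ip w (a *: u) = a * ip w u.
Proof.
by move=> Su Sw; have Sau := lin_closedZ a lS Su; rewrite ipC // ipZl // (ipC Sw).
Qed.

Lemma ipBl u v w : S u -> S v -> S w -> ip (u - v) w = ip u w - ip v w.
Proof.
move=> Su Sv Sw; have SNv := lin_closedZ (-1) lS Sv.
by rewrite -scaleN1r ipDl // ipZl // mulN1r.
Qed.

Lemma ipBr u v w : S u -> S v -> S w -> ip w (u - v) = ip w u - ip w v.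
Proof.
move=> Su Sv Sw; have SNv := lin_closedZ (-1) lS Sv.
by rewrite -scaleN1r ipDr // ipZr // mulN1r.
Qed.

Lemma ip_suml (I : Type) (r : seq I) (c : I -> R) (u : I -> V) w :
  (forall i, S (u i)) -> S w ->
  ip (\sum_(i <- r) c i *: u i) w = \sum_(i <- r) c i * ip (u i) w.
Proof.
move=> Su Sw; elim: r => [|i r IH]; first by rewrite !big_nil ip0l.
by case: Hip => _ H _; rewrite !big_cons H ?IH //; exact: lin_closed_sum.
Qed.

Lemma ip_sumr (I : Type) (r : seq I) (c : I -> R) (u : I -> V) w :
  (forall i, S (u i)) -> S w ->
  ip w (\sum_(i <- r) c i *: u i) = \sum_(i <- r) c i * ip w (u i).
Proof.
move=> Su Sw; rewrite ipC ?ip_suml //; last exact: lin_closed_sum.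
by apply: eq_bigr => i _; rewrite ipC.
Qed.

Lemma nrmD u v : S u -> S v -> ip (u + v) (u + v) = ip u u + 2 * ip u v + ip v v.
Proof.
move=> Su Sv; have Suv := lin_closedD lS Su Sv.
rewrite ipDl // !ipDr // (ipC Sv Su); ring.
Qed.

Lemma nrmB u v : S u -> S v -> ip (u - v) (u - v) = ip u u - 2 * ip u v + ip v v.
Proof.
move=> Su Sv; have Suv := lin_closedB lS Su Sv.
rewrite ipBl // !ipBr // (ipC Sv Su); ring.
Qed.

Lemma ip_CS u v : S u -> S v -> ip u v ^+ 2 <= ip u u * ip v v.
Proof.
move=> Su Sv; have [v0|v0] := eqVneq (ip v v) 0.
  rewrite v0 mulr0; have H t : 0 <= ip u u - 2 * t * ip u v.
    have Stv := lin_closedZ t lS Sv.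
    have := ip_ge0 (lin_closedB lS Su Stv).
    by rewrite nrmB // ipZl // !ipZr // v0 !mulr0 addr0 mulrA.
  have [->|c0] := eqVneq (ip u v) 0; first by rewrite expr0n.
  (* A null vector [v] leaves an affine function of [t], which equals [-1] at this point. *)
  have := H ((ip u u + 1) / (2 * ip u v)).
  have -> : 2 * ((ip u u + 1) / (2 * ip u v)) * ip u v = ip u u + 1 by field.
  lra.
have vp : 0 < ip v v by rewrite lt_def v0 ip_ge0.
pose t := ip u v / ip v v.
have Stv := lin_closedZ t lS Sv.
have := ip_ge0 (lin_closedB lS Su Stv).
rewrite nrmB // ipZl // !ipZr //.
have -> : ip u u - 2 * (t * ip u v) + t * (t * ip v v) = ip u u - ip u v ^+ 2 / ip v v.
  by rewrite /t; field.
by rewrite subr_ge0 ler_pdivrMr.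
Qed.

Lemma ip_null u v : S u -> S v -> ip u u = 0 -> ip u v = 0.
Proof.
move=> Su Sv u0; have := ip_CS Su Sv; rewrite u0 mul0r => H.
by apply/eqP; rewrite -sqrf_eq0 eq_le H sqr_ge0.
Qed.

Lemma nrmD_le u v : S u -> S v -> ip (u + v) (u + v) <= 2 * ip u u + 2 * ip v v.
Proof.
move=> Su Sv; have := ip_ge0 (lin_closedB lS Su Sv).
rewrite nrmB // nrmD //; lra.
Qed.

Definition proj r (e : 'I_r -> V) u := \sum_j ip u (e j) *: e j.

Definition orthonormal r (e : 'I_r -> V) :=
  (forall j, S (e j)) /\ forall j k, ip (e j) (e k) = (j == k)%:R.

Section Projection.
Variables (r : nat) (e : 'I_r -> V).
Hypothesis oe : orthonormal e.

Let Se j : S (e j). Proof. by case: oe. Qed.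

Lemma proj_in u : S (proj e u). Proof. exact: lin_closed_sum. Qed.

Lemma res_in u : S u -> S (u - proj e u).
Proof. by move=> Su; apply: lin_closedB => //; exact: proj_in. Qed.

Lemma ip_comb (c : 'I_r -> R) k : ip (\sum_j c j *: e j) (e k) = c k.
Proof.
rewrite ip_suml // (bigD1 k) //= big1 ?addr0 => [|j jk].
  by rewrite (proj2 oe) eqxx mulr1.
by rewrite (proj2 oe) (negbTE jk) mulr0.
Qed.

Lemma nrm_comb (c : 'I_r -> R) :
  ip (\sum_j c j *: e j) (\sum_j c j *: e j) = \sum_j c j ^+ 2.
Proof.
rewrite ip_sumr //; last exact: lin_closed_sum.
by apply: eq_bigr => j _; rewrite ip_comb.
Qed.

Lemma res_orth u k : S u -> ip (u - proj e u) (e k) = 0.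
Proof. by move=> Su; rewrite ipBl ?ip_comb ?subrr //; exact: proj_in. Qed.

Lemma res_orth_comb u (c : 'I_r -> R) : S u ->
  ip (u - proj e u) (\sum_j c j *: e j) = 0.
Proof.
move=> Su; rewrite ip_sumr //; last exact: res_in.
by rewrite big1 // => j _; rewrite res_orth ?mulr0.
Qed.

Lemma nrm_proj u : S u ->
  ip u u = ip (u - proj e u) (u - proj e u) + \sum_j ip u (e j) ^+ 2.
Proof.
move=> Su; have SR := res_in Su; have SP := proj_in u.
rewrite -nrm_comb -/(proj e u).
transitivity (ip (u - proj e u + proj e u) (u - proj e u + proj e u)).
  by rewrite subrK.
rewrite nrmD //.
have H := res_orth_comb (fun j => ip u (e j)) Su; rewrite -/(proj e u) in H.
by rewrite H mulr0 addr0.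
Qed.

Lemma bessel u : S u -> \sum_j ip u (e j) ^+ 2 <= ip u u.
Proof. by move=> Su; rewrite (nrm_proj Su) lerDr ip_ge0 //; exact: res_in. Qed.

Lemma nrm_res_le u (c : 'I_r -> R) : S u ->
  ip (u - proj e u) (u - proj e u) <=
  ip (u - \sum_j c j *: e j) (u - \sum_j c j *: e j).
Proof.
move=> Su; have Sc : S (\sum_j c j *: e j) by exact: lin_closed_sum.
have -> : u - \sum_j c j *: e j = (u - proj e u) + \sum_j (ip u (e j) - c j) *: e j.
  under [in RHS]eq_bigr do rewrite scalerBl.
  by rewrite sumrB addrA subrK.
set w := \sum_j _; have Sw : S w by exact: lin_closed_sum.
have SR := res_in Su.
by rewrite [leRHS]nrmD // res_orth_comb // mulr0 addr0 lerDl ip_ge0.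
Qed.

Lemma projD a u v : S u -> S v -> proj e (a *: u + v) = a *: proj e u + proj e v.
Proof.
move=> Su Sv; rewrite /proj scaler_sumr -big_split; apply: eq_bigr => j _ /=.
by case: Hip => _ H _; rewrite H // scalerDl scalerA.
Qed.

Lemma res_orth_null u v : S u -> S v ->
  ip (v - proj e v) (v - proj e v) = 0 -> ip (u - proj e u) v = 0.
Proof.
move=> Su Sv v0; have Ru := res_in Su; have Rv := res_in Sv; have Pv := proj_in v.
transitivity (ip (u - proj e u) (v - proj e v + proj e v)); first by rewrite subrK.
rewrite ipDr //.
by rewrite (ipC Ru Rv) (ip_null Rv Ru v0) add0r; exact: res_orth_comb.
Qed.

(** A residual of norm zero is what membership of [v] in the span of [e] amounts to for a
    semidefinite product, so this is best approximation by [v]. *)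
Lemma nrm_res_null_le u v : S u -> S v ->
  ip (v - proj e v) (v - proj e v) = 0 ->
  ip (u - proj e u) (u - proj e u) <= ip (u - v) (u - v).
Proof.
move=> Su Sv v0; have Ru := res_in Su; have Rv := res_in Sv.
have Suv := lin_closedB lS Su Sv; have Ruv := res_in Suv.
have -> : u - proj e u = (u - v - proj e (u - v)) + (v - proj e v).
  have -> : proj e (u - v) = proj e u - proj e v.
    by rewrite addrC -scaleN1r projD // scaleN1r addrC.
  by rewrite opprB addrAC [u - v + _]addrA subrK addrA subrK.
rewrite nrmD // v0 addr0 (ipC Ruv Rv) (ip_null Rv Ruv v0) mulr0 addr0.
by rewrite [leRHS](nrm_proj Suv) lerDl sumr_ge0 // => j _; exact: sqr_ge0.
Qed.

End Projection.

(** The product may be degenerate, so spanning is expressed by residuals of norm zero. The clause on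
    [P] says that the [e j] are combinations of the [v i], in a form that transports properties such
    as continuity. *)
Lemma gram_schmidt n (v : 'I_n -> V) : (forall i, S (v i)) ->
  exists r (e : 'I_r -> V), [/\ (r <= n)%N, orthonormal e,
    forall P, lin_closed P -> (forall i, P (v i)) -> forall j, P (e j) &
    forall i, ip (v i - proj e (v i)) (v i - proj e (v i)) = 0].
Proof.
elim: n v => [|n IH] v Sv.
  exists 0, (fun=> 0); split => //; last by case.
    by split; case.
  by move=> P [].
have [r [e [rn oe spe res0]]] := IH (fun i => v (lift ord0 i)) (fun i => Sv _).
have [Se eE] := oe.
pose w := v ord0 - proj e (v ord0).
have Sw : S w by exact: res_in.
have [w0|w0] := eqVneq (ip w w) 0.
  exists r, e; split => //; first exact: leqW.
    by move=> P lP Pv; apply: spe.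
  by move=> i; case: (unliftP ord0 i) => [i' ->|->].
have wp : 0 < ip w w by rewrite lt_def w0 ip_ge0.
pose s := Num.sqrt (ip w w).
have s0 : s != 0 by rewrite gt_eqF // sqrtr_gt0.
have ss : s * s = ip w w by rewrite -expr2 sqr_sqrtr // ltW.
pose e0 := s^-1 *: w.
have Se0 : S e0 by exact: lin_closedZ.
pose e' (k : 'I_r.+1) := if unlift ord0 k is Some k' then e k' else e0.
have e'0 : e' ord0 = e0 by rewrite /e' unlift_none.
have e'S k : e' (lift ord0 k) = e k by rewrite /e' liftK.
have e0e k : ip e0 (e k) = 0 by rewrite ipZl // res_orth ?mulr0.
have oe' : orthonormal e'.
  split=> [j|j k]; first by case: (unliftP ord0 j) => [j' ->|->]; rewrite ?e'S ?e'0.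
  case: (unliftP ord0 j) => [j' ->|->]; case: (unliftP ord0 k) => [k' ->|->];
    rewrite ?e'S ?e'0.
  - by rewrite eE (inj_eq lift_inj).
  - by rewrite ipC // e0e eq_sym (negbTE (neq_lift _ _)).
  - by rewrite e0e (negbTE (neq_lift _ _)).
  - by rewrite eqxx ipZl // ipZr // -ss mulKf // mulVf.
have projE u : proj e' u = ip u e0 *: e0 + proj e u.
  rewrite /proj big_ord_recl e'0; congr (_ + _).
  by apply: eq_bigr => j _; rewrite e'S.
exists r.+1, e'; split => //.
  move=> P lP Pv j; case: (unliftP ord0 j) => [j' ->|->]; rewrite ?e'S ?e'0.
    by apply: spe => // i.
  apply: lin_closedZ => //; apply: lin_closedB => //.
  by apply: lin_closed_sum => // j'; apply: spe.
move=> i; have := bessel oe' (Sv i); case: (unliftP ord0 i) => [i' ->|->] _.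
  set u := v (lift ord0 i').
  have Su : S u by exact: Sv.
  apply/eqP; rewrite eq_le ip_ge0 ?andbT; last exact: res_in.
  (* The old projection, with coefficient zero at [e0], competes with the new one. *)
  have := nrm_res_le oe' (fun k => if unlift ord0 k is Some k' then ip u (e k') else 0) Su.
  rewrite big_ord_recl unlift_none scale0r add0r.
  under eq_bigr do rewrite liftK e'S.
  by rewrite -/(proj e u) res0.
have -> : v ord0 - proj e' (v ord0) = 0.
  rewrite projE; have -> : ip (v ord0) e0 = s.
    rewrite -{1}[v ord0](subrK (proj e (v ord0))) -/w ipDl //; last exact: proj_in.
    have -> : ip (proj e (v ord0)) e0 = 0.
      by rewrite ipC //; [rewrite ipZl ?res_orth_comb ?mulr0 //; exact: proj_in | exact: proj_in].
    by rewrite addr0 ipZr // -ss mulrA mulVf // mul1r.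
  by rewrite scalerA divff // scale1r /w subrK subrr.
by rewrite ip0l //; case: lS.
Qed.

End PreHilbert.

(** * Square-integrable functions and measures with a density *)

Section L2.
Context d (T : measurableType d) (R : realType).
Implicit Types (f g : T -> R).
Variable m : {measure set T -> \bar R}.

Definition L1 (f : T -> R) := m.-integrable setT (EFin \o f).

Definition L2 (f : T -> R) :=
  measurable_fun setT f /\ (\int[m]_x (f x ^+ 2)%:E < +oo)%E.

Definition l2ip (f g : T -> R) : R := \int[m]_x (f x * g x).

Lemma L2_sqr f : L2 f -> L1 (fun x => f x ^+ 2).
Proof.
move=> [mf iF]; apply/integrableP; split.
  by apply/measurable_EFinP; exact: measurable_funX.
by under eq_integral do rewrite /= ger0_norm ?sqr_ge0 //.
Qed.

Lemma L1_le f g : measurable_fun setT f -> (forall x, `|f x| <= g x) -> L1 g -> L1 f.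
Proof.
move=> mf fg; apply: le_integrable => //; first exact/measurable_EFinP.
by move=> x _; rewrite /= lee_fin (le_trans (fg x)) // ler_norm.
Qed.

Lemma L1D f g : L1 f -> L1 g -> L1 (fun x => f x + g x).
Proof. by move=> Lf Lg; exact: (integrableD _ Lf Lg). Qed.

Lemma L1Z a f : L1 f -> L1 (fun x => a * f x).
Proof. by move=> Lf; exact: (integrableZl measurableT a Lf). Qed.

Lemma L1_mfun f : L1 f -> measurable_fun setT f.
Proof. by move=> /integrableP[/measurable_EFinP]. Qed.

Lemma L2_mul f g : L2 f -> L2 g -> L1 (fun x => f x * g x).
Proof.
move=> Lf Lg.
apply: (@L1_le _ (fun x => f x ^+ 2 + g x ^+ 2)).
- by apply: measurable_funM; [case: Lf|case: Lg].
- move=> x; rewrite normrM -[f x ^+ 2]real_normK ?num_real //.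
  rewrite -[g x ^+ 2]real_normK ?num_real //.
  by have := sqr_ge0 (`|f x| - `|g x|); have := sqr_ge0 (`|f x| + `|g x|); nra.
- by apply: L1D; exact: L2_sqr.
Qed.

Lemma L2I f : measurable_fun setT f -> L1 (fun x => f x ^+ 2) -> L2 f.
Proof.
move=> mf /integrableP[_]; split => //.
by move: b; under eq_integral do rewrite /= ger0_norm ?sqr_ge0 //.
Qed.

Lemma L2_lin_closed : @lin_closed R (T -> R) L2.
Proof.
split.
  split; first exact: measurable_cst.
  rewrite (eq_integral (cst 0%E)) ?integral0 // => x _.
  by rewrite expr0n.
move=> a u v Lu Lv; apply: L2I.
  by apply: measurable_funD; [apply: measurable_funM => //|]; [case: Lu|case: Lv].
have -> : (fun x => (a *: u + v) x ^+ 2) =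
    (fun x => a ^+ 2 * u x ^+ 2 + (2 * a * (u x * v x) + v x ^+ 2)).
  apply/funext => x; rewrite [(a *: u + v) x](_ : _ = a * u x + v x) //; ring.
apply: L1D; first by apply: L1Z; exact: L2_sqr.
apply: L1D; last exact: L2_sqr.
by apply: L1Z; exact: L2_mul.
Qed.

Lemma l2_pre_ip : @pre_ip R (T -> R) L2 l2ip.
Proof.
split.
- by move=> u v _ _; apply: eq_Rintegral => x _; rewrite mulrC.
- move=> a u v w Lu Lv Lw; rewrite /l2ip -RintegralZl //; last exact: L2_mul.
  rewrite -RintegralD //; [|exact: (L1Z a (L2_mul Lu Lw))|exact: (L2_mul Lv Lw)].
  by apply: eq_Rintegral => x _; rewrite mulrA -mulrDl.
- by move=> u _; apply: Rintegral_ge0 => x _; rewrite -expr2 sqr_ge0.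
Qed.

Lemma RintegralK f : L1 f -> (\int[m]_x f x)%:E = (\int[m]_x (f x)%:E)%E.
Proof. by move=> Lf; rewrite /Rintegral fineK //; exact: integrable_fin_num. Qed.

Lemma l2ipK f : L2 f -> (l2ip f f)%:E = (\int[m]_x (f x ^+ 2)%:E)%E.
Proof. by move=> Lf; rewrite RintegralK //; exact: L2_mul. Qed.

Lemma L1_sum (I : Type) (r : seq I) (f : I -> T -> R) :
  (forall i, L1 (f i)) -> L1 (fun x => \sum_(i <- r) f i x).
Proof.
move=> Lf; elim: r => [|i r IH].
  have -> : (fun x => \sum_(i <- [::]) f i x) = cst 0.
    by apply/funext => x; rewrite big_nil.
  exact: integrable0.
have -> : (fun x => \sum_(j <- i :: r) f j x) = (fun x => f i x + \sum_(j <- r) f j x).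
  by apply/funext => x; rewrite big_cons.
exact: L1D.
Qed.

Lemma RintegralD' f g : L1 f -> L1 g ->
  \int[m]_x (f x + g x) = \int[m]_x f x + \int[m]_x g x.
Proof. by move=> Lf Lg; rewrite RintegralD. Qed.

Lemma Rintegral_suml (I : Type) (r : seq I) (f : I -> T -> R) :
  (forall i, L1 (f i)) ->
  \int[m]_x (\sum_(i <- r) f i x) = \sum_(i <- r) \int[m]_x f i x.
Proof.
move=> Lf; elim: r => [|i r IH].
  rewrite big_nil; under eq_Rintegral do rewrite big_nil.
  by rewrite /Rintegral integral0.
rewrite big_cons -IH -RintegralD' //; last exact: L1_sum.
by apply: eq_Rintegral => x _; rewrite big_cons.
Qed.

(* The larger function need not be measurable: the integral of a nonnegative
   function is a supremum over simple functions below it. *)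
Lemma le_ge0_integral (f g : T -> \bar R) :
  (forall x, 0 <= f x)%E -> (forall x, f x <= g x)%E ->
  (\int[m]_x f x <= \int[m]_x g x)%E.
Proof.
move=> f0 fg; have g0 x : (0 <= g x)%E by apply: le_trans (fg x).
rewrite !ge0_integralTE //; apply: le_ereal_sup => _ [h hf <-].
by exists h => // x; apply: le_trans (fg x).
Qed.

End L2.

Section Density.
Context d (T : measurableType d) (R : realType).
Variable m : {measure set T -> \bar R}.
Variable q : T -> \bar R.
Hypothesis mq : measurable_fun setT q.
Hypothesis q0 : forall x, (0 <= q x)%E.
Import HBNNSimple.

(** [P] is known through its values on sets, so the formula passes from indicators to simple
    functions and then to monotone limits. *)
Lemma ge0_integral_density (P : {measure set T -> \bar R}) (g : T -> \bar R) :
  (forall A, measurable A -> P A = \int[m]_(x in A) q x)%E ->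
  measurable_fun setT g -> (forall x, 0 <= g x)%E ->
  (\int[P]_x g x = \int[m]_x (g x * q x))%E.
Proof.
move=> PE mg g0; pose h := nnsfun_approx measurableT mg.
have hg x : (h n x)%:E @[n --> \oo] --> g x by exact: cvg_nnsfun_approx.
have nh x : nondecreasing_seq (fun n => (h n x)%:E).
  by move=> a b ab; rewrite lee_fin; exact/lefP/nd_nnsfun_approx.
have Mhq n : measurable_fun setT (fun x => (h n x)%:E * q x)%E.
  by apply: emeasurable_funM => //; exact/measurable_EFinP.
have -> : (\int[P]_x g x = limn (fun n => \int[P]_x (h n x)%:E))%E.
  rewrite -monotone_convergence //.
  - by apply: eq_integral => x _; apply/esym/cvg_lim.
  - by move=> n; exact/measurable_EFinP.
  - by move=> n x _; rewrite lee_fin.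
have -> : (\int[m]_x (g x * q x) = limn (fun n => \int[m]_x ((h n x)%:E * q x)))%E.
  rewrite -monotone_convergence //.
  - apply: eq_integral => x _; apply/esym/cvg_lim => //.
    (* Multiplication is not continuous at [q x = +oo]; there the products are constantly [0] or
       eventually [+oo]. *)
    have [qy|qf] := eqVneq (q x) +oo%E; last first.
      by apply: cvgeZr => //; rewrite ge0_fin_numE // lt_neqAle qf leey.
    rewrite qy; have [gx|gx] := eqVneq (g x) 0%E.
      rewrite gx mul0e; apply: cvg_near_cst; apply: nearW => n.
      have -> : (h n x)%:E = 0%E; last by rewrite mul0e.
      apply/eqP; rewrite eq_le; apply/andP; split; last by rewrite lee_fin.
      rewrite -[leRHS]gx -(cvg_lim _ (hg x)) //.
      apply: lime_ge; first by apply/cvg_ex; exists (g x).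
      by exists n => // k /=; exact: nh.
    have gp : (0 < g x)%E by rewrite lt_def gx g0.
    rewrite gt0_muley //; apply: cvg_near_cst.
    have [N HN] : exists N, (0 < (h N x)%:E)%E.
      apply: contrapT => /forallNP H; move: gp; rewrite -(cvg_lim _ (hg x)) //.
      apply/negP; rewrite -leNgt; apply: lime_le; first by apply/cvg_ex; exists (g x).
      by apply: nearW => n; rewrite leNgt; apply/negP.
    exists N => // n /= Nn; rewrite gt0_muley //.
    exact: lt_le_trans HN (nh x _ _ Nn).
  - by move=> n x _; rewrite mule_ge0 // lee_fin.
  - by move=> x _ a b ab; rewrite lee_wpmul2r //; exact: nh.
congr (limn _); apply/funext => n.
transitivity (\int[P]_x (\sum_(y \in range (h n)) (y * \1_(h n @^-1` [set y]) x)%:E))%E.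
  by apply: eq_integral => t _; rewrite /= fimfunE -fsumEFin.
have indich r : measurable_fun setT (fun x => (r * \1_(h n @^-1` [set r]) x)%:E).
  by apply/measurable_EFinP; exact: measurable_funM.
rewrite ge0_integral_fsum //; last by move=> y x _; exact: nnfun_muleindic_ge0.
transitivity (\int[m]_x (\sum_(y \in range (h n))
    (y * \1_(h n @^-1` [set y]) x)%:E * q x))%E; last first.
  apply: eq_integral => x _.
  rewrite -ge0_mule_fsuml => [|y]; last exact: nnfun_muleindic_ge0.
  by rewrite fsumEFin // -(fimfunE _ x).
rewrite ge0_integral_fsum //; last 2 first.
  - by move=> y; apply: emeasurable_funM.
  - by move=> y x _; rewrite mule_ge0 // nnfun_muleindic_ge0.
apply: eq_fsbigr => r rhn.
rewrite integralZl_indic_nnsfun //.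
under [RHS]eq_integral do rewrite EFinM -muleA.
rewrite ge0_integralZl //.
- congr (_ * _)%E; rewrite integral_indic // setIT PE //.
  rewrite integral_mkcond; apply: eq_integral => x _.
  by rewrite epatch_indic muleC.
- by apply: emeasurable_funM => //; exact/measurable_EFinP.
- by move=> t Et; rewrite mule_ge0 // lee_fin.
- by move: rhn; rewrite inE => -[t _ <-]; rewrite lee_fin.
Qed.

Definition density_mu (A : set T) : \bar R := (\int[m]_(x in A) q x)%E.

Let dens0 : density_mu set0 = 0%E. Proof. exact: integral_set0. Qed.

Let dens_ge0 A : (0 <= density_mu A)%E. Proof. exact: integral_ge0. Qed.

Let dens_sigma_additive : semi_sigma_additive density_mu.
Proof. exact: semi_sigma_additive_nng_induced. Qed.

HB.instance Definition _ := isMeasure.Build _ _ _ density_mu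
  dens0 dens_ge0 dens_sigma_additive.

Hypothesis q1 : (\int[m]_x q x = 1)%E.

Let density_mu1 : density_mu setT = 1%E. Proof. exact: q1. Qed.

HB.instance Definition _ :=
  @Measure_isProbability.Build _ _ R density_mu density_mu1.

Lemma density_probability :
  exists P : probability T R, forall g, measurable_fun setT g ->
    (forall x, 0 <= g x)%E -> (\int[P]_x g x = \int[m]_x (g x * q x))%E.
Proof. by exists density_mu => g mg g0; apply: ge0_integral_density. Qed.

End Density.

(** * Sampling from a probability measure *)

Section Quadrature.
Context d (T : measurableType d) (R : realType).
Variables (P : probability T R) (D : set T).
Hypotheses (mD : measurable D) (PD : P (~` D) = 0%E).

(** If [g] exceeded [1] on [D], a set of full measure, its integral would be at least [1]. The gap
    between the levels [0] and [1] spares a strict inequality between integrals. *)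
Lemma exists_le_of_Rintegral_le0 (g : T -> R) : L1 P g -> \int[P]_x g x <= 0 ->
  exists x, D x /\ g x <= 1.
Proof.
move=> Lg g0; apply: contrapT => H.
have gD x : D x -> 1 < g x.
  by move=> Dx; rewrite ltNge; apply/negP => gx; apply: H; exists x.
have mDc : measurable (~` D) by exact: measurableC.
have PD1 : P D = 1%E by have := probability_setC P mDc; rewrite setCK PD sube0.
have EgD : (\int[P]_x (g x)%:E = \int[P]_(x in D) (g x)%:E)%E.
  by rewrite (negligible_integral mDc measurableT Lg PD) setTD setCK.
have : (1 <= \int[P]_x (g x)%:E)%E.
  rewrite EgD -PD1 -[leLHS]mul1e -integral_cst //.
  apply: ge0_le_integral => //=.
  - by apply/measurable_EFinP/measurable_funTS; exact: (L1_mfun Lg).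
  - by move=> x Dx; rewrite lee_fin ltW // gD.
by rewrite -RintegralK // lee_fin leNgt (le_lt_trans g0).
Qed.

Lemma Rint_lin (f g : T -> R) a b : L1 P f -> L1 P g ->
  \int[P]_x (a * f x + b * g x) = a * (\int[P]_x f x) + b * (\int[P]_x g x).
Proof.
by move=> Lf Lg; rewrite RintegralD' ?RintegralZl //; exact: L1Z.
Qed.

(* Importance sampling with density proportional to [1 + \sum_j `|h j|] makes
   the summands bounded; a greedy choice of nodes then keeps the accumulated
   error of [N] nodes of order [sqrt N]. *)
Lemma quadrature J (h : 'I_J -> T -> R) (delta : R) : 0 < delta ->
  (forall j, L1 P (h j)) ->
  exists N (x : 'I_N -> T) (w : 'I_N -> R),
    [/\ forall a, D (x a), forall a, 0 < w a &
    forall j, `|\sum_a w a * h j (x a) - \int[P]_x h j x| <= delta].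
Proof.
move=> delta0 Lh; pose W x := 1 + \sum_j `|h j x|.
have W1 x : 1 <= W x by rewrite lerDl sumr_ge0.
have W0 x : 0 < W x by apply: lt_le_trans (W1 x).
have hW j x : `|h j x| <= W x.
  rewrite /W (bigD1 j) //= addrCA lerDl addr_ge0 //; exact: sumr_ge0.
have Lcst c : L1 P (fun=> c) by exact: finite_measure_integrable_cst.
have LW : L1 P W.
  apply: L1D => //; apply: L1_sum => j.
  by apply: integrable_norm; exact: Lh.
pose I := \int[P]_x W x.
have I1 : 1 <= I.
  have <- : \int[P]_x (1 : R) = 1.
    rewrite Rintegral_cst // mul1r; exact: (congr1 fine (probability_setT P)).
  apply: le_Rintegral => //; first exact: (Lcst 1).
have I0 : 0 < I by apply: lt_le_trans I1.
pose m j := (\int[P]_x h j x) / I.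
have hm j : \int[P]_x h j x = m j * I by rewrite /m divfK // gt_eqF.
have step (v : 'I_J -> R) : exists x, D x /\
    \sum_j (v j + h j x / W x - m j) ^+ 2 <= \sum_j v j ^+ 2 + J.+1%:R.
  (* Up to the variance term, [g] is [W] times the growth of the squared error caused by a node at
     [x]; its integral is [- I * \sum_j m j ^+ 2]. *)
  pose g x := \sum_j ((2 * v j - 2 * m j) * h j x + (m j ^+ 2 - 2 * v j * m j) * W x).
  have Lgj j : L1 P (fun x => (2 * v j - 2 * m j) * h j x + (m j ^+ 2 - 2 * v j * m j) * W x).
    by apply: L1D; apply: L1Z.
  have [|x [Dx gx]] := @exists_le_of_Rintegral_le0 g (L1_sum _ Lgj).
    rewrite Rintegral_suml //; apply: sumr_le0 => j _.
    rewrite Rint_lin // hm -/I.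
    by have := sqr_ge0 (m j); nra.
  exists x; split => //.
  (* [g x <= 1 <= W x] accounts for one unit of growth, and [h j x ^+ 2 <= W x ^+ 2] for one unit
     per [j]. *)
  rewrite -natr1 addrA -lerBlDl -(ler_pM2l (W0 x)) mulr1.
  apply: le_trans (W1 x); apply: le_trans gx.
  have -> : (J%:R : R) = \sum_(j < J) 1 by rewrite sumr_const card_ord.
  rewrite -big_split /= -sumrB mulr_sumr; apply: ler_sum => j _.
  have Wn : W x != 0 by rewrite gt_eqF.
  have -> : W x * ((v j + h j x / W x - m j) ^+ 2 - (v j ^+ 2 + 1)) =
    ((2 * v j - 2 * m j) * h j x + (m j ^+ 2 - 2 * v j * m j) * W x) +
    (h j x ^+ 2 - W x ^+ 2) / W x by field.
  rewrite gerDl pmulr_lle0 ?invr_gt0 // subr_le0 -[leLHS]real_normK ?num_real //.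
  by rewrite ler_pXn2r ?nnegrE // ltW.
have greedy N : exists x : nat -> T, (forall a, (a < N)%N -> D (x a)) /\
    \sum_j (\sum_(a < N) h j (x a) / W (x a) - N%:R * m j) ^+ 2 <= N%:R * J.+1%:R.
  elim: N => [|N [x [Dx IH]]].
    have [x0 _] := step (fun=> 0); exists (fun=> x0); split => //.
    by rewrite mul0r big1 // => j _; rewrite big_ord0 mul0r subr0 expr0n.
  have [y [Dy Hy]] := step (fun j => \sum_(a < N) h j (x a) / W (x a) - N%:R * m j).
  exists (fun a => if (a < N)%N then x a else y); split.
    by move=> a aN; case: ifP => // /Dx.
  rewrite -natr1 mulrDl mul1r; apply: le_trans (lerD IH (lexx _)).
  apply: le_trans Hy; rewrite le_eqVlt; apply/orP; left; apply/eqP.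
  apply: eq_bigr => j _; rewrite big_ord_recr /= ltnn.
  rewrite (eq_bigr (fun a : 'I_N => h j (x a) / W (x a))) => [|a _]; last by rewrite ltn_ord.
  by congr (_ ^+ 2); ring.
(* The error is [I / N] times a discrepancy whose square is at most [N * (J + 1)]; it is at most
   [delta] once [N] exceeds [K]. *)
pose K := (I / delta) ^+ 2 * J.+1%:R.
have K0 : 0 <= K by rewrite mulr_ge0 ?sqr_ge0.
pose N := (Num.truncn K).+1.
have KN : K < N%:R by exact: truncnS_gt.
have N0 : 0 < N%:R :> R by exact: le_lt_trans KN.
have [x [Dx Hx]] := greedy N.
exists N, (fun a => x a), (fun a => I / (N%:R * W (x a))); split.
- by move=> a; apply: Dx.
- by move=> a; rewrite divr_gt0 // mulr_gt0.
move=> j; pose S := \sum_(a < N) h j (x a) / W (x a) - N%:R * m j.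
have -> : \sum_(a < N) I / (N%:R * W (x a)) * h j (x a) - \int[P]_x h j x = I / N%:R * S.
  rewrite /S mulrBr mulr_sumr hm; congr (_ - _); last by field; rewrite gt_eqF.
  by apply: eq_bigr => a _; field; rewrite !gt_eqF.
have S2 : S ^+ 2 <= N%:R * J.+1%:R.
  apply: le_trans Hx; rewrite (bigD1 j) //= lerDl; apply: sumr_ge0 => i _; exact: sqr_ge0.
rewrite -(@ler_pXn2r _ 2) ?nnegrE // ?(ltW delta0) // real_normK ?num_real //.
rewrite exprMn; apply: (@le_trans _ _ ((I / N%:R) ^+ 2 * (N%:R * J.+1%:R))).
  by rewrite ler_wpM2l // sqr_ge0.
have -> : (I / N%:R) ^+ 2 * (N%:R * J.+1%:R) = K * delta ^+ 2 / N%:R.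
  by rewrite /K; field; rewrite !gt_eqF.
rewrite ler_pdivrMr // mulrC ler_wpM2l ?sqr_ge0 //; exact: ltW.
Qed.

End Quadrature.

Section GramProjection.
Variables (R : rcfType) (V : lmodType R) (S : V -> Prop) (ip : V -> V -> R).
Hypotheses (lS : lin_closed S) (Hip : pre_ip S ip).
Variables (m : nat) (v : 'I_m -> V).
Hypothesis Sv : forall i, S (v i).
Let G : 'M[R]_m := \matrix_(i, j) ip (v i) (v j).
Hypothesis Gu : G \in unitmx.

Let b z : 'rV[R]_m := \row_i ip z (v i).

(** Orthogonal projection written in the [v i] themselves instead of an orthonormal basis, because a
    sampling algorithm has to combine the chosen evaluations. *)
Definition gproj z := \sum_i (b z *m invmx G) 0 i *: v i.

Lemma gproj_in z : S (gproj z).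
Proof. exact: lin_closed_sum. Qed.

Lemma gres_in z : S z -> S (z - gproj z).
Proof. by move=> Sz; apply: lin_closedB => //; exact: gproj_in. Qed.

Lemma gres_orth z j : S z -> ip (z - gproj z) (v j) = 0.
Proof.
move=> Sz; rewrite (ipBl lS Hip) //; last exact: gproj_in.
rewrite /gproj (ip_suml lS Hip) //.
have -> : \sum_i (b z *m invmx G) 0 i * ip (v i) (v j) = (b z *m invmx G *m G) 0 j.
  by rewrite [RHS]mxE; apply: eq_bigr => i _; rewrite [G _ _]mxE.
by rewrite mulmxKV // mxE subrr.
Qed.

Lemma gres_orth_comb z (c : 'I_m -> R) : S z -> ip (z - gproj z) (\sum_i c i *: v i) = 0.
Proof.
move=> Sz; rewrite (ip_sumr lS Hip) //; last exact: gres_in.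
by rewrite big1 // => j _; rewrite gres_orth ?mulr0.
Qed.

Lemma gresE z : S z ->
  ip (z - gproj z) (z - gproj z) = ip z z - (b z *m invmx G *m (b z)^T) 0 0.
Proof.
move=> Sz; rewrite {1}(ipBr lS Hip) //; [|exact: gproj_in|exact: gres_in].
rewrite {2}/gproj gres_orth_comb // subr0 (ipBl lS Hip) //; last exact: gproj_in.
congr (_ - _); rewrite /gproj (ip_suml lS Hip) // [RHS]mxE.
by apply: eq_bigr => i _; rewrite !mxE (ipC Hip).
Qed.

Lemma gprojD a z y : S z -> S y -> gproj (a *: z + y) = a *: gproj z + gproj y.
Proof.
move=> Sz Sy; rewrite /gproj scaler_sumr -big_split /=; apply: eq_bigr => i _.
have -> : b (a *: z + y) = a *: b z + b y.
  by apply/rowP => j; rewrite !mxE; case: Hip => _ H _; rewrite H.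
rewrite mulmxDl -scalemxAl; set A := _ *m _; set B := b y *m _.
have -> : (a *: A + B) 0 i = a * A 0 i + B 0 i by move: A B => A B; rewrite !mxE.
by rewrite scalerDl scalerA.
Qed.

Lemma gproj0 : gproj 0 = 0.
Proof.
rewrite /gproj big1 // => i _.
have -> : b 0 = 0 by apply/rowP => j; rewrite !mxE (ip0l lS Hip).
by rewrite mul0mx mxE scale0r.
Qed.

Lemma gres_sum n (c : 'I_n -> R) (z : 'I_n -> V) : (forall i, S (z i)) ->
  \sum_i c i *: z i - gproj (\sum_i c i *: z i) = \sum_i c i *: (z i - gproj (z i)).
Proof.
move=> Sz; elim: n c z Sz => [|n IH] c z Sz; first by rewrite !big_ord0 gproj0 subrr.
rewrite !big_ord_recl gprojD //; last exact: lin_closed_sum.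
by rewrite -IH // opprD addrACA scalerBr.
Qed.

Lemma nrm_gres_le z : S z -> ip (z - gproj z) (z - gproj z) <= ip z z.
Proof.
move=> Sz; have SR := gres_in Sz; have SP := gproj_in z.
rewrite -[leRHS]/(ip z z).
rewrite (_ : ip z z = ip (z - gproj z + gproj z) (z - gproj z + gproj z)); last by rewrite subrK.
rewrite [leRHS](nrmD lS Hip) //.
have H := gres_orth_comb (fun i => (b z *m invmx G) 0 i) Sz; rewrite -/(gproj z) in H.
by rewrite H mulr0 addr0 lerDl (ip_ge0 Hip).
Qed.

Lemma nrm_gresD_le z y : S z -> S y ->
  ip (z + y - gproj (z + y)) (z + y - gproj (z + y)) <=
  2 * ip (z - gproj z) (z - gproj z) + 2 * ip (y - gproj y) (y - gproj y).
Proof.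
move=> Sz Sy; have H := gprojD 1 Sz Sy; rewrite !scale1r in H.
rewrite H opprD addrACA; apply: (nrmD_le lS Hip); exact: gres_in.
Qed.

End GramProjection.

Section SamplingTheorem.
Variables (R : realType) (V : lmodType R) (S : V -> Prop) (ip : V -> V -> R).
Hypotheses (lS : lin_closed S) (Hip : pre_ip S ip).

(** Coordinates reduce this to matrices: [VV] describes [u a] along [L], and [W] its residual along
    an orthonormal system [f] of the residuals. The rows of [row_mx W VV] then have the scalar
    products of the [u a], and [\tr (W *m W^T)] is the total squared residual. *)
Lemma discrete_sampling k (L : 'I_k -> V) N (u : 'I_N -> V) :
  orthonormal S ip L -> (forall a, S (u a)) ->
  exists m (X : 'I_m -> 'I_N),
    [/\ (m <= k.*2)%N, (\matrix_(i, j) ip (u (X i)) (u (X j)) : 'M[R]_m) \in unitmx &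
     let g := gproj ip (fun i => u (X i)) in
     \sum_a ip (u a - g (u a)) (u a - g (u a)) <=
     2 * \sum_a ip (u a - proj ip L (u a)) (u a - proj ip L (u a))].
Proof.
move=> oL Su; pose r a := u a - proj ip L (u a).
have Sr a : S (r a) by exact: res_in.
have [p [f [_ of_ _ fr]]] := gram_schmidt lS Hip Sr.
have [SL oLE] := oL; have [Sf ofE] := of_.
pose VV : 'M[R]_(N, k) := \matrix_(a, l) ip (u a) (L l).
pose W : 'M[R]_(N, p) := \matrix_(a, q) ip (r a) (f q).
have WE a b : (W *m W^T) a b = ip (r a) (r b).
  have Spb := proj_in lS of_ (r b); have SRb := res_in lS of_ (Sr b).
  rewrite -[X in _ = ip _ X](subrK (proj ip f (r b))) (ipDr lS Hip) //.
  rewrite (ipC Hip (Sr a) SRb) (ip_null lS Hip SRb (Sr a) (fr b)) add0r (ip_sumr lS Hip) // mxE.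
  apply: eq_bigr => q _.
  by rewrite !mxE mulrC.
have KE a b : (row_mx W VV *m (row_mx W VV)^T) a b = ip (u a) (u b).
  rewrite tr_row_mx mul_row_col [LHS]mxE WE.
  have Spa := proj_in lS oL (u a); have Spb := proj_in lS oL (u b).
  have uE c : u c = r c + proj ip L (u c) by rewrite subrK.
  have -> : ip (u a) (u b) = ip (r a + proj ip L (u a)) (r b + proj ip L (u b)) by rewrite -!uE.
  have r0 c d : ip (r c) (proj ip L (u d)) = 0 by exact: (res_orth_comb lS Hip oL _ (Su c)).
  have Sub : S (r b + proj ip L (u b)) by rewrite -uE.
  rewrite (ipDl Hip (Sr a) Spa Sub) (ipDr lS Hip (Sr b) Spb (Sr a)) (ipDr lS Hip (Sr b) Spb Spa).
  rewrite r0 addr0.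
  rewrite (ipC Hip Spa (Sr b)) r0 add0r; congr (_ + _).
  rewrite (ip_sumr lS Hip _ _ SL Spa) mxE; apply: eq_bigr => l _.
  by rewrite (ip_comb lS Hip oL) !mxE mulrC.
have [m [X [mk Gu Hs]]] := volume_sampling W VV.
exists m, X; set Z := rowsub X _ in Gu Hs.
have GE : Z *m Z^T = \matrix_(i, j) ip (u (X i)) (u (X j)).
  apply/matrixP => i j; rewrite [RHS]mxE -KE !mxE.
  by apply: eq_bigr => l _; rewrite !mxE.
rewrite GE in Gu Hs; split => // g.
rewrite (_ : \sum_a ip (u a - proj ip L (u a)) _ = \tr (W *m W^T)); last first.
  by apply: eq_bigr => a _; rewrite WE.
apply: le_trans Hs; rewrite le_eqVlt; apply/orP; left; apply/eqP.
apply: eq_bigr => a _.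
rewrite /g (gresE lS Hip) // [RHS]mxE.
have rE b c : (row b (row_mx W VV) *m (row c (row_mx W VV))^T) 0 0 = ip (u b) (u c).
  by rewrite -KE !mxE; apply: eq_bigr => l _; rewrite !mxE.
have bE c : row c (row_mx W VV) *m Z^T = \row_i ip (u c) (u (X i)).
  apply/rowP => i; rewrite [RHS]mxE -KE !mxE; apply: eq_bigr => l _; by rewrite !mxE.
rewrite rE bE; congr (_ + _); rewrite [RHS]mxE; congr (- (_ *m _) 0 0).
by rewrite -bE trmx_mul trmxK.
Qed.

Context d (T : measurableType d) (P : probability T R) (D : set T).
Hypotheses (mD : measurable D) (PD : P (~` D) = 0%E).

Lemma quadrature_fin (I : finType) (h : I -> T -> R) (delta : R) : 0 < delta ->
  (forall j, L1 P (h j)) ->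
  exists N (x : 'I_N -> T) (w : 'I_N -> R),
    [/\ forall a, D (x a), forall a, 0 < w a &
    forall j, `|\sum_a w a * h j (x a) - \int[P]_x h j x| <= delta].
Proof.
move=> d0 Lh; have [N [x [w [Dx w0 H]]]] := quadrature mD PD d0 (fun j : 'I_#|I| => Lh (enum_val j)).
by exists N, x, w; split => // j; have := H (enum_rank j); rewrite enum_rankK.
Qed.

(** The quadrature rule is made accurate for [K2], for [r] and for all products [e l * e l']; the
    latter determine the residual of the finite-rank field under whatever projection is selected
    afterwards. The residual of [u] itself is only dominated, by a function [B] that is integrable
    by construction. *)
Lemma sampling k (L : 'I_k -> V) (u : T -> V) N (M : 'I_N -> V) (e : 'I_N -> T -> R)
    (tau : R) : 0 < tau ->
  orthonormal S ip L -> (forall x, S (u x)) -> (forall l, S (M l)) ->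
  (forall l l', L1 P (fun x => e l x * e l' x)) ->
  let K2 x := ip (u x - proj ip L (u x)) (u x - proj ip L (u x)) in
  let r x := ip (u x - \sum_l e l x *: M l) (u x - \sum_l e l x *: M l) in
  L1 P K2 -> \int[P]_x K2 x <= tau -> L1 P r -> \int[P]_x r x <= tau ->
  exists m (X : 'I_m -> T) (A : 'M[R]_m) (B : T -> R),
    [/\ (m <= k.*2)%N, forall i, D (X i), L1 P B /\ \int[P]_x B x <= 28 * tau &
     forall x, let p := \sum_i (\sum_j A i j * ip (u x) (u (X j))) *: u (X i) in
        ip (u x - p) (u x - p) <= B x].
Proof.
move=> tau0 oL Su SM Le K2 r LK2 IK2 Lr Ir.
pose C := \sum_l ip (M l) (M l).
have C0 : 0 <= C by apply: sumr_ge0 => l _; exact: (ip_ge0 Hip).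
(* Two demands are met: [delta <= tau], and the [N ^ 2] products with coefficients at most [C] cost
   at most [tau] together. *)
pose delta := tau / (1 + N%:R ^+ 2 * C).
have den1 : 1 <= 1 + N%:R ^+ 2 * C by rewrite lerDl mulr_ge0 ?sqr_ge0.
have den0 : 0 < 1 + N%:R ^+ 2 * C by exact: lt_le_trans den1.
have delta0 : 0 < delta by rewrite divr_gt0.
have delta1 : delta <= tau by rewrite ler_pdivrMr // ler_peMr // ltW.
have deltaC : N%:R ^+ 2 * C * delta <= tau.
  have -> : N%:R ^+ 2 * C * delta = tau - delta.
    by rewrite /delta; field; rewrite gt_eqF.
  by rewrite lerBlDr lerDl ltW.
pose h (j : option (option ('I_N * 'I_N))) (x : T) : R :=
  match j with
  | None => K2 x
  | Some None => r x
  | Some (Some q) => e q.1 x * e q.2 x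
  end.
have Lh j : L1 P (h j) by case: j => [[q|]|] //; exact: Le.
have [n [x [w [Dx w0 Hq]]]] := quadrature_fin delta0 Lh.
(* Scaling by square roots of the weights turns weighted sums of squares into the plain sums of
   [discrete_sampling]. *)
pose s a := Num.sqrt (w a).
have ss a : s a * s a = w a by rewrite -expr2 sqr_sqrtr // ltW.
pose us a := s a *: u (x a).
have Sus a : S (us a) by exact: lin_closedZ.
have [m [Y [mk Gu]]] := discrete_sampling oL Sus.
set v := fun i => us (Y i); set g := gproj ip v => /= Hs.
have Sv i : S (v i) by exact: Sus.
have Sg z : S z -> S (z - g z) by move=> Sz; exact: (gres_in ip lS Sv Sz).
have gresZ c z : S z -> ip (c *: z - g (c *: z)) (c *: z - g (c *: z)) =
    c * c * ip (z - g z) (z - g z).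
  move=> Sz; have S0 : S 0 by case: lS.
  have E : g (c *: z) = c *: g z.
    by rewrite -[c *: z]addr0 /g (gprojD Hip) // (gproj0 lS Hip) // addr0.
  have Sgz : S (z - g z) by exact: Sg.
  rewrite E -scalerBr (ipZl lS Hip) ?(ipZr lS Hip) ?mulrA //; exact: lin_closedZ.
pose p z := ip (z - g z) (z - g z).
have pZ a : p (us a) = w a * p (u (x a)) by rewrite /p gresZ // ss.
pose q y := \sum_l e l y *: M l.
have Sq y : S (q y) by exact: lin_closed_sum.
pose Pi l l' := ip (M l - g (M l)) (M l' - g (M l')).
have SgM l : S (M l - g (M l)) by exact: Sg.
(* Passing to the residual is a contraction, so Cauchy-Schwarz bounds these entries whatever nodes
   were selected. *)
have PiC l l' : `|Pi l l'| <= C.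
  have MC l1 : Pi l1 l1 <= C.
    apply: le_trans (nrm_gres_le lS Hip Sv Gu (SM l1)) _.
    rewrite /C (bigD1 l1) //= lerDl; apply: sumr_ge0 => i _; exact: (ip_ge0 Hip).
  have := ip_CS lS Hip (SgM l) (SgM l'); rewrite -!/(Pi _ _) => CS.
  rewrite -(@ler_pXn2r _ 2) ?nnegrE // real_normK ?num_real //.
  apply: le_trans CS _; rewrite expr2 ler_pM //; exact: (ip_ge0 Hip).
have pq y : p (q y) = \sum_l \sum_l' Pi l l' * (e l y * e l' y).
  rewrite /p /g /q !(gres_sum lS Hip) // (ip_suml lS Hip) //; last exact: lin_closed_sum.
  apply: eq_bigr => l _; rewrite (ip_sumr lS Hip) // mulr_sumr; apply: eq_bigr => l' _.
  by rewrite /Pi; ring.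
have Lpq : L1 P (fun y => p (q y)).
  have -> : (fun y => p (q y)) = (fun y => \sum_l \sum_l' Pi l l' * (e l y * e l' y)).
    by apply/funext => y; rewrite pq.
  by apply: L1_sum => l; apply: L1_sum => l'; apply: L1Z.
have Ipq : \int[P]_y p (q y) <= \sum_a w a * p (q (x a)) + tau.
  have -> : \int[P]_y p (q y) = \sum_l \sum_l' Pi l l' * \int[P]_y (e l y * e l' y).
    under eq_Rintegral do rewrite pq.
    rewrite Rintegral_suml; last by move=> l; apply: L1_sum => l'; exact: L1Z.
    apply: eq_bigr => l _; rewrite Rintegral_suml; last by move=> l'; exact: L1Z.
    by apply: eq_bigr => l' _; rewrite RintegralZl //; exact: Le.
  have -> : \sum_a w a * p (q (x a)) =
      \sum_l \sum_l' Pi l l' * \sum_a w a * (e l (x a) * e l' (x a)).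
    under eq_bigr do rewrite pq mulr_sumr.
    rewrite exchange_big; apply: eq_bigr => l _ /=.
    under eq_bigr do rewrite mulr_sumr.
    rewrite exchange_big; apply: eq_bigr => l' _ /=.
    by rewrite mulr_sumr; apply: eq_bigr => a _; ring.
  rewrite -lerBlDl; apply: le_trans deltaC.
  have -> : N%:R ^+ 2 * C * delta = \sum_(l < N) \sum_(l' < N) C * delta.
    by rewrite !sumr_const !card_ord -mulrnA -[RHS]mulr_natl natrM expr2 !mulrA.
  rewrite -sumrB; apply: ler_sum => l _; rewrite -sumrB; apply: ler_sum => l' _.
  rewrite -mulrBr; apply: le_trans (ler_norm _) _; rewrite normrM ler_pM //.
  by rewrite distrC; exact: (Hq (Some (Some (l, l')))).
have p_ge0 z : S z -> 0 <= p z by move=> Sz; apply: (ip_ge0 Hip); exact: Sg.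
have p_le z : S z -> p z <= ip z z by move=> Sz; exact: (nrm_gres_le lS Hip Sv Gu).
have pD z y : S z -> S y -> p (z + y) <= 2 * p z + 2 * p y.
  by move=> Sz Sy; exact: (nrm_gresD_le lS Hip Sv).
have pN z : S z -> p (- z) = p z.
  by move=> Sz; rewrite -scaleN1r /p gresZ // mulrNN !mul1r.
have Srr y : S (u y - q y) by exact: lin_closedB.
exists m, (fun i => x (Y i)),
  (\matrix_(i, j) (s (Y i) * invmx (\matrix_(i, j) ip (v i) (v j)) j i * s (Y j))),
  (fun y => 2 * p (q y) + 2 * r y).
split => //.
- split; first by apply: L1D; apply: L1Z.
  rewrite Rint_lin //.
  have Hr := Hq (Some None); rewrite /h /= in Hr.
  have HK := Hq None; rewrite /h /= in HK.
  (* With [delta <= tau] the weighted sums are at most [4 * tau] for [p (u x)] and [2 * tau] for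
     [r], hence [12 * tau] for [p (q x)]; its integral is at most [13 * tau], and
     [2 * 13 + 2 = 28]. *)
  have SK : \sum_a p (us a) <= 2 * (tau + delta).
    apply: le_trans Hs _; rewrite ler_pM2l //.
    rewrite (eq_bigr (fun a => w a * K2 (x a))).
      move: HK; rewrite ler_norml => /andP[_]; lra.
    move=> a _; rewrite /us /K2.
    have E : proj ip L (s a *: u (x a)) = s a *: proj ip L (u (x a)).
      rewrite /proj scaler_sumr; apply: eq_bigr => l _.
      by rewrite (ipZl lS Hip) ?scalerA //; case: oL.
    have Sr1 : S (u (x a) - proj ip L (u (x a))) by exact: res_in.
    by rewrite E -scalerBr (ipZl lS Hip) ?(ipZr lS Hip) ?mulrA ?ss //; exact: lin_closedZ.
  have Sr' : \sum_a w a * r (x a) <= tau + delta.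
    move: Hr; rewrite ler_norml => /andP[_]; lra.
  have : \sum_a w a * p (q (x a)) <= 2 * \sum_a p (us a) + 2 * \sum_a w a * r (x a).
    rewrite !mulr_sumr -big_split; apply: ler_sum => a _ /=.
    rewrite pZ; have := pD _ _ (Su (x a)) (lin_closedZ (-1) lS (Srr (x a))).
    rewrite scaleN1r pN // opprB addrCA subrr addr0 => H1.
    have := p_le _ (Srr (x a)); rewrite -/(r _) => H2.
    have := w0 a; nra.
  lra.
- move=> y; set z := \sum_i _.
  have -> : z = g (u y).
    rewrite /z /g /gproj; apply: eq_bigr => i _.
    rewrite scalerA; congr (_ *: _); rewrite mxE [RHS]mulrC mulr_sumr; apply: eq_bigr => j _.
    rewrite !mxE (ipZr lS Hip) //; ring.
  rewrite -/(p _); have := pD _ _ (Sq y) (Srr y); rewrite addrC subrK => H.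
  by apply: le_trans H _; rewrite lerD2l ler_pM2l //; exact: p_le.
Qed.

End SamplingTheorem.

(** * Prediction of Gaussian variables *)

Section Normal.
Variable R : realType.
Notation lam := (@lebesgue_measure R).

Lemma normal_pdfN0 (s x : R) : s != 0 ->
  normal_pdf 0 s x = normal_peak s * normal_fun 0 s x.
Proof. by rewrite /normal_pdf => /negbTE ->. Qed.

Lemma normal_pdf_scale (s z : R) : 0 < s ->
  normal_pdf 0 s (s * z) * s = normal_pdf 0 1 z.
Proof.
move=> s0; rewrite !normal_pdfN0 ?gt_eqF // /normal_fun !subr0.
have -> : - (s * z) ^+ 2 / (s ^+ 2 *+ 2) = - z ^+ 2 / (1 ^+ 2 *+ 2).
  by field; rewrite gt_eqF.
rewrite mulrAC; congr (_ * _); rewrite /normal_peak expr1n mul1r.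
rewrite -mulrnAr sqrtrM ?sqr_ge0 // sqrtr_sqr gtr0_norm //.
by rewrite invfM mulrC mulrA divff ?mul1r // gt_eqF.
Qed.

Lemma integral_normal_scale (s : R) (g : R -> R) : 0 < s -> continuous g ->
  (forall x, 0 <= g x) ->
  (\int[lam]_x (g x * normal_pdf 0 s x)%:E =
   \int[lam]_z (g (s * z) * normal_pdf 0 1 z)%:E)%E.
Proof.
move=> s0 cg g0; pose F (z : R^o) : R^o := s * z.
have F'E : F^`()%classic = cst s.
  apply/funext => x; rewrite /F derive1E deriveM // derive_cst scaler0 addr0.
  by rewrite derive_id; exact: mulr1.
rewrite (@increasing_ge0_integration_by_substitutionT _ F
   (fun x => g x * normal_pdf 0 s x)).
- apply: eq_integral => z _; congr (_%:E).
  by rewrite F'E !fctE /F -(normal_pdf_scale z s0) mulrA.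
- by move=> x y xy; rewrite /F ltr_pM2l.
- by rewrite F'E => ?; exact: cvg_cst.
- by rewrite F'E; exact: is_cvg_cst.
- by rewrite F'E; exact: is_cvg_cst.
- by move=> x; apply: derivableM.
- apply/gt0_cvgMrNy => //; exact: cvg_id.
- apply/gt0_cvgMry => //; exact: cvg_id.
- move=> x; apply: cvgM; first exact: cg.
  by apply: continuous_normal_pdf; rewrite gt_eqF.
- by move=> x; rewrite mulr_ge0 // normal_pdf_ge0.
Qed.

Definition gmoment n : \bar R := (\int[lam]_z (z ^+ n * normal_pdf 0 1 z)%:E)%E.

Lemma measurable_moment n : measurable_fun setT (fun z : R => (z ^+ n * normal_pdf 0 1 z)%:E).
Proof.
apply/measurable_EFinP; apply: measurable_funM; first exact: measurable_funX.
exact: measurable_normal_pdf.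
Qed.

Lemma gmoment2_gt0 : (0 < gmoment 2)%E.
Proof.
(* A lower bound of the integrand on [[1, 2]], where [z ^ 2 >= 1] and [z ^ 2 / 2 <= 2]. *)
pose c := normal_peak (1 : R) * expR (- 2).
have c0 : 0 < c by rewrite mulr_gt0 ?normal_peak_gt0 ?expR_gt0 ?oner_neq0.
apply: (@lt_le_trans _ _ (\int[lam]_(x in `[1%R, 2%R]) c%:E)%E).
  rewrite integral_cst //= lebesgue_measure_itv /= lte_fin ltr1n -EFinB -EFinM lte_fin.
  by rewrite mulr_gt0 //; lra.
rewrite /gmoment.
apply: (@le_trans _ _ (\int[lam]_(z in `[1%R, 2%R]) (z ^+ 2 * normal_pdf 0 1 z)%:E))%E.
  apply: ge0_le_integral => //=.
  - by move=> x _; rewrite lee_fin ltW.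
  - by apply: measurable_funTS; exact: measurable_moment.
  - move=> x; rewrite in_itv /= => /andP[x1 x2]; rewrite lee_fin.
    rewrite -[leLHS]mul1r ler_pM ?exprn_ege1 //; first exact: ltW.
    rewrite normal_pdfN0 ?oner_neq0 // /c ler_pM2l ?normal_peak_gt0 ?oner_neq0 //.
    rewrite /normal_fun ler_expR subr0 expr1n; nra.
apply: ge0_subset_integral => //; first exact: measurable_moment.
by move=> x _; rewrite lee_fin mulr_ge0 ?sqr_ge0 ?normal_pdf_ge0.
Qed.

Lemma gmoment4_lty : (gmoment 4 < +oo)%E.
Proof.
(* The exponential of [- z ^ 2 / 2] is that of [- z ^ 2 / 8], the profile of [normal_pdf 0 2], times
   the square of that of [- 3 / 16 * z ^ 2]; each of the two equal factors absorbs [z ^ 2] at the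
   price [16 / 3]. *)
pose C := (16 / 3) ^+ 2 * (normal_peak (1 : R) / normal_peak (2 : R)).
have p1 : 0 < normal_peak (1 : R) by rewrite normal_peak_gt0 ?oner_neq0.
have p2 : 0 < normal_peak (2 : R) by rewrite normal_peak_gt0 // gt_eqF.
have C0 : 0 <= C by rewrite mulr_ge0 ?sqr_ge0 // divr_ge0 // ltW.
apply: (@le_lt_trans _ _ (\int[lam]_z (C%:E * (normal_pdf 0 2 z)%:E))%E); last first.
  rewrite ge0_integralZl //; last 2 first.
    by apply/measurable_EFinP; exact: measurable_normal_pdf.
    by move=> x _; rewrite lee_fin normal_pdf_ge0.
  by rewrite integral_normal_pdf mule1 ltry.
apply: ge0_le_integral => //.
- by move=> z _; rewrite lee_fin mulr_ge0 ?normal_pdf_ge0 ?exprn_even_ge0.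
- exact: measurable_moment.
- by apply/measurable_EFinP; apply: measurable_funM => //; exact: measurable_normal_pdf.
move=> z _; rewrite -EFinM lee_fin !normal_pdfN0 ?oner_neq0 ?gt_eqF //.
rewrite /C /normal_fun !subr0.
have -> : - z ^+ 2 / (1 ^+ 2 *+ 2) =
    - z ^+ 2 / (2 ^+ 2 *+ 2) - (3 / 16 * z ^+ 2 + 3 / 16 * z ^+ 2) :> R.
  by field.
rewrite expRD expRN expRD.
set E := expR _; set e := expR (3 / 16 * _).
have e0 : 0 < e by exact: expR_gt0.
have E0 : 0 < E by exact: expR_gt0.
have le : 3 / 16 * z ^+ 2 <= e by apply: le_trans (expR_ge1Dx _); lra.
have -> : (16 / 3) ^+ 2 * (normal_peak 1 / normal_peak 2) * (normal_peak 2 * E) =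
  normal_peak 1 * E * (16 / 3) ^+ 2 by field; rewrite gt_eqF.
have -> : z ^+ 4 * (normal_peak 1 * (E / (e * e))) = normal_peak 1 * E * (z ^+ 4 / (e * e)).
  by field; rewrite gt_eqF.
rewrite ler_pM2l ?mulr_gt0 // ler_pdivrMr ?mulr_gt0 //.
have z2 := sqr_ge0 z; have -> : z ^+ 4 = z ^+ 2 * z ^+ 2 by ring.
have h : z ^+ 2 <= 16 / 3 * e by lra.
have -> : (16 / 3) ^+ 2 * (e * e) = (16 / 3 * e) * (16 / 3 * e) by ring.
by rewrite ler_pM.
Qed.

End Normal.

Section GaussianVariables.
Context d (O : measurableType d) (R : realType) (mu : probability O R).
Notation lam := (@lebesgue_measure R).

Definition gaussian_rv (L : O -> R) := measurable_fun setT L /\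
  exists s : R, 0 <= s /\
    forall A : set R, measurable A -> mu (L @^-1` A) = centered_normal s A.

Lemma gaussian_integral L : gaussian_rv L -> exists s : R, 0 <= s /\
  forall g : R -> R, continuous g -> (forall x, 0 <= g x) ->
  (\int[mu]_w (g (L w))%:E = \int[lam]_z (g (s * z) * normal_pdf 0 1 z)%:E)%E.
Proof.
move=> [mL [s [s0 law]]]; exists s; split => // g cg g0.
have mg : measurable_fun setT (fun x => (g x)%:E).
  by apply/measurable_EFinP; exact: continuous_measurable_fun.
have mL' : measurable_fun setT (L : O -> measurableTypeR R) by [].
pose mx := isMeasurableFun.Build _ _ _ _ _ mL'.
pose X : {mfun O >-> measurableTypeR R} := HB.pack (L : O -> measurableTypeR R) mx.
have mg' : measurable_fun setT (fun x : measurableTypeR R => (g x)%:E) by [].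
have -> : (\int[mu]_w (g (L w))%:E = \int[pushforward mu X]_x (g x)%:E)%E.
  by rewrite ge0_integral_pushforward // => y _; rewrite lee_fin.
(* The law is then a Dirac mass, and both sides are [g 0]. *)
have [s00|sn0] := eqVneq s 0.
  rewrite (@eq_measure_integral _ (measurableTypeR R) R setT (dirac (0 : measurableTypeR R))
    (pushforward mu X) (fun x => (g x)%:E)); last first.
    by move=> A mA _; apply: (etrans (law A mA)); rewrite /centered_normal s00 eqxx.
  rewrite integral_dirac // diracT mul1e s00.
  under eq_integral do rewrite mul0r EFinM.
  rewrite ge0_integralZl ?lee_fin //.
  - by rewrite integral_normal_pdf mule1.
  - by apply/measurable_EFinP; exact: measurable_normal_pdf.
  - by move=> x _; rewrite lee_fin normal_pdf_ge0.
rewrite (@eq_measure_integral _ (measurableTypeR R) R setT (normal_prob 0 s)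
  (pushforward mu X) (fun x => (g x)%:E)); last first.
  by move=> A mA _; apply: (etrans (law A mA)); rewrite /centered_normal (negbTE sn0).
have sp : 0 < s by rewrite lt_def sn0.
rewrite -integral_normal_scale //.
rewrite (@ge0_integral_density _ _ _ lam (fun x => (normal_pdf 0 s x)%:E)) //.
- by apply/measurable_EFinP; exact: measurable_normal_pdf.
- by move=> x; rewrite lee_fin normal_pdf_ge0.
Qed.

Let m2 := fine (gmoment R 2).
Let m4 := fine (gmoment R 4).

Let gm4 : gmoment R 4 = m4%:E.
Proof.
rewrite /m4 fineK // ge0_fin_numE ?gmoment4_lty //.
by apply: integral_ge0 => z _; rewrite lee_fin mulr_ge0 ?normal_pdf_ge0 ?exprn_even_ge0.
Qed.

Let gm2_lty : (gmoment R 2 < +oo)%E.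
Proof.
apply: (@le_lt_trans _ _ (\int[lam]_z ((normal_pdf 0 1 z)%:E + (z ^+ 4 * normal_pdf 0 1 z)%:E))%E).
  apply: ge0_le_integral => //.
  - by move=> z _; rewrite lee_fin mulr_ge0 ?normal_pdf_ge0 ?sqr_ge0.
  - exact: measurable_moment.
  - apply: emeasurable_funD; last exact: measurable_moment.
    by apply/measurable_EFinP; exact: measurable_normal_pdf.
  - move=> z _; rewrite -EFinD lee_fin.
    have := normal_pdf_ge0 0 1 z; set p := normal_pdf _ _ _ => p0.
    have -> : p + z ^+ 4 * p = (1 + z ^+ 4) * p by ring.
    rewrite ler_wpM2r //; have -> : z ^+ 4 = (z ^+ 2) ^+ 2 by ring.
    have := sqr_ge0 (z ^+ 2 - 1); nra.
rewrite ge0_integralD //.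
- rewrite integral_normal_pdf; have := gm4; rewrite /gmoment => ->.
  by rewrite -EFinD ltry.
- by move=> z _; rewrite lee_fin normal_pdf_ge0.
- by apply/measurable_EFinP; exact: measurable_normal_pdf.
- by move=> z _; rewrite lee_fin mulr_ge0 ?normal_pdf_ge0 ?exprn_even_ge0.
- exact: measurable_moment.
Qed.

Let gm2 : gmoment R 2 = m2%:E.
Proof. by rewrite /m2 fineK // ge0_fin_numE ?gm2_lty // ltW // gmoment2_gt0. Qed.

Let m2_gt0 : 0 < m2.
Proof. by rewrite -lte_fin -gm2 gmoment2_gt0. Qed.

Let scale_moment n (s : R) : ~~ odd n ->
  (\int[lam]_z ((s * z) ^+ n * normal_pdf 0 1 z)%:E = (s ^+ n)%:E * gmoment R n)%E.
Proof.
move=> n2; rewrite /gmoment -ge0_integralZl //.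
- by apply: eq_integral => z _; rewrite -EFinM exprMn mulrA.
- exact: measurable_moment.
- by move=> z _; rewrite lee_fin mulr_ge0 ?normal_pdf_ge0 ?exprn_even_ge0.
- by rewrite lee_fin exprn_even_ge0.
Qed.

Let continuous_exprn n : continuous (fun x : R => x ^+ n).
Proof. by move=> x; exact: exprn_continuous. Qed.

Lemma gaussian_scale L : gaussian_rv L -> exists s : R, [/\ 0 <= s,
  (\int[mu]_w (L w ^+ 2)%:E = (s ^+ 2 * m2)%:E)%E,
  (\int[mu]_w (L w ^+ 4)%:E = (s ^+ 4 * m4)%:E)%E &
  forall g : R -> R, continuous g -> (forall x, 0 <= g x) ->
  (\int[mu]_w (g (L w))%:E = \int[lam]_z (g (s * z) * normal_pdf 0 1 z)%:E)%E].
Proof.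
move=> gL; have [s [s0 H]] := gaussian_integral gL; exists s; split => //.
- rewrite (H (fun x => x ^+ 2)) ?scale_moment ?gm2 // => x; exact: sqr_ge0.
- rewrite (H (fun x => x ^+ 4)) ?scale_moment ?gm4 // => x; exact: exprn_even_ge0.
Qed.

Lemma gaussian_L2 L : gaussian_rv L -> L2 mu L.
Proof.
move=> gL; have [s [_ H _ _]] := gaussian_scale gL.
by split; [case: gL|rewrite H ltry].
Qed.

(** Both sides scale like [s ^ 4], so one [kappa] serves all [L]. This is what prevents an event of
    small probability from carrying most of a variance. *)
Lemma gaussian_moment4 : exists kappa : R, 0 <= kappa /\
  forall L, gaussian_rv L ->
   (\int[mu]_w (L w ^+ 4)%:E = (kappa * l2ip mu L L ^+ 2)%:E)%E.
Proof.
exists (m4 / m2 ^+ 2); split.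
  rewrite divr_ge0 ?sqr_ge0 // -lee_fin -gm4.
  by apply: integral_ge0 => z _; rewrite lee_fin mulr_ge0 ?normal_pdf_ge0 ?exprn_even_ge0.
move=> L gL; have [s [s0 H2 H4 _]] := gaussian_scale gL; rewrite H4; congr (_%:E).
have -> : l2ip mu L L = s ^+ 2 * m2.
  by apply: EFin_inj; rewrite l2ipK ?H2 //; exact: gaussian_L2.
by field; rewrite gt_eqF.
Qed.

Lemma gaussian_same_law L L' (g : R -> R) : gaussian_rv L -> gaussian_rv L' ->
  l2ip mu L L = l2ip mu L' L' -> continuous g -> (forall x, 0 <= g x) ->
  (\int[mu]_w (g (L w))%:E = \int[mu]_w (g (L' w))%:E)%E.
Proof.
move=> gL gL' E cg g0.
have [s [s0 H2 _ H]] := gaussian_scale gL; have [s' [s'0 H2' _ H']] := gaussian_scale gL'.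
rewrite H // H' //; suff -> : s = s' by [].
have : s ^+ 2 = s' ^+ 2.
  apply: (mulIf (lt0r_neq0 m2_gt0)); apply: EFin_inj; rewrite -H2 -H2'.
  by rewrite -!l2ipK ?E //; exact: gaussian_L2.
by move=> /eqP; rewrite eqrXn2 // => /eqP.
Qed.

End GaussianVariables.

Section StepLimit.
Variable R : realType.

Lemma bernoulli_inequality (x : R) n : -1 <= x -> 1 + n%:R * x <= (1 + x) ^+ n.
Proof.
move=> x1; elim: n => [|n IH]; first by rewrite mul0r addr0.
rewrite exprS; apply: (@le_trans _ _ ((1 + x) * (1 + n%:R * x))); last first.
  by rewrite ler_wpM2l //; lra.
rewrite -natr1; have : 0 <= n%:R * x ^+ 2 by rewrite mulr_ge0 ?sqr_ge0.
have -> : (1 + x) * (1 + n%:R * x) = 1 + (n%:R + 1) * x + n%:R * x ^+ 2 by ring.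
lra.
Qed.

Definition stepn (k : nat) (w : R) := (1 - w ^+ k) ^+ (2 ^ k).

Lemma stepn_bound k w : 0 <= w <= 1 -> 0 <= stepn k w <= 1.
Proof.
move=> /andP[w0 w1]; have wk0 : 0 <= w ^+ k by exact: exprn_ge0.
have wk1 : w ^+ k <= 1 by exact: exprn_ile1.
by apply/andP; split; [apply: exprn_ge0|apply: exprn_ile1]; lra.
Qed.

(* The polynomials used in the elementary proofs of the Stone-Weierstrass
   theorem to separate the two sides of [1/2]. *)
Lemma stepn_lt w : 0 <= w -> w < 2^-1 -> stepn k w @[k --> \oo] --> (1 : R).
Proof.
move=> w0 w2.
have h : `|2 * w| < 1 by rewrite ger0_norm; lra.
have wk k : 0 <= w ^+ k <= 1.
  by rewrite exprn_ge0 //= exprn_ile1 //; lra.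
apply: (@squeeze_cvgr _ _ _ _ (fun k => 1 - (2 * w) ^+ k) (fun=> 1)).
- apply: nearW => k; have /andP[k0 k1] := wk k; apply/andP; split.
    rewrite /stepn exprMn -natrX; have := @bernoulli_inequality (- w ^+ k) (2 ^ k).
    rewrite mulrN; apply; lra.
  by apply: exprn_ile1; lra.
- rewrite -[X in _ --> X]subr0; apply: cvgB; first exact: cvg_cst.
  exact: cvg_expr.
- exact: cvg_cst.
Qed.

Lemma stepn_gt w : 2^-1 < w -> w <= 1 -> stepn k w @[k --> \oo] --> (0 : R).
Proof.
move=> w2 w1; have w0 : 0 < w by lra.
have h : `|(2 * w)^-1| < 1.
  by rewrite ger0_norm ?invr_ge0 ?invf_lt1; lra.
apply: (@squeeze_cvgr _ _ _ _ (fun=> 0) (fun k => (2 * w)^-1 ^+ k)).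
- apply: nearW => k; have /andP[-> _] /= : 0 <= stepn k w <= 1.
    by apply: stepn_bound; lra.
  have wk0 : 0 < w ^+ k by exact: exprn_gt0.
  have wk1 : w ^+ k <= 1 by apply: exprn_ile1 => //; exact: ltW.
  (* With [x = w ^ k] and [N = 2 ^ k], the product of [(1 - x) ^ N] and [(1 + x) ^ N] is at most
     [1], while the second factor is at least [(2 * w) ^ k]. *)
  have H1 : 1 + (2 ^ k)%:R * w ^+ k <= (1 + w ^+ k) ^+ (2 ^ k) by apply: bernoulli_inequality; lra.
  have H2 : stepn k w * (1 + w ^+ k) ^+ (2 ^ k) <= 1.
    rewrite /stepn -exprMn; apply: exprn_ile1.
      by apply: mulr_ge0; lra.
    have := sqr_ge0 (w ^+ k); nra.
  have s0 : 0 <= stepn k w by apply: exprn_ge0; lra.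
  rewrite exprVn -div1r ler_pdivlMr ?exprn_gt0 ?mulr_gt0 // exprMn -natrX.
  apply: le_trans H2; rewrite ler_wpM2l //; apply: le_trans H1; lra.
- exact: cvg_cst.
- exact: cvg_expr.
Qed.

End StepLimit.

Section BoundedExpectation.
Context d (O : measurableType d) (R : realType) (mu : probability O R).
Implicit Types f g h : O -> R.

Definition bm g := measurable_fun setT g /\ exists K : R, forall w, `|g w| <= K.

Lemma bm_L1 g : bm g -> L1 mu g.
Proof.
move=> [mg [K gK]]; apply: (@L1_le _ _ _ _ _ (fun=> K)) => //.
exact: finite_measure_integrable_cst.
Qed.

Lemma bm_cst (c : R) : bm (fun=> c).
Proof. by split; [exact: measurable_cst|exists `|c|]. Qed.

Lemma bmM f g : bm f -> bm g -> bm (fun w => f w * g w).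
Proof.
move=> [mf [K fK]] [mg [K' gK]]; split; first exact: measurable_funM.
by exists (K * K') => w; rewrite normrM ler_pM.
Qed.

Lemma bmD f g : bm f -> bm g -> bm (fun w => f w + g w).
Proof.
move=> [mf [K fK]] [mg [K' gK]]; split; first exact: measurable_funD.
by exists (K + K') => w; rewrite (le_trans (ler_normD _ _)) // lerD.
Qed.

Lemma bm_sin f : measurable_fun setT f -> bm (fun w => sin (f w)).
Proof.
move=> mf; split.
  apply: measurableT_comp mf; apply: continuous_measurable_fun; exact: continuous_sin.
by exists 1 => w; rewrite ler_norml sin_geN1 sin_le1.
Qed.

Lemma bm_cos f : measurable_fun setT f -> bm (fun w => cos (f w)).
Proof.
move=> mf; split.
  apply: measurableT_comp mf; apply: continuous_measurable_fun; exact: continuous_cos.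
by exists 1 => w; rewrite ler_norml cos_geN1 cos_le1.
Qed.

Lemma Rintegral_lim0 (f_ : nat -> O -> R) f g :
  (forall n, measurable_fun setT (f_ n)) -> measurable_fun setT f ->
  L1 mu g -> (forall n w, `|f_ n w| <= g w) ->
  (forall w, f_ n w @[n --> \oo] --> f w) ->
  (forall n, \int[mu]_w f_ n w = 0) -> \int[mu]_w f w = 0.
Proof.
move=> mf_ mf Lg fg lim f0.
have [|||||Lf _ cv] := @dominated_convergence _ _ _ mu setT measurableT
  (fun n => EFin \o f_ n) (EFin \o f) (EFin \o g).
- by move=> n; exact/measurable_EFinP.
- exact/measurable_EFinP.
- by apply: aeW => w _; apply: cvg_EFin; [exact: nearW|exact: lim].
- exact: Lg.
- by apply: aeW => w n _; rewrite /= lee_fin.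
have E n : (\int[mu]_w (f_ n w)%:E = 0)%E.
  rewrite -RintegralK ?f0 //; apply: L1_le Lg => //; exact: mf_.
apply: EFin_inj; rewrite RintegralK //.
have cv0 : (\int[mu]_w (EFin \o f_ n) w)%E @[n --> \oo] --> (0 : \bar R)%E.
  under eq_fun do rewrite E; exact: cvg_cst.
exact: (cvg_unique _ cv cv0).
Qed.

End BoundedExpectation.

Section Regression.
Context d (O : measurableType d) (R : realType) (mu : probability O R).
Variable Gc : (O -> R) -> Prop.
Hypotheses (lG : @lin_closed R (O -> R) Gc) (gG : forall v, Gc v -> gaussian_rv mu v).
Variable M : O -> R.
Hypothesis GM : Gc M.

Let E f := \int[mu]_w f w.
Let lS := L2_lin_closed mu.
Let Hip := l2_pre_ip mu.
Let L2G v : Gc v -> L2 mu v. Proof. by move=> /gG; exact: gaussian_L2. Qed.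
Let mG v : Gc v -> measurable_fun setT v. Proof. by move=> /gG[]. Qed.

Definition uncorr (v : O -> R) := Gc v /\ l2ip mu M v = 0.

Lemma uncorr_lin_closed : @lin_closed R (O -> R) uncorr.
Proof.
have SM := L2G GM; split; first by split; [case: lG|rewrite (ipC Hip) // ?(ip0l lS Hip) //; case: lS].
move=> a u v [Gu u0] [Gv v0]; split; first by case: lG => _; exact.
have Su := L2G Gu; have Sv := L2G Gv.
by rewrite (ipDr lS Hip) ?(ipZr lS Hip) ?u0 ?v0 ?mulr0 ?addr0 //; exact: (lin_closedZ _ lS).
Qed.

Let E1D f : L1 mu f -> E (fun w => 1 + f w) = 1 + E f.
Proof.
move=> Lf; rewrite /E RintegralD' //; last exact: finite_measure_integrable_cst.
by rewrite Rintegral_cst // mul1r (congr1 fine (probability_setT mu)).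
Qed.

Lemma gaussian_same_Rint u v (g : R -> R) : Gc u -> Gc v -> l2ip mu u u = l2ip mu v v ->
  continuous g -> (forall x, -1 <= g x <= 1) -> E (g \o u) = E (g \o v).
Proof.
move=> Gu Gv uv cg g1.
have bg w : Gc w -> L1 mu (g \o w).
  move=> Gw; apply: bm_L1; split.
    by apply: measurableT_comp; [exact: continuous_measurable_fun|exact: mG].
  by exists 1 => x; rewrite ler_norml; exact: g1.
(* Adding [1] makes [g] nonnegative, as [gaussian_same_law] demands. *)
have := @gaussian_same_law _ _ _ mu u v (fun x => 1 + g x) (gG Gu) (gG Gv) uv.
have cg1 : continuous (fun x => 1 + g x) by move=> x; apply: cvgD; [exact: cvg_cst|exact: cg].
move=> /(_ cg1); have g0 x : 0 <= 1 + g x by have /andP[] := g1 x; lra.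
move=> /(_ g0) H; apply: (addrI 1).
rewrite -!E1D; [|exact: bg|exact: bg].
by rewrite /E /Rintegral /= H.
Qed.

(** [v] and [- v] have equal variance, hence equal law, and [sin] is odd. *)
Lemma E_sin_gaussian v : Gc v -> E (fun w => sin (v w)) = 0.
Proof.
move=> Gv; have GNv : Gc (- v) by rewrite -scaleN1r; exact: (lin_closedZ _ lG).
have vv : l2ip mu v v = l2ip mu (- v) (- v).
  by apply: eq_Rintegral => w _; rewrite [(- v) w](_ : _ = - v w) // mulrNN.
have /= H := @gaussian_same_Rint v (- v) sin Gv GNv vv (@continuous_sin R)
  (fun x => introT andP (conj (sin_geN1 x) (sin_le1 x))).
have HN : E (sin \o (- v)) = - E (sin \o v).
  have -> : sin \o (- v) = (fun w => -1 * sin (v w)).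
    by apply/funext => w; rewrite /= mulN1r -sinN.
  by rewrite /E RintegralZl ?mulN1r //; apply: bm_L1; apply: bm_sin; exact: mG.
have : E (sin \o v) = - E (sin \o v) by rewrite -HN.
rewrite -[E (fun w => _)]/(E (sin \o v)); lra.
Qed.

(* [inH] and [mulH] stand in for "[g] depends on the uncorrelated observations
   only", without conditional expectations: by joint normality [M] is independent
   of every uncorrelated [v], and the odd function [sin (s * M)] has mean zero. *)
Definition inH (g : O -> R) := bm g /\ forall v s, uncorr v ->
  E (fun w => g w * cos (v w) * sin (s * M w)) = 0 /\
  E (fun w => g w * sin (v w) * sin (s * M w)) = 0.

Definition mulH (h : O -> R) := bm h /\ forall g, inH g -> inH (fun w => g w * h w).

Let Gadd v s : Gc v -> Gc (fun w => v w + s * M w).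
Proof.
move=> Gv; have -> : (fun w => v w + s * M w) = s *: M + v.
  by apply/funext => w; rewrite addrC.
by case: lG => _; exact.
Qed.

(** By product-to-sum formulas, [cos v * sin (s * M)] is a difference of sines of Gaussian
    variables, each of mean zero, and [sin v * sin (s * M)] a difference of cosines of [v - s * M]
    and [v + s * M]. These two have the same variance because [v] and [M] are uncorrelated. Joint
    normality enters here, as closure of [Gc] under combinations. *)
Lemma inH1 : inH (fun=> 1).
Proof.
split; first exact: bm_cst.
move=> v s [Gv Mv].
have Gp := Gadd s Gv; have Gm := Gadd (- s) Gv.
have Lp f : L2 mu f -> f = f by [].
have [bsp bcp] : bm (fun w => sin (v w + s * M w)) /\ bm (fun w => cos (v w + s * M w)).
  by split; [apply: bm_sin|apply: bm_cos]; exact: mG.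
have [bsm bcm] : bm (fun w => sin (v w + - s * M w)) /\ bm (fun w => cos (v w + - s * M w)).
  by split; [apply: bm_sin|apply: bm_cos]; exact: mG.
split.
  have -> : (fun w => 1 * cos (v w) * sin (s * M w)) =
      (fun w => 2^-1 * (sin (v w + s * M w) - sin (v w + - s * M w))).
    by apply/funext => w; rewrite mulNr sinB sinD; field.
  rewrite /E RintegralZl //.
    by rewrite RintegralB //; [|exact: bm_L1|exact: bm_L1];
      rewrite -!/(E _) !E_sin_gaussian // subr0 mulr0.
  apply: bm_L1; have := bmD bsp (bmM (bm_cst _ (-1)) bsm).
  by under eq_fun do rewrite mulN1r.
have -> : (fun w => 1 * sin (v w) * sin (s * M w)) =
    (fun w => 2^-1 * (cos (v w + - s * M w) - cos (v w + s * M w))).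
  by apply/funext => w; rewrite mulNr cosB cosD; field.
rewrite /E RintegralZl //.
  rewrite RintegralB //; [|exact: bm_L1|exact: bm_L1].
  rewrite -!/(E _) (@gaussian_same_Rint _ (fun w => v w + s * M w) cos Gm Gp).
  - by rewrite subrr mulr0.
  - have ex t : l2ip mu (fun w => v w + t * M w) (fun w => v w + t * M w) =
       t * t * l2ip mu M M + l2ip mu v v.
      have -> : (fun w => v w + t * M w) = v + t *: M by [].
      have SM := L2G GM; have Sv := L2G Gv; have StM := lin_closedZ t lS SM.
      rewrite (nrmD lS Hip) // (ipZr lS Hip) // (ipZl lS Hip) // (ipZr lS Hip) //.
      by rewrite (ipC Hip Sv SM) Mv; ring.
    by rewrite !ex mulrNN.
  - exact: continuous_cos.
  - by move=> x; rewrite cos_geN1 cos_le1.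
apply: bm_L1; have := bmD bcm (bmM (bm_cst _ (-1)) bcp).
by under eq_fun do rewrite mulN1r.
Qed.

Lemma inH_lin a g h : inH g -> inH h -> inH (fun w => a * g w + h w).
Proof.
move=> [bg Hg] [bh Hh]; split; first by apply: bmD => //; exact: bmM (bm_cst _ _) _.
move=> v s uv; have [g1 g2] := Hg v s uv; have [h1 h2] := Hh v s uv.
have bs : bm (fun w => sin (s * M w)).
  by apply: bm_sin; apply: measurable_funM => //; exact: mG.
have bv : bm (fun w => cos (v w)) by apply: bm_cos; apply: mG; case: uv.
have bv' : bm (fun w => sin (v w)) by apply: bm_sin; apply: mG; case: uv.
have L f k : bm f -> bm k -> L1 mu (fun w => f w * k w * sin (s * M w)).
  by move=> bf bk; apply: bm_L1; do 2 (apply: bmM => //).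
split.
  have -> : (fun w => (a * g w + h w) * cos (v w) * sin (s * M w)) =
     (fun w => a * (g w * cos (v w) * sin (s * M w)) + h w * cos (v w) * sin (s * M w)).
    by apply/funext => w; ring.
  rewrite /E RintegralD' ?RintegralZl -?/(E _) ?g1 ?h1 ?mulr0 ?addr0 //; try exact: L.
  by apply: L1Z; exact: L.
have -> : (fun w => (a * g w + h w) * sin (v w) * sin (s * M w)) =
   (fun w => a * (g w * sin (v w) * sin (s * M w)) + h w * sin (v w) * sin (s * M w)).
  by apply/funext => w; ring.
rewrite /E RintegralD' ?RintegralZl -?/(E _) ?g2 ?h2 ?mulr0 ?addr0 //; try exact: L.
by apply: L1Z; exact: L.
Qed.

Lemma inH_lim (g_ : nat -> O -> R) (g : O -> R) (K : R) : (forall n, inH (g_ n)) ->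
  (forall n w, `|g_ n w| <= K) -> (forall w, g_ n w @[n --> \oo] --> g w) -> inH g.
Proof.
move=> Hg gK lim; have mg_ n : measurable_fun setT (g_ n) by case: (Hg n) => -[].
have mg : measurable_fun setT g by apply: measurable_fun_cvg mg_ _ => w _; exact: lim.
have gK' w : `|g w| <= K.
  have c : `|g_ n w| @[n --> \oo] --> `|g w| by apply: cvg_norm; exact: lim.
  rewrite -(cvg_lim _ c) //.
  by apply: limr_le; [apply/cvg_ex; eexists; exact: c|exact: nearW].
split; first by split => //; exists K.
move=> v s uv.
have ms : measurable_fun setT (fun w => sin (s * M w)).
  by have [] : bm (fun w => sin (s * M w)) by apply: bm_sin; apply: measurable_funM => //; exact: mG.
have mc : measurable_fun setT (fun w => cos (v w)).
  by have [] : bm (fun w => cos (v w)) by apply: bm_cos; apply: mG; case: uv.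
have msv : measurable_fun setT (fun w => sin (v w)).
  by have [] : bm (fun w => sin (v w)) by apply: bm_sin; apply: mG; case: uv.
have b1 (x y z : R) : `|x| <= K -> `|y| <= 1 -> `|z| <= 1 -> `|x * y * z| <= K.
  move=> xK y1 z1; rewrite !normrM -[K]mulr1 -[K]mulr1 ler_pM ?mulr_ge0 //.
  by rewrite ler_pM.
have LK : L1 mu (fun=> K) by exact: finite_measure_integrable_cst.
have s1 x : `|sin x| <= (1 : R) by rewrite ler_norml sin_geN1 sin_le1.
have c1 x : `|cos x| <= (1 : R) by rewrite ler_norml cos_geN1 cos_le1.
split.
- apply: (@Rintegral_lim0 _ _ _ _ (fun n w => g_ n w * cos (v w) * sin (s * M w)) _ (fun=> K)) => //.
  + by move=> n; do 2 apply: measurable_funM => //.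
  + by do 2 apply: measurable_funM => //.
  + by move=> n w; apply: b1.
  + by move=> w; do 2 (apply: cvgM; last exact: cvg_cst); exact: lim.
  + by move=> n; case: (Hg n) => _ /(_ v s uv)[].
- apply: (@Rintegral_lim0 _ _ _ _ (fun n w => g_ n w * sin (v w) * sin (s * M w)) _ (fun=> K)) => //.
  + by move=> n; do 2 apply: measurable_funM => //.
  + by do 2 apply: measurable_funM => //.
  + by move=> n w; apply: b1.
  + by move=> w; do 2 (apply: cvgM; last exact: cvg_cst); exact: lim.
  + by move=> n; case: (Hg n) => _ /(_ v s uv)[].
Qed.

Lemma inH_eq g h : g =1 h -> inH g -> inH h.
Proof. by move=> /funext ->. Qed.

Lemma mulH_eq g h : g =1 h -> mulH g -> mulH h.
Proof. by move=> /funext ->. Qed.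

Lemma mulH_inH h : mulH h -> inH h.
Proof. by move=> [_ /(_ _ inH1)]; apply: inH_eq => w; rewrite mul1r. Qed.

Lemma mulH1 : mulH (fun=> 1).
Proof.
by split; [exact: bm_cst|move=> g; apply: inH_eq => w; rewrite mulr1].
Qed.

Lemma mulH_lin a g h : mulH g -> mulH h -> mulH (fun w => a * g w + h w).
Proof.
move=> [bg Hg] [bh Hh]; split; first by apply: bmD => //; exact: bmM (bm_cst _ _) _.
move=> f Hf; apply: inH_eq (inH_lin a (Hg f Hf) (Hh f Hf)) => w; ring.
Qed.

Lemma mulH_cst c : mulH (fun=> c).
Proof.
by apply: mulH_eq (mulH_lin (c - 1) mulH1 mulH1) => w; ring.
Qed.

(** Products are the reason for passing to multipliers: the identities defining [inH] are linear in
    [g], whereas multipliers compose. *)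
Lemma mulHM g h : mulH g -> mulH h -> mulH (fun w => g w * h w).
Proof.
move=> [bg Hg] [bh Hh]; split; first exact: bmM.
by move=> f Hf; apply: inH_eq (Hh _ (Hg f Hf)) => w; rewrite mulrA.
Qed.

Lemma mulHX g n : mulH g -> mulH (fun w => g w ^+ n).
Proof.
move=> Hg; elim: n => [|n IH]; first exact: mulH1.
by apply: mulH_eq (mulHM Hg IH) => w; rewrite exprS.
Qed.

Lemma mulH_lim (g_ : nat -> O -> R) (g : O -> R) (K : R) : (forall n, mulH (g_ n)) ->
  (forall n w, `|g_ n w| <= K) -> (forall w, g_ n w @[n --> \oo] --> g w) -> mulH g.
Proof.
move=> Hg gK lim; split.
  by have [] := inH_lim (fun n => mulH_inH (Hg n)) gK lim.
move=> f Hf; have [[mf [Kf fK]] _] := Hf.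
apply: (@inH_lim (fun n w => f w * g_ n w) _ (Kf * K)).
- by move=> n; case: (Hg n) => _; exact.
- by move=> n w; rewrite normrM ler_pM.
- by move=> w; apply: cvgM; [exact: cvg_cst|exact: lim].
Qed.

Let uncorrD u v : uncorr u -> uncorr v -> uncorr (fun w => u w + v w).
Proof. by move=> uu uv; exact: (lin_closedD uncorr_lin_closed uu uv). Qed.

Let uncorrB u v : uncorr u -> uncorr v -> uncorr (fun w => u w - v w).
Proof. by move=> uu uv; exact: (lin_closedB uncorr_lin_closed uu uv). Qed.

(** Multiplication by [cos u] or [sin u] turns trigonometric functions of [v] into those of [v + u]
    and [v - u], which are again uncorrelated with [M]. *)
Lemma mulH_trig u : uncorr u -> mulH (fun w => cos (u w)) /\ mulH (fun w => sin (u w)).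
Proof.
move=> uu; have mu_ := mG (proj1 uu).
have bc := bm_cos mu_; have bs := bm_sin mu_.
have comb0 a b F G f : bm F -> bm G -> E F = 0 -> E G = 0 ->
    (forall w, f w = a * F w + b * G w) -> E f = 0.
  move=> bF bG F0 G0 /funext ->; have LF := bm_L1 mu bF; have LG := bm_L1 mu bG.
  by rewrite /E Rint_lin // -!/(E _) F0 G0 !mulr0 addr0.
have bt v s : uncorr v -> bm (fun w => cos (v w)) /\ bm (fun w => sin (v w)) /\
    bm (fun w => sin (s * M w)).
  move=> uv; split; first by apply: bm_cos; apply: mG; case: uv.
  split; apply: bm_sin; first by apply: mG; case: uv.
  by apply: measurable_funM => //; exact: mG.
split; split => // g [bg Hg]; (split; first exact: bmM) => v s uv.
- have up := uncorrD uv uu; have um := uncorrB uv uu.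
  have [bcp [bsp bM]] := bt _ s up; have [bcm [bsm _]] := bt _ s um.
  have [cp sp] := Hg _ s up; have [cm sm] := Hg _ s um.
  split.
    apply: (comb0 2^-1 2^-1 _ _ _ _ _ cp cm); try by do 2 apply: bmM => //.
    by move=> w; rewrite cosD cosB; field.
  apply: (comb0 2^-1 2^-1 _ _ _ _ _ sp sm); try by do 2 apply: bmM => //.
  by move=> w; rewrite sinD sinB; field.
- have up := uncorrD uv uu; have um := uncorrB uv uu.
  have [bcp [bsp bM]] := bt _ s up; have [bcm [bsm _]] := bt _ s um.
  have [cp sp] := Hg _ s up; have [cm sm] := Hg _ s um.
  split.
    apply: (comb0 2^-1 (- 2^-1) _ _ _ _ _ sp sm); try by do 2 apply: bmM => //.
    by move=> w; rewrite sinD sinB; field.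
  apply: (comb0 (- 2^-1) 2^-1 _ _ _ _ _ cp cm); try by do 2 apply: bmM => //.
  by move=> w; rewrite cosD cosB; field.
Qed.

Lemma mulH_sin_affine u (a t : R) : uncorr u -> mulH (fun w => sin (t * (u w - a))).
Proof.
move=> uu; have ut : uncorr (fun w => t * u w) by exact: (lin_closedZ t uncorr_lin_closed uu).
have [Hc Hs] := mulH_trig ut.
apply: mulH_eq (mulH_lin (- sin (t * a)) Hc (mulHM (mulH_cst (cos (t * a))) Hs)) => w.
by rewrite mulrBr sinB; ring.
Qed.

(** Polynomials in [sin (t * (u - b))] converge to a step function of this sine. At low frequency
    [t = 1 / (n + 1)] its sign is eventually that of [u - b], and letting [b] decrease to [a]
    settles the value at [u = a]. *)
Lemma mulH_gt u (a : R) : uncorr u -> mulH (fun w => (a < u w)%R%:R).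
Proof.
move=> uu.
pose p (b t : R) k w := 1 - stepn k ((1 + sin (t * (u w - b))) / 2).
have w01 (x : R) : 0 <= (1 + sin x) / 2 <= 1.
  by have := sin_geN1 x; have := sin_le1 x => *; apply/andP; split; lra.
have Hp b t k : mulH (p b t k).
  have Hw : mulH (fun w => (1 + sin (t * (u w - b))) / 2).
    apply: mulH_eq (mulH_lin 2^-1 (mulH_sin_affine b t uu) (mulH_cst 2^-1)) => w.
    by field.
  have H1 : mulH (fun w => 1 - ((1 + sin (t * (u w - b))) / 2) ^+ k).
    by apply: mulH_eq (mulH_lin (-1) (mulHX k Hw) (mulH_cst 1)) => w; ring.
  apply: mulH_eq (mulH_lin (-1) (mulHX (2 ^ k) H1) (mulH_cst 1)) => w.
  by rewrite /p /stepn; ring.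
(* The value taken where the sine vanishes. [stepn k 2^-1] is [(1 - 2^-k) ^ (2 ^ k)], which
   increases; its limit [kap] disappears when [b] tends to [a]. *)
pose kap : R := lim (stepn k 2^-1 @[k --> \oo]).
have nd : {homo (fun k => stepn k (2^-1 : R)) : n m / (n <= m)%N >-> n <= m}.
  apply: homo_leq => //; first by move=> x y z; exact: le_trans.
  move=> k; rewrite /stepn expnS exprM.
  have h0 : 0 <= (2^-1 : R) ^+ k.+1 by apply: exprn_ge0; lra.
  have h1 : (2^-1 : R) ^+ k.+1 = 2^-1 * 2^-1 ^+ k by rewrite exprS.
  have h2 : (2^-1 : R) ^+ k <= 1 by apply: exprn_ile1; lra.
  apply: lerXn2r; rewrite ?nnegrE ?sqr_ge0 //; first by lra.
  have := sqr_ge0 ((2^-1 : R) ^+ k.+1); rewrite h1; nra.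
have ckap : stepn k 2^-1 @[k --> \oo] --> kap.
  apply: nondecreasing_is_cvgn => //; exists 1 => _ [k _ <-].
  by have /andP[] : 0 <= stepn k (2^-1 : R) <= 1 by apply: stepn_bound; lra.
pose chi (x : R) : R := if 0 < x then 1 else if x < 0 then 0 else 1 - kap.
have kap01 : 0 <= kap <= 1.
  have ck : cvgn (fun k => stepn k (2^-1 : R)) by apply/cvg_ex; exists kap.
  apply/andP; split; [apply: limr_ge => //|apply: limr_le => //]; apply: nearW => k;
    by have /andP[] : 0 <= stepn k (2^-1 : R) <= 1 by apply: stepn_bound; lra.
have chi1 x : `|chi x| <= 1.
  rewrite /chi; case: ifP => _; first by rewrite normr1.
  case: ifP => _; first by rewrite normr0.
  by rewrite ler_norml; move: kap01 => /andP[? ?]; apply/andP; split; lra.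
have Hchi b t : mulH (fun w => chi (sin (t * (u w - b)))).
  apply: (@mulH_lim (p b t) _ 1) => [k|k w|w]; first exact: Hp.
    have /andP[? ?] := stepn_bound k (w01 (t * (u w - b))).
    by rewrite ler_norml; apply/andP; split; rewrite /p; lra.
  have /andP[? ?] := w01 (t * (u w - b)).
  rewrite /chi; case: ltrgt0P => s0.
  - rewrite -[X in _ --> X]subr0; apply: cvgB; first exact: cvg_cst.
    by apply: stepn_gt => //; lra.
  - rewrite -[X in _ --> X](subrr 1); apply: cvgB; first exact: cvg_cst.
    by apply: stepn_lt => //; lra.
  - apply: cvgB; first exact: cvg_cst.
    by rewrite /p s0 addr0 mul1r; exact: ckap.
pose phi (b x : R) : R := if b < x then 1 else if x < b then 0 else 1 - kap.
have phi1 b x : `|phi b x| <= 1.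
  by have := chi1 (x - b); rewrite /chi /phi subr_gt0 subr_lt0.
have small (x : R) : 0 < x -> \forall n \near \oo, n.+1%:R^-1 * x < pi.
  move=> x0; near=> n.
  rewrite mulrC ltr_pdivrMr ?ltr0n // -ltr_pdivrMl ?pi_gt0 //.
  apply: lt_trans (_ : n%:R < _); last by rewrite ltr_nat.
  near: n; exact: nbhs_infty_gtr.
have Hphi b : mulH (fun w => phi b (u w)).
  apply: (@mulH_lim (fun n w => chi (sin (n.+1%:R^-1 * (u w - b)))) _ 1) => [n|n w|w].
  - exact: Hchi.
  - exact: chi1.
  - apply: cvg_near_cst; rewrite /phi; case: ltrgtP => ub.
    + have := small (u w - b); rewrite subr_gt0 => /(_ ub); apply: filterS => n h.
      rewrite /chi sin_gt0_pi // h andbT mulr_gt0 ?subr_gt0 ?invr_gt0 ?ltr0n //.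
    + have := small (b - u w); rewrite subr_gt0 => /(_ ub); apply: filterS => n h.
      have s0 : 0 < sin (n.+1%:R^-1 * (b - u w)).
        by rewrite sin_gt0_pi // h andbT mulr_gt0 ?subr_gt0 ?invr_gt0 ?ltr0n.
      have -> : n.+1%:R^-1 * (u w - b) = - (n.+1%:R^-1 * (b - u w)) by ring.
      by rewrite sinN /chi oppr_gt0 oppr_lt0 s0 ltNge ltW.
    + by apply: nearW => n; rewrite ub subrr mulr0 sin0 /chi ltxx.
apply: (@mulH_lim (fun n w => phi (a + n.+1%:R^-1) (u w)) _ 1) => [n|n w|w].
- exact: Hphi.
- exact: phi1.
- apply: cvg_near_cst; case: ltP => ua.
    have : 0 < u w - a by rewrite subr_gt0.
    move=> h; near=> n; rewrite /phi.
    suff -> : a + n.+1%:R^-1 < u w by [].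
    rewrite -ltrBrDl; near: n; exact: near_infty_natSinv_lt (PosNum h).
  apply: nearW => n; rewrite /phi.
  have h : u w < a + n.+1%:R^-1 by rewrite (le_lt_trans ua) // ltrDl invr_gt0 ltr0n.
  by rewrite h ltNge ltW.
Unshelve. all: by end_near. Qed.

(** Events whose indicators are multipliers. They form a sigma-algebra for which all uncorrelated
    variables are measurable, so measurability can take over the role of conditioning. *)
Definition sigset (A : set O) := measurable A /\ mulH (\1_A : O -> R).

Lemma sigset_sigma : sigma_algebra setT sigset.
Proof.
have SC A : sigset A -> sigset (~` A).
  move=> [mA HA]; split; first exact: measurableC.
  apply: mulH_eq (mulH_lin (-1) HA (mulH_cst 1)) => w.
  by rewrite !indicE in_setC; case: (w \in A) => /=; ring.
have S0 : sigset set0.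
  split; first exact: measurable0.
  by apply: mulH_eq (mulH_cst 0) => w; rewrite indic0.
have SU A B : sigset A -> sigset B -> sigset (A `|` B).
  move=> [mA HA] [mB HB]; split; first exact: measurableU.
  apply: mulH_eq (mulH_lin 1 HA (mulH_lin (-1) (mulHM HA HB) HB)) => w.
  by rewrite !indicE in_setU; case: (w \in A); case: (w \in B) => /=; ring.
split => //.
  by move=> A; rewrite setTD; exact: SC.
move=> A SA; split; first by apply: bigcup_measurable => k _; case: (SA k).
have Sn n : sigset (\big[setU/set0]_(i < n) A i).
  by elim: n => [|n IH]; rewrite ?big_ord0 // big_ord_recr; exact: SU.
apply: (@mulH_lim (fun n => \1_(\big[setU/set0]_(i < n) A i)) _ 1).
- by move=> n; case: (Sn n).
- by move=> n w; rewrite indicE; case: (w \in _); rewrite ?normr1 ?normr0.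
- move=> w; apply: cvg_near_cst; have [|wA] := pselect ((\bigcup_k A k) w).
    move=> [k _ Akw]; exists k.+1 => // n /= kn; rewrite !indicE; congr (_%:R).
    congr (nat_of_bool _); apply/idP/idP => _; apply/mem_set; first by exists k.
    by rewrite -bigcup_mkord; exists k.
  apply: nearW => n; rewrite !indicE !memNset //.
  by apply: contra_not wA; rewrite -bigcup_mkord => -[k _ Akw]; exists k.
Qed.

Lemma sigset_gt u a : uncorr u -> sigset [set w | a < u w].
Proof.
move=> uu; split.
  have := mG (proj1 uu) measurableT (measurable_itv `]a, +oo[); rewrite setTI.
  congr measurable; apply/seteqP; split => w /=; by rewrite in_itv /= andbT.
apply: mulH_eq (mulH_gt a uu) => w; rewrite indicE; congr (_%:R); congr (nat_of_bool _).
by apply/idP/idP => [h|/set_mem //]; apply/mem_set.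
Qed.

Lemma layer_sum (h v : R) N : 0 <= h -> 0 <= v -> v <= N%:R * h ->
  v <= \sum_(j < N) h * (j%:R * h < v)%R%:R <= v + h.
Proof.
move=> h0 v0 vN; suff H n : Num.min v (n%:R * h) <= \sum_(j < n) h * (j%:R * h < v)%R%:R
    <= Num.min (v + h) (n%:R * h).
  have /andP[h1 h2] := H N; apply/andP; split.
    by apply: le_trans h1; rewrite le_min lexx.
  by apply: le_trans h2 _; rewrite ge_min lexx.
elim: n => [|n /andP[IH1 IH2]].
  by rewrite big_ord0 mul0r min_r // min_r ?lexx //; lra.
rewrite big_ord_recr /= -natr1; move: IH1 IH2; set S := \sum_(_ < _) _.
rewrite !le_min !ge_min; have nh : 0 <= n%:R * h by rewrite mulr_ge0.
set m := n%:R * h in nh *; have -> : (n%:R + 1) * h = m + h by rewrite mulrDl mul1r.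
case: ltP => c /=; rewrite ?mulr1 ?mulr0 => /orP[] H1 /andP[H2 H3];
  apply/andP; split; try (apply/andP; split); try (apply/orP; (left; lra) || (right; lra)); lra.
Qed.

(** A uniform approximation from above by layers [j * h N < phi + c], each an event of [sigset]. The
    shift by [c] makes the function nonnegative, of height at most [2 * c]. *)
Lemma mulH_comp (Y : O -> R) (phi : R -> R) (c : R) :
  (forall B, measurable B -> sigset (Y @^-1` B)) -> measurable_fun setT phi ->
  0 < c -> (forall y, `|phi y| <= c) -> mulH (fun w => phi (Y w)).
Proof.
move=> SY mphi c0 phic.
pose h N := 2 * c / N.+1%:R.
have h0 N : 0 <= h N by rewrite divr_ge0 ?ler0n // mulr_ge0 // ltW.
have hN N : N.+1%:R * h N = 2 * c by rewrite /h mulrC divfK.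
pose f N w := -c + \sum_(j < N.+1) h N * (j%:R * h N < phi (Y w) + c)%R%:R.
have fb N w : phi (Y w) <= f N w <= phi (Y w) + h N.
  have := phic (Y w); rewrite ler_norml => /andP[p1 p2].
  have /andP[l1 l2] : phi (Y w) + c <= \sum_(j < N.+1) h N * (j%:R * h N < phi (Y w) + c)%R%:R
      <= phi (Y w) + c + h N.
    by apply: layer_sum => //; [lra|rewrite hN; lra].
  by rewrite /f; apply/andP; split; lra.
apply: (@mulH_lim f _ (3 * c)).
- move=> N; have Hj j : mulH (fun w => (j%:R * h N < phi (Y w) + c)%R%:R).
    have [] := SY [set y | j%:R * h N < phi y + c].
      have := measurable_funD mphi (measurable_cst c) measurableT (measurable_itv `]j%:R * h N, +oo[).
      rewrite setTI; congr measurable; apply/seteqP; split => y /=; by rewrite in_itv /= andbT.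
    move=> _; apply: mulH_eq => w; rewrite indicE; congr (_%:R); congr (nat_of_bool _).
    by apply/idP/idP => [/set_mem //|hh]; apply/mem_set.
  rewrite /f; have Hs m : mulH (fun w => \sum_(j < m) h N * (j%:R * h N < phi (Y w) + c)%R%:R).
    elim: m => [|m IH]; first by apply: mulH_eq (mulH_cst 0) => w; rewrite big_ord0.
    by apply: mulH_eq (mulH_lin (h N) (Hj m) IH) => w; rewrite big_ord_recr /= addrC.
  by apply: mulH_eq (mulH_lin 1 (mulH_cst (- c)) (Hs N.+1)) => w; rewrite mul1r.
- move=> N w; have /andP[l1 l2] := fb N w; have := phic (Y w); rewrite ler_norml => /andP[p1 p2].
  have hc : h N <= 2 * c by rewrite ler_pdivrMr ?ltr0n // ler_peMr ?ler1n // mulr_ge0 // ltW.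
  by rewrite ler_norml; apply/andP; split; lra.
- move=> w; apply: (@squeeze_cvgr _ _ _ _ (fun=> phi (Y w)) (fun N => phi (Y w) + h N)).
  + by apply: nearW => N; exact: fb.
  + exact: cvg_cst.
  + rewrite -[X in _ --> X]addr0; apply: cvgD; first exact: cvg_cst.
    rewrite -[X in _ --> X](mulr0 (2 * c)); apply: cvgM; first exact: cvg_cst.
    exact: cvg_harmonic.
Qed.

Lemma sin_near0 (x : R) : `|sin x| <= `|x| /\ `|sin x - x| <= x ^+ 2.
Proof.
wlog x0 : x / 0 <= x => [H|].
  have [/H//|/ltW xn] := leP 0 x.
  have [] := H (- x); first by rewrite oppr_ge0.
  by rewrite sinN !normrN -opprD normrN sqrrN.
have [->|xn0] := eqVneq x 0.
  by rewrite sin0 subrr normr0 expr0n.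
have xp : 0 < x by rewrite lt_def xn0.
have [c] : exists2 c, c \in `]0, x[%R & sin x - sin 0 = cos c * (x - 0).
  apply: MVT => //.
  by apply: continuous_subspaceT; exact: continuous_sin.
rewrite in_itv sin0 !subr0 /= => /andP[c0 cx] ->.
have [e] : exists2 e, e \in `]0, c[%R & cos c - cos 0 = (- sin e) * (c - 0).
  apply: MVT => //.
  by apply: continuous_subspaceT; exact: continuous_cos.
rewrite cos0 subr0 => _ ce.
rewrite normrM ler_piMl ?normr_ge0 ?cos_max //; split => //.
have -> : cos c * x - x = (cos c - 1) * x by ring.
rewrite ce mulNr mulNr normrN !normrM expr2 ler_pM ?mulr_ge0 ?normr_ge0 //; last by rewrite ger0_norm.
rewrite -[leRHS]mul1r ler_pM ?normr_ge0 ?sin_max // ger0_norm ltW //.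
Qed.

(** The functions [(n + 1) * sin (M / (n + 1))] tend to [M] and are dominated by its absolute value;
    the choice [v = 0] makes the cosine equal to [1]. *)
Lemma inH_orth g : inH g -> E (fun w => g w * M w) = 0.
Proof.
move=> [[mg [K gK]] Hg].
have mM := mG GM; have SM := L2G GM.
have LM : L1 mu (fun w => `|M w|).
  apply: (@L1_le _ _ _ _ _ (fun w => M w * M w + 1)).
  - exact: measurableT_comp.
  - move=> w; rewrite normr_id -expr2 -[M w ^+ 2]real_normK ?num_real //.
    have := sqr_ge0 (`|M w| - 1); have := normr_ge0 (M w); nra.
  - by apply: L1D; [exact: L2_mul|exact: finite_measure_integrable_cst].
apply: (@Rintegral_lim0 _ _ _ _ (fun n w => g w * (n.+1%:R * sin (n.+1%:R^-1 * M w)))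
  _ (fun w => K * `|M w|)).
- move=> n; apply: measurable_funM => //; apply: measurable_funM => //.
  by have [] : bm (fun w => sin (n.+1%:R^-1 * M w)) by apply: bm_sin; exact: measurable_funM.
- exact: measurable_funM.
- exact: L1Z.
- move=> n w; have n0 : 0 < n.+1%:R :> R by rewrite ltr0n.
  rewrite normrM ler_pM // normrM gtr0_norm // -ler_pdivlMl //.
  have [H _] := sin_near0 (n.+1%:R^-1 * M w).
  by apply: le_trans H _; rewrite normrM gtr0_norm ?invr_gt0.
- move=> w; apply: cvgM; first exact: cvg_cst.
  have hc (c : R) : M w + c * n.+1%:R^-1 @[n --> \oo] --> M w.
    rewrite -[X in _ --> X]addr0; apply: cvgD; first exact: cvg_cst.
    rewrite -[X in _ --> X](mulr0 c); apply: cvgM; first exact: cvg_cst.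
    exact: cvg_harmonic.
  apply: (@squeeze_cvgr _ _ _ _ (fun n => M w + (- M w ^+ 2) * n.+1%:R^-1)
    (fun n => M w + M w ^+ 2 * n.+1%:R^-1)) => //.
  apply: nearW => n; have n0 : 0 < n.+1%:R :> R by rewrite ltr0n.
  have [_ H] := sin_near0 (n.+1%:R^-1 * M w).
  suff : `|n.+1%:R * sin (n.+1%:R^-1 * M w) - M w| <= M w ^+ 2 * n.+1%:R^-1.
    rewrite mulNr; set A := _ ^+ 2 * _; set S := _ * sin _; rewrite ler_norml => /andP[].
    by move: A S (M w) => A S m h1 h2; apply/andP; split; lra.
  have -> : n.+1%:R * sin (n.+1%:R^-1 * M w) - M w =
    n.+1%:R * (sin (n.+1%:R^-1 * M w) - n.+1%:R^-1 * M w) by field; rewrite gt_eqF.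
  rewrite normrM gtr0_norm // -ler_pdivlMl //; apply: le_trans H _.
  by rewrite le_eqVlt; apply/orP; left; apply/eqP; field; rewrite gt_eqF.
- move=> n; have u0 : uncorr (fun=> 0) by exact: (proj1 uncorr_lin_closed).
  have [H _] := Hg (fun=> 0) n.+1%:R^-1 u0.
  have -> : (fun w => g w * (n.+1%:R * sin (n.+1%:R^-1 * M w))) =
     (fun w => n.+1%:R * (g w * cos 0 * sin (n.+1%:R^-1 * M w))).
    by apply/funext => w; rewrite cos0; ring.
  rewrite RintegralZl //; first by rewrite -/(E _) H mulr0.
  apply: bm_L1; apply: bmM; first by apply: bmM; [split => //; exists K|exact: bm_cst].
  by apply: bm_sin; exact: measurable_funM.
Qed.

(* [M] is orthogonal to every square-integrable function of the uncorrelated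
   observations, so no function of them predicts [M] better than [0]. *)
Lemma uncorr_no_prediction (Y : O -> R) :
  (forall B, measurable B -> sigset (Y @^-1` B)) ->
  (\int[mu]_w (M w ^+ 2)%:E <= \int[mu]_w ((M w + Y w) ^+ 2)%:E)%E.
Proof.
move=> SY; have mM := mG GM; have SM := L2G GM.
have mY : measurable_fun setT Y by move=> _ B mB; rewrite setTI; case: (SY B mB).
(* [Y] may fail to be square-integrable. Cut off outside [T n] it is bounded and orthogonal to [M],
   and the sets [T n] exhaust the space. *)
pose T n := [set w | `|Y w| <= n%:R].
have mT n : measurable (T n).
  have := measurableT_comp (@normr_measurable R setT) mY measurableT (measurable_itv `]-oo, n%:R]).
  by rewrite setTI; congr measurable; apply/seteqP; split => w /=; rewrite in_itv.
pose f n w : \bar R := (M w ^+ 2 * \1_(T n) w)%:E.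
have cvf : (\int[mu]_w f n w)%E @[n --> \oo] --> (\int[mu]_w (M w ^+ 2)%:E)%E.
  have -> : (\int[mu]_w (M w ^+ 2)%:E = \int[mu]_w (limn (fun n => f n w)))%E.
    apply: eq_integral => w _; apply/esym/cvg_lim => //; apply: cvg_near_cst.
    exists (Num.truncn `|Y w|).+1 => // n /= hn; rewrite /f indicE mem_set ?mulr1 // /T /=.
    by rewrite ltW // (lt_le_trans (truncnS_gt _)) // ler_nat.
  apply: cvg_monotone_convergence => //.
  - move=> n; apply/measurable_EFinP; apply: measurable_funM; first exact: measurable_funX.
    exact: measurable_indic.
  - by move=> n w _; rewrite /f lee_fin mulr_ge0 ?sqr_ge0.
  - move=> w _ a b ab; rewrite /f lee_fin ler_wpM2l ?sqr_ge0 // !indicE ler_nat.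
    have [wa|wa] := boolP (w \in T a); last by case: (w \in T b).
    rewrite mem_set //; move: wa => /set_mem wa; apply: le_trans wa _.
    by rewrite ler_nat.
rewrite -(cvg_lim _ cvf) //; apply: lime_le; first by apply/cvg_ex; eexists; exact: cvf.
apply: nearW => n.
pose phi (y : R) : R := y * \1_[set z : R | `|z| <= n%:R] y.
have mn : measurable [set z : R | `|z| <= n%:R].
  have := @normr_measurable R setT measurableT _ (measurable_itv `]-oo, n%:R]).
  by rewrite setTI; congr measurable; apply/seteqP; split => w /=; rewrite in_itv.
have mphi : measurable_fun setT phi.
  by apply: measurable_funM => //; exact: measurable_indic.
have phib y : `|phi y| <= n.+1%:R.
  rewrite /phi indicE; have [/set_mem /= h|_] := boolP (y \in _).
    by rewrite mulr1 (le_trans h) // ler_nat.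
  by rewrite mulr0 normr0.
have HY := mulH_inH (mulH_comp SY mphi (ltr0Sn R n) phib).
have bY : bm (fun w => phi (Y w)) by case: HY.
have LT : L1 mu (fun w => M w ^+ 2 * \1_(T n) w).
  apply: L1_le (L2_sqr SM); first by
    apply: measurable_funM; [exact: measurable_funX|exact: measurable_indic].
  move=> w; rewrite normrM ger0_norm ?sqr_ge0 // ler_piMr ?sqr_ge0 // indicE.
  by case: (w \in _); rewrite ?normr1 ?normr0.
have [mbY _] := bY.
have LY2 : L1 mu (fun w => phi (Y w) * phi (Y w)) by apply: bm_L1; exact: bmM.
have LMY : L1 mu (fun w => phi (Y w) * M w).
  apply: L2_mul => //; split => //.
  by have /integrableP[_] := LY2; under eq_integral do rewrite /= -expr2 ger0_norm ?sqr_ge0 //.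
have h0 : \int[mu]_w (phi (Y w) * M w) = 0 := inH_orth HY.
(* The cross term has mean zero; by [EE] the right-hand side is the integral of [(M + Y) ^ 2] over
   [T n]. *)
have E1 : \int[mu]_w (M w ^+ 2 * \1_(T n) w) <=
    \int[mu]_w (M w ^+ 2 * \1_(T n) w + (2 * (phi (Y w) * M w) + phi (Y w) * phi (Y w))).
  rewrite RintegralD' //; last by apply: L1D => //; exact: L1Z.
  rewrite RintegralD' //; last exact: L1Z.
  rewrite RintegralZl // h0 mulr0 add0r lerDl.
  by apply: Rintegral_ge0 => w _; rewrite -expr2 sqr_ge0.
have -> : (\int[mu]_w f n w = (\int[mu]_w (M w ^+ 2 * \1_(T n) w))%:E)%E.
  by rewrite RintegralK.
apply: (@le_trans _ _ (\int[mu]_w (M w ^+ 2 * \1_(T n) w +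
    (2 * (phi (Y w) * M w) + phi (Y w) * phi (Y w))))%:E).
  by rewrite lee_fin.
rewrite RintegralK; last by do 2 apply: L1D => //; exact: L1Z.
have EE w : M w ^+ 2 * \1_(T n) w + (2 * (phi (Y w) * M w) + phi (Y w) * phi (Y w)) =
    (M w + Y w) ^+ 2 * \1_(T n) w.
  have e1 : \1_(T n) w = \1_[set z : R | `|z| <= n%:R] (Y w) :> R.
    by rewrite !indicE; congr (_%:R); congr (nat_of_bool _); apply/idP/idP => /set_mem h; apply/mem_set.
  have e2 : \1_(T n) w * \1_(T n) w = \1_(T n) w :> R.
    by rewrite indicE; case: (w \in _); rewrite ?mulr1 ?mulr0.
  rewrite /phi -e1.
  have -> : Y w * \1_(T n) w * (Y w * \1_(T n) w) = Y w ^+ 2 * (\1_(T n) w * \1_(T n) w) by ring.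
  by rewrite e2; ring.
under eq_integral do rewrite EE.
apply: le_ge0_integral => w; first by rewrite lee_fin mulr_ge0 ?sqr_ge0.
rewrite lee_fin ler_piMr ?sqr_ge0 // indicE; by case: (w \in _).
Qed.

End Regression.

Lemma measurable_gt_fun d (O : measurableType d) (R : realType) (f : O -> R) :
  (forall a, measurable [set w | a < f w]) -> measurable_fun setT f.
Proof.
move=> H; apply: (measurability _ (RGenOInfty.measurableE R)) => //.
move=> _ [_ [a ->] <-]; rewrite setTI; have := H a; congr measurable.
by apply/seteqP; split => w /=; rewrite in_itv /= andbT.
Qed.

(** * Gaussian measures on function spaces *)

Section Borel.
Variable R : realType.

Lemma open_gt_continuous (X : topologicalType) (f : X -> R) (a : R) :
  continuous f -> open [set x | a < f x].
Proof.
move=> cf; have -> : [set x | a < f x] = f @^-1` [set y | a < y] by [].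
by apply: open_comp => [x _|]; [exact: cf|exact: open_gt].
Qed.

Lemma continuous_measurable_Rd n (f : 'rV[R]_n -> R) : continuous f ->
  measurable_fun setT (f : Rd R n -> R).
Proof.
move=> cf; apply: measurable_gt_fun => a; apply: sub_sigma_algebra.
exact: (@open_gt_continuous 'rV[R]_n).
Qed.

Lemma measurable_coord n (i : 'I_n) : measurable_fun setT (fun y : Rd R n => coord y i).
Proof.
apply: (@continuous_measurable_Rd n (fun y : 'rV[R]_n => y ord0 i)).
exact: coord_continuous.
Qed.

Lemma measurable_Rd d (O : measurableType d) n (f : O -> Rd R n) :
  (forall i, measurable_fun setT (fun w => coord (f w) i)) -> measurable_fun setT f.
Proof.
move=> Hf; apply: (@measurability _ _ O (Rd R n) setT f (@open 'rV[R]_n) erefl).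
move=> _ [U oU <-]; rewrite setTI.
(* Boxes with rational centre and radius [1 / (k + 1)] are countably many, and every open set is a
   union of them. *)
pose box (p : 'rV[rat]_n * nat) : set 'rV[R]_n :=
  [set y | forall i, `|y ord0 i - ratr (p.1 ord0 i)| < p.2.+1%:R^-1].
have mbox p : measurable (f @^-1` box p).
  have -> : f @^-1` box p = ~` \bigcup_(i : 'I_n)
      [set w | p.2.+1%:R^-1 <= `|coord (f w) i - ratr (p.1 ord0 i)|].
    apply/seteqP; split => w /=; first by move=> H [i _ /=]; rewrite leNgt H.
    by move=> H i; rewrite ltNge; apply/negP => h; apply: H; exists i.
  apply: measurableC; apply: countable_bigcupT_measurable => // i.
  have m1 : measurable_fun setT (fun w => `|coord (f w) i - ratr (p.1 ord0 i)|).
    by apply: measurableT_comp => //; apply: measurable_funB.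
  have := m1 measurableT _ (measurable_itv `[p.2.+1%:R^-1, +oo[).
  rewrite setTI; congr measurable.
  by apply/seteqP; split => w /=; rewrite in_itv /= andbT.
have -> : f @^-1` U = \bigcup_(p : 'rV[rat]_n * nat)
    (if `[< box p `<=` U >] then f @^-1` box p else set0).
  apply/seteqP; split => w /=; last by move=> [p _]; case: asboolP => // H /H.
  move=> Uw; have /nbhs_ballP [r /= r0 rU] : nbhs (f w : 'rV[R]_n) U by exact: open_nbhs_nbhs.
  pose k := Num.truncn (2 / r).
  have kr : 2 * k.+1%:R^-1 < r.
    rewrite ltr_pdivrMr ?ltr0n // mulrC -ltr_pdivrMr //; exact: truncnS_gt.
  have k0 : 0 < k.+1%:R^-1 :> R by rewrite invr_gt0 ltr0n.
  have qex i : exists q : rat, `|coord (f w) i - ratr q| < k.+1%:R^-1.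
    move: (coord (f w) i) (k.+1%:R^-1) k0 => c e e0.
    have [|q] := @rat_in_itvoo R (c - e) (c + e); first by lra.
    rewrite in_itv /= => /andP[q1 q2]; exists q; rewrite ltr_norml; apply/andP; split; lra.
  have [q Hq] := choice qex.
  exists (\row_i q i, k) => //; case: asboolP => [_|]; first by move=> i /=; rewrite mxE; exact: Hq.
  case=> y Hy; apply: rU; split => // i j; rewrite ord1.
  have := Hy j; rewrite /= mxE => H1; have H2 := Hq j.
  have Hd : `|coord (f w) j - y ord0 j| < r.
    have -> : coord (f w) j - y ord0 j =
        (coord (f w) j - ratr (q j)) - (y ord0 j - ratr (q j)) by ring.
    apply: le_lt_trans (ler_normB _ _) _; apply: lt_trans kr.
    by rewrite mulr_natl mulr2n; exact: ltrD.
  exact: Hd.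
by apply: countable_bigcupT_measurable => // p; case: asboolP.
Qed.

End Borel.

Section FunctionSpace.
Context (R : realType) (F : completeNormedModType R).

Lemma clf_measurable (L : F -> R) : clf L -> measurable_fun setT (L : Fb F -> R).
Proof.
move=> [_ cL]; apply: measurable_gt_fun => a; apply: sub_sigma_algebra.
exact: (@open_gt_continuous R F).
Qed.

Lemma clf_lin_closed : @lin_closed R (Fb F -> R) (@clf R F).
Proof.
split.
  by split => [a f g|]; [rewrite mulr0 addr0|exact: cst_continuous].
move=> a u v [lu cu] [lv cv]; split.
  by move=> b f g; rewrite !fctE lu lv !scalerDr /GRing.scale /=; ring.
by move=> x; apply: cvgD; [apply: cvgM; [exact: cvg_cst|exact: cu]|exact: cv].
Qed.

Lemma lipschitz_clf (L : F -> R) (C : R) :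
  (forall (a : R) (f g : F), L (a *: f + g) = a * L f + L g) ->
  (forall f, `|L f| <= C * `|f|) -> clf L.
Proof.
move=> lL LC; split => // f; apply/cvgrPdist_lt => e e0.
pose K := `|C| + 1; have K0 : 0 < K by rewrite ltr_wpDl.
near=> g.
have -> : L f - L g = L (f - g) by rewrite [f - g]addrC -(scaleN1r g) lL mulN1r addrC.
apply: le_lt_trans (LC _) _; apply: (@le_lt_trans _ _ (K * `|f - g|)).
  by rewrite ler_wpM2r // (le_trans (ler_norm C)) // lerDl.
rewrite -ltr_pdivlMl //; near: g.
apply: (@cvgr_dist_lt _ _ _ _ _ id) => //; last by rewrite mulr_gt0 ?invr_gt0.
Unshelve. all: by end_near. Qed.

Lemma gaussian_clf (mu : probability (Fb F) R) (L : Fb F -> R) :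
  centered_gaussian mu -> clf L -> gaussian_rv mu L.
Proof. by move=> H cL; split; [exact: clf_measurable|exact: H]. Qed.

Lemma dense_sequence (S : set F) : countable S -> closure S = setT ->
  exists s : nat -> F, forall (f : F) (e : R), 0 < e -> exists k, `|f - s k| < e.
Proof.
move=> cS dS.
have S0 : S !=set0.
  have : closure S (0 : F) by rewrite dS.
  move=> /(_ setT filterT) [s [Ss _]]; by exists s.
have [s0 Ss0] := S0.
have [s Hs] : exists s : nat -> F, forall y, S y -> exists k, s k = y.
  move: cS => /countable_injP [h hinj].
  pose s n := if pselect (exists2 y, S y & h y = n) is left e then sval (cid2 e) else s0.
  exists s => y Sy; exists (h y); rewrite /s; case: pselect => [e|]; last by case; exists y.
  case: cid2 => z /= Sz hz; apply: hinj => //; exact: mem_set.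
exists s => f e e0.
have : closure S f by rewrite dS.
move=> /(_ _ (nbhsx_ballx f _ e0)) [y [Sy fy]].
have [k ky] := Hs y Sy; exists k; rewrite ky.
by move: fy; rewrite -ball_normE.
Qed.

(* A function that is measurable in one variable and continuous in the other,
   separable one is a limit of functions that are constant in the second
   variable on countably many sets. *)
Lemma caratheodory_measurable d (T : measurableType d) (U : Fb F -> T -> R) (S : set F) :
  countable S -> closure S = setT -> (forall f, measurable_fun setT (U f)) ->
  (forall x, continuous (fun f : F => U f x)) ->
  measurable_fun setT (fun p : Fb F * T => U p.1 p.2).
Proof.
move=> cS dS mU cU.
have [s Hs] := dense_sequence cS dS.
have near_s (f : F) n : exists k, `|f - s k| < n.+1%:R^-1.
  by apply: Hs; rewrite invr_gt0 ltr0n.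
(* Taking the least index makes each [A k] a ball minus finitely many balls, hence measurable. *)
pose kk f n := ex_minn (near_s f n).
pose V n (p : Fb F * T) := U (s (kk p.1 n)) p.2.
apply: (measurable_fun_cvg (h := V)) => [n|[f x] _].
  apply: measurable_gt_fun => a.
  pose A k := [set f : Fb F | kk f n = k].
  have mball k : measurable [set f : Fb F | `|f - s k| < n.+1%:R^-1].
    apply: sub_sigma_algebra.
    have -> : [set f : F | `|f - s k| < n.+1%:R^-1] = ball (s k) n.+1%:R^-1.
      by rewrite -ball_normE; apply/seteqP; split => f /=; rewrite distrC.
    exact: ball_open.
  have mA k : measurable (A k).
    have -> : A k = [set f : Fb F | `|f - s k| < n.+1%:R^-1] `\`
        \bigcup_(j in `I_k) [set f : Fb F | `|f - s j| < n.+1%:R^-1].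
      apply/seteqP; split => f; rewrite /A /kk /=.
        case: ex_minnP => m m1 m2 <-; split => // -[j /= jm jf].
        by have := m2 j jf; rewrite leqNgt jm.
      move=> [kf H]; case: ex_minnP => m m1 m2; apply/eqP; rewrite eqn_leq m2 //=.
      rewrite leqNgt; apply/negP => mk; apply: H; by exists m.
    by apply: measurableD => //; apply: bigcup_measurable => j _.
  have -> : [set p | a < V n p] = \bigcup_k (A k `*` [set x | a < U (s k) x]).
    apply/seteqP; split => -[f x] /=; first by move=> h; exists (kk f n).
    by move=> [k _ [/= <- h]].
  apply: bigcupT_measurable => k; apply: measurableX; first exact: mA.
  have := mU (s k) measurableT _ (measurable_itv `]a, +oo[).
  by rewrite setTI; congr measurable; apply/seteqP; split => x /=; rewrite in_itv /= andbT.
have cv : s (kk f n) @[n --> \oo] --> (f : F).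
  apply/cvgrPdist_lt => e e0; near=> n.
  rewrite /kk; case: ex_minnP => m m1 _; apply: lt_trans m1 _.
  near: n; exact: near_infty_natSinv_lt (PosNum e0).
exact: (cvg_comp _ _ cv (cU x f)).
Unshelve. all: by end_near. Qed.

End FunctionSpace.

(** * Extension by zero from [D] to the whole space *)

Section Extension.
Context (R : realType) (d : nat).
Variables (D : set (Rd R d)) (rho : Rd R d -> R) (lam : {measure set (Rd R d) -> \bar R}).
Hypotheses (mD : measurable D) (mrho : measurable_fun D rho)
  (rho0 : forall x, D x -> 0 <= rho x).

(** Evaluations are controlled on [D] alone. Cutting functions off outside [D] lets all of them live
    on the whole space, under the probability of density [densD]. *)
Definition zext (h : Rd R d -> R) : Rd R d -> R := fun x => if x \in D then h x else 0.

Definition densD (x : Rd R d) : \bar R := (zext rho x)%:E.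

Lemma ext_measurable h : measurable_fun D h -> measurable_fun setT (zext h).
Proof. by move=> mh; have := (measurable_restrictT h mD).1 mh. Qed.

Lemma densD_measurable : measurable_fun setT densD.
Proof. by apply/measurable_EFinP; exact: ext_measurable. Qed.

Lemma densD_ge0 x : (0 <= densD x)%E.
Proof. by rewrite lee_fin /zext; case: ifP => // /set_mem; exact: rho0. Qed.

Lemma densD_int : (\int[lam]_x densD x = \int[lam]_(x in D) (rho x)%:E)%E.
Proof.
rewrite [RHS]integral_mkcond; apply: eq_integral => x _.
by rewrite patchE /densD /zext; case: ifP.
Qed.

Lemma ext_out h x : ~ D x -> zext h x = 0.
Proof. by move=> Dx; rewrite /zext memNset. Qed.

Lemma ext_in h x : D x -> zext h x = h x.
Proof. by move=> Dx; rewrite /zext mem_set. Qed.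

Lemma extB g h : zext (fun x => g x - h x) = zext g - zext h.
Proof.
by apply/funext => x; rewrite !fctE /zext; case: ifP => _ //; rewrite subr0.
Qed.

Variable P : probability (Rd R d) R.
Hypothesis PE : forall g : Rd R d -> \bar R, measurable_fun setT g ->
  (forall x, 0 <= g x)%E -> (\int[P]_x g x = \int[lam]_x (g x * densD x))%E.

Lemma P_compl : P (~` D) = 0%E.
Proof.
have mDc : measurable (~` D) by exact: measurableC.
rewrite -[X in P X]setIT -integral_indic // PE.
- apply: integral0_eq => x _; rewrite indicE in_setC /densD /zext.
  by case: ifP => xD; rewrite /= ?mul0e ?mule0.
- by apply/measurable_EFinP; exact: measurable_indic.
- by move=> x; rewrite lee_fin.
Qed.

Lemma G2E h : measurable_fun D h ->
  G2 D rho lam h = (\int[P]_x (zext h x ^+ 2)%:E)%E.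
Proof.
move=> mh; rewrite /G2 PE.
- rewrite integral_mkcond; apply: eq_integral => x _; rewrite patchE /densD /zext.
  by case: ifP => // _; rewrite mule0.
- by apply/measurable_EFinP; apply: measurable_funX; exact: ext_measurable.
- by move=> x; rewrite lee_fin sqr_ge0.
Qed.

Lemma inG_L2 h : inG D rho lam h -> L2 P (zext h).
Proof. by move=> [mh ih]; split; [exact: ext_measurable|rewrite -G2E]. Qed.

Lemma L2_ext h : L2 P h -> L2 P (zext h).
Proof.
move=> [mh ih]; split; first by apply: ext_measurable; exact: measurable_funTS.
apply: le_lt_trans ih; apply: ge0_le_integral => //.
- by move=> x _; rewrite lee_fin sqr_ge0.
- by apply/measurable_EFinP; apply: measurable_funX; apply: ext_measurable; exact: measurable_funTS mh.
- by apply/measurable_EFinP/measurable_funX.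
- by move=> x _; rewrite lee_fin /zext; case: ifP => // _; rewrite expr0n /= sqr_ge0.
Qed.

Lemma L2_inG h : L2 P h -> inG D rho lam h.
Proof.
move=> Lh; have mhD : measurable_fun D h by apply: measurable_funTS; case: Lh.
split => //.
by rewrite G2E //; case: (L2_ext Lh).
Qed.

Lemma inG_B g h : inG D rho lam g -> inG D rho lam h -> measurable_fun D (fun x => g x - h x).
Proof. by move=> [mg _] [mh _]; exact: measurable_funB. Qed.

End Extension.

Section RegressionMeasurable.
Context d (O : measurableType d) (R : realType) (mu : probability O R).
Variable Gc : (O -> R) -> Prop.
Hypotheses (lG : @lin_closed R (O -> R) Gc) (gG : forall v, Gc v -> gaussian_rv mu v).
Variable M : O -> R.
Hypothesis GM : Gc M.

(** A copy of [O] with a coarser sigma-algebra, for which the uncorrelated variables are measurable.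
    Ordinary composition lemmas then cover measurable functions of them. *)
Let Os := g_sigma_algebraType (sigset mu Gc M).

Lemma uncorr_measurable u : uncorr mu Gc M u -> measurable_fun [set: Os] (u : Os -> R).
Proof.
move=> uu; apply: (@measurable_gt_fun _ Os) => a; apply: sub_sigma_algebra.
exact: sigset_gt.
Qed.

Lemma uncorr_no_prediction_meas (Y : O -> R) : measurable_fun [set: Os] (Y : Os -> R) ->
  (\int[mu]_w (M w ^+ 2)%:E <= \int[mu]_w ((M w + Y w) ^+ 2)%:E)%E.
Proof.
move=> mY; apply: (uncorr_no_prediction lG gG GM) => B mB.
have := mY measurableT B mB; rewrite setTI.
by rewrite /measurable /= (sigma_algebra_id (sigset_sigma lG gG GM)).
Qed.

End RegressionMeasurable.

(** * The approximation problem for a fixed probability measure *)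

Section Problem.
Context (R : realType) (d : nat) (P : probability (Rd R d) R) (D : set (Rd R d)).
Hypotheses (mD : measurable D).
Context (F : completeNormedModType R) (eF : Fb F -> Rd R d -> R) (mu : probability (Fb F) R).
Variables (S : set F) (C : R).
Hypotheses (cS : countable S) (dS : closure S = setT)
 (eF_lin : forall (a : R) (f g : F), eF (a *: f + g) = a *: eF f + eF g)
 (eF_cont : forall x, continuous (fun f : F => eF f x))
 (eF_L2 : forall f, L2 P (eF f))
 (eF_bound : forall f : F, l2ip P (eF f) (eF f) <= C * `|f| ^+ 2)
 (gmu : centered_gaussian mu).

Let lSP := L2_lin_closed P.
Let HP := l2_pre_ip P.
Let lSm := L2_lin_closed mu.
Let Hm := l2_pre_ip mu.

Local Notation orth e := (@orthonormal R (Rd R d -> R) (L2 P) (l2ip P) _ e).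
Local Notation projP e := (@proj R (Rd R d -> R) (l2ip P) _ e).
Local Notation orthm e := (@orthonormal R (Fb F -> R) (L2 mu) (l2ip mu) _ e).
Local Notation projm e := (@proj R (Fb F -> R) (l2ip mu) _ e).

Definition pe (x : Rd R d) : Fb F -> R := fun f => eF f x.

Lemma pe_clf x : clf (pe x).
Proof. by split => [a f g|]; [rewrite /pe eF_lin|exact: eF_cont]. Qed.

Lemma clf_L2 (L : Fb F -> R) : clf L -> L2 mu L.
Proof. by move=> cL; apply: gaussian_L2; exact: gaussian_clf. Qed.

Lemma pe_L2 x : L2 mu (pe x). Proof. by apply: clf_L2; exact: pe_clf. Qed.

Lemma eF_joint : measurable_fun setT (fun p : Fb F * Rd R d => eF p.1 p.2).
Proof.
by apply: (caratheodory_measurable cS dS) => // f; case: (eF_L2 f).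
Qed.

Lemma tonelli (h : Fb F * Rd R d -> R) : measurable_fun setT h ->
  (\int[mu]_f \int[P]_x (h (f, x) ^+ 2)%:E = \int[P]_x \int[mu]_f (h (f, x) ^+ 2)%:E)%E.
Proof.
move=> mh; rewrite (@fubini_tonelli _ _ _ _ _ mu P (fun p => (h p ^+ 2)%:E)) //.
- by apply/measurable_EFinP/measurable_funX.
- by move=> p; rewrite lee_fin sqr_ge0.
Qed.

Lemma measurable_sq_f (h : Fb F * Rd R d -> R) : measurable_fun setT h ->
  measurable_fun setT (fun f => \int[P]_x (h (f, x) ^+ 2)%:E)%E.
Proof.
move=> mh; apply: (@measurable_fun_fubini_tonelli_F _ _ _ _ _ P (fun p => (h p ^+ 2)%:E)).
- by apply/measurable_EFinP/measurable_funX.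
- by move=> p; rewrite lee_fin sqr_ge0.
Qed.

Lemma measurable_sq_x (h : Fb F * Rd R d -> R) : measurable_fun setT h ->
  measurable_fun setT (fun x => \int[mu]_f (h (f, x) ^+ 2)%:E)%E.
Proof.
move=> mh; apply: (@measurable_fun_fubini_tonelli_G _ _ _ _ _ mu (fun p => (h p ^+ 2)%:E)).
- by apply/measurable_EFinP/measurable_funX.
- by move=> p; rewrite lee_fin sqr_ge0.
Qed.

Lemma eF_sqE f : (\int[P]_x (eF f x ^+ 2)%:E = (l2ip P (eF f) (eF f))%:E)%E.
Proof. by rewrite l2ipK. Qed.

Lemma pe_sqE x : (\int[mu]_f (eF f x ^+ 2)%:E = (l2ip mu (pe x) (pe x))%:E)%E.
Proof. by rewrite l2ipK //; exact: pe_L2. Qed.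

Lemma measurable_Q : measurable_fun setT (fun f => l2ip P (eF f) (eF f)).
Proof.
apply/measurable_EFinP.
have := measurable_sq_f eF_joint; congr measurable_fun; apply/funext => f /=.
by rewrite eF_sqE.
Qed.

Lemma measurable_s2 : measurable_fun setT (fun x => l2ip mu (pe x) (pe x)).
Proof.
apply/measurable_EFinP.
have := measurable_sq_x eF_joint; congr measurable_fun; apply/funext => f /=.
by rewrite pe_sqE.
Qed.

Lemma Q_tail (p : R) : 0 < p -> exists n : nat,
  (mu [set f | (n%:R < l2ip P (eF f) (eF f))%R] <= p%:E)%E.
Proof.
move=> p0; pose A n := [set f : Fb F | n%:R < l2ip P (eF f) (eF f)].
have mA n : measurable (A n).
  have := measurable_Q measurableT (measurable_itv `]n%:R, +oo[); rewrite setTI.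
  by congr measurable; apply/seteqP; split => f /=; rewrite in_itv /= andbT.
have cv : mu (A n) @[n --> \oo] --> (0 : \bar R)%E.
  rewrite -(measure0 mu).
  have -> : set0 = \bigcap_n A n.
    apply/seteqP; split => // f H; exfalso.
    have := H (Num.truncn (l2ip P (eF f) (eF f))).+1 I; rewrite /A /=.
    by rewrite ltNge ltW ?truncnS_gt.
  apply: nonincreasing_cvg_mu => //.
  - by rewrite (le_lt_trans (probability_le1 _ _)) ?ltry.
  - exact: bigcapT_measurable.
  - move=> a b ab; apply/subsetPset => f; rewrite /A /=; apply: le_lt_trans.
    by rewrite ler_nat.
have [n _ Hn] : \forall n \near \oo, (mu (A n) < p%:E)%E.
  have fA n : mu (A n) \is a fin_num by rewrite fin_num_measure.
  have cv' : fine (mu (A n)) @[n --> \oo] --> (0 : R) by exact: fine_cvg.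
  have : \forall n \near \oo, fine (mu (A n)) < p by apply: (cvgr_lt 0) => //; exact: cv'.
  by apply: filterS => n; rewrite -{2}(fineK (fA n)) lte_fin.
by exists n; apply: ltW; apply: Hn => /=.
Qed.

(* Second moment of the norm, bounded as in the Paley-Zygmund argument: fourth
   moments of Gaussian variables are controlled by their variances, hence the
   event [Q > n] of small probability carries at most half of each variance. *)
Lemma second_moment : (\int[P]_x (l2ip mu (pe x) (pe x))%:E < +oo)%E.
Proof.
have [kap [kap0 Hkap]] := gaussian_moment4 mu.
pose p : R := (4 * (kap + 1))^-1.
have p0 : 0 < p by rewrite invr_gt0 mulr_gt0 // ltr_wpDl.
have [n Hn] := Q_tail p0.
pose A := [set f : Fb F | l2ip P (eF f) (eF f) <= n%:R].
have mA : measurable A.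
  have := measurable_Q measurableT (measurable_itv `]-oo, n%:R]); rewrite setTI.
  by congr measurable; apply/seteqP; split => f /=; rewrite in_itv.
have mAc : measurable (~` A) by exact: measurableC.
have muAc : (mu (~` A) <= p%:E)%E.
  have -> // : ~` A = [set f | n%:R < l2ip P (eF f) (eF f)].
  by apply/seteqP; split => f; rewrite /A /= ltNge => /negP.
pose h (q : Fb F * Rd R d) := \1_A q.1 * eF q.1 q.2.
have mh : measurable_fun setT h.
  apply: measurable_funM; last exact: eF_joint.
  by apply: measurableT_comp => //; exact: measurable_indic.
have indsq (B : set (Fb F)) f : (\1_B f : R) ^+ 2 = \1_B f.
  by rewrite indicE; case: (f \in B); rewrite ?expr1n ?expr0n.
have half x : l2ip mu (pe x) (pe x) <= 2 * \int[mu]_f (\1_A f * eF f x ^+ 2).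
  set s2 := l2ip mu (pe x) (pe x).
  have L2x := pe_L2 x; have Lsq : L1 mu (fun f => eF f x ^+ 2) by exact: (L2_sqr L2x).
  have L4 : L1 mu (fun f => (eF f x ^+ 2) ^+ 2).
    apply/integrableP; split.
      by apply/measurable_EFinP; do 2 apply: measurable_funX; case: L2x.
    under eq_integral do rewrite /= ger0_norm ?sqr_ge0 // -exprM.
    by rewrite (Hkap (pe x)) ?ltry //; exact: gaussian_clf (pe_clf x).
  have L1i (B : set (Fb F)) : measurable B -> L1 mu (fun f => \1_B f * eF f x ^+ 2).
    move=> mB; apply: L1_le Lsq.
      by apply: measurable_funM; [exact: measurable_indic|apply: measurable_funX; case: L2x].
    move=> f; rewrite normrM (ger0_norm (sqr_ge0 _)) ler_piMl ?sqr_ge0 // indicE.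
    by case: (f \in B); rewrite ?normr1 ?normr0.
  have split2 : s2 = \int[mu]_f (\1_A f * eF f x ^+ 2) + \int[mu]_f (\1_(~` A) f * eF f x ^+ 2).
    rewrite -RintegralD' //; [|exact: L1i|exact: L1i].
    apply: eq_Rintegral => f _; rewrite /pe !indicE in_setC.
    by case: (f \in A) => /=; ring.
  suff : \int[mu]_f (\1_(~` A) f * eF f x ^+ 2) <= s2 / 2 by lra.
  have s20 : 0 <= s2 by exact: (ip_ge0 Hm).
  have [s2e|s2p] := eqVneq s2 0.
    rewrite s2e mul0r -[leRHS]s2e.
    apply: (@le_Rintegral _ _ _ mu setT _ (fun f => pe x f * pe x f)) => //; first exact: L1i.
    by move=> f _; rewrite /pe -expr2 ler_piMl ?sqr_ge0 // indicE.
  have s2g : 0 < s2 by rewrite lt_def s2p.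
  (* The weight in [b * y <= y ^ 2 / c + c / 4 * b ^ 2]: with this [c], the fourth moment and the
     probability [p] contribute at most a quarter of [s2] each. *)
  pose c := 4 * (kap + 1) * s2.
  have c0 : 0 < c by rewrite !mulr_gt0 // ltr_wpDl.
  have bnd f : \1_(~` A) f * eF f x ^+ 2 <= c^-1 * (eF f x ^+ 2) ^+ 2 + (c / 4) * \1_(~` A) f.
    rewrite -[X in (c / 4) * X]indsq.
    have := sqr_ge0 ((eF f x ^+ 2) - c / 2 * \1_(~` A) f).
    rewrite -(pmulr_rge0 _ (_ : 0 < c^-1)) ?invr_gt0 //.
    set y := eF f x ^+ 2; set b := \1_(~` A) f.
    have -> : c^-1 * (y - c / 2 * b) ^+ 2 = c^-1 * y ^+ 2 + c / 4 * b ^+ 2 - b * y.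
      by field; rewrite gt_eqF.
    by rewrite subr_ge0.
  have mui : \int[mu]_f \1_(~` A) f <= p.
    rewrite -lee_fin RintegralK; last exact: integrable_indic.
    by rewrite integral_indic // setIT.
  have Iind : L1 mu (\1_(~` A) : Fb F -> R) by exact: integrable_indic.
  have I4 : \int[mu]_f (eF f x ^+ 2) ^+ 2 = kap * s2 ^+ 2.
    apply: EFin_inj; rewrite RintegralK // -(Hkap (pe x)); last exact: gaussian_clf (pe_clf x).
    by apply: eq_integral => f _; rewrite -exprM.
  apply: (@le_trans _ _ (\int[mu]_f (c^-1 * (eF f x ^+ 2) ^+ 2 + (c / 4) * \1_(~` A) f))).
    apply: le_Rintegral => //; first exact: L1i.
    by apply: L1D; apply: L1Z.
  rewrite Rint_lin // I4.
  apply: (@le_trans _ _ (c^-1 * (kap * s2 ^+ 2) + c / 4 * p)).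
    by rewrite lerD2l ler_wpM2l // divr_ge0 // ltW.
  have -> : c^-1 * (kap * s2 ^+ 2) + c / 4 * p = s2 * (kap / (kap + 1) + 1) / 4.
    by rewrite /c /p; field; rewrite s2p /= gt_eqF // ltr_wpDl.
  have : kap / (kap + 1) <= 1 by rewrite ler_pdivrMr ?ltr_wpDl //; lra.
  nra.
have hsq f x : h (f, x) ^+ 2 = \1_A f * eF f x ^+ 2.
  by rewrite /h /= exprMn indsq.
have E2 x : ((l2ip mu (pe x) (pe x))%:E <= 2%:E * \int[mu]_f (h (f, x) ^+ 2)%:E)%E.
  have LA : L1 mu (fun f => \1_A f * eF f x ^+ 2).
    have L2x := pe_L2 x; apply: L1_le (L2_sqr L2x).
      by apply: measurable_funM; [exact: measurable_indic|apply: measurable_funX; case: L2x].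
    move=> f; rewrite normrM (ger0_norm (sqr_ge0 _)) ler_piMl ?sqr_ge0 // indicE.
    by case: (f \in A); rewrite ?normr1 ?normr0.
  under eq_integral do rewrite hsq.
  by rewrite -RintegralK // -EFinM lee_fin.
apply: (@le_lt_trans _ _ (2%:E * \int[P]_x \int[mu]_f (h (f, x) ^+ 2)%:E)%E).
  rewrite -ge0_integralZl //; last 2 first.
  - exact: measurable_sq_x.
  - by move=> x _; apply: integral_ge0 => f _; rewrite lee_fin sqr_ge0.
  apply: ge0_le_integral => //.
  - by move=> x _; rewrite lee_fin; exact: (ip_ge0 Hm (pe_L2 x)).
  - by apply/measurable_EFinP; exact: measurable_s2.
  - by apply: measurable_funeM; exact: measurable_sq_x.
(* The squared norm is at most [n] on [A], so integrating over [x] first bounds the double integral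
   by [n]. *)
rewrite -tonelli //; apply: (@le_lt_trans _ _ (2%:E * \int[mu]_f (n%:R)%:E)%E).
  rewrite lee_wpmul2l //; apply: ge0_le_integral => //.
  - by move=> f _; apply: integral_ge0 => x _; rewrite lee_fin sqr_ge0.
  - exact: measurable_sq_f.
  - move=> f _; under eq_integral do rewrite hsq EFinM.
    rewrite ge0_integralZl //; last 2 first.
    + by apply/measurable_EFinP/measurable_funX; case: (eF_L2 f).
    + by move=> x _; rewrite lee_fin sqr_ge0.
    rewrite eF_sqE -EFinM lee_fin indicE; have [/set_mem fA|fA] := boolP (f \in A).
      by rewrite mul1r.
    by rewrite mul0r.
rewrite integral_cst //; apply: (@le_lt_trans _ _ (2%:E * (n%:R%:E * 1))%E).
  by apply: lee_wpmul2l => //; apply: lee_wpmul2l; [rewrite lee_fin|exact: probability_le1].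
by rewrite mule1 -EFinM ltry.
Qed.

(** Cauchy-Schwarz and the embedding bound give a Lipschitz constant. Continuity is what makes the
    coefficients Gaussian. *)
Lemma coef_clf (e : Rd R d -> R) : L2 P e -> clf (fun f : F => l2ip P (eF f) e).
Proof.
move=> Le; apply: (@lipschitz_clf _ _ _ (Num.sqrt (`|C| * l2ip P e e))) => [a f g|f].
  by rewrite eF_lin (ipDl HP) ?(ipZl lSP HP) //; exact: (lin_closedZ _ lSP).
have e0 : 0 <= l2ip P e e by exact: (ip_ge0 HP).
rewrite -(ler_pXn2r (_ : 0 < 2)%N) ?nnegrE ?mulr_ge0 ?sqrtr_ge0 //.
rewrite real_normK ?num_real // exprMn sqr_sqrtr ?mulr_ge0 //.
rewrite (le_trans (ip_CS lSP HP (eF_L2 f) Le)) // mulrAC ler_wpM2r //.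
by rewrite (le_trans (eF_bound f)) // ler_wpM2r ?sqr_ge0 // ler_norm.
Qed.

Lemma eFB f g : eF (f - g) = eF f - eF g.
Proof. by rewrite addrC -scaleN1r eF_lin scaleN1r addrC. Qed.

Lemma integral_Q : (\int[mu]_f (l2ip P (eF f) (eF f))%:E < +oo)%E.
Proof.
under eq_integral do rewrite -eF_sqE.
rewrite (tonelli eF_joint); under eq_integral do rewrite pe_sqE.
exact: second_moment.
Qed.

Section Residual.
Variables (N : nat) (e : 'I_N -> Rd R d -> R).
Hypothesis oe : orth e.

Definition resP f := l2ip P (eF f - projP e (eF f)) (eF f - projP e (eF f)).

Lemma resP_ge0 f : 0 <= resP f.
Proof. exact: (ip_ge0 HP (res_in lSP oe (eF_L2 f))). Qed.

Lemma resPE f : resP f = l2ip P (eF f) (eF f) - \sum_k l2ip P (eF f) (e k) ^+ 2.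
Proof. by rewrite (nrm_proj lSP HP oe (eF_L2 f)) addrK. Qed.

Lemma resP_le f : resP f <= l2ip P (eF f) (eF f).
Proof. by rewrite resPE gerBl sumr_ge0 // => k _; exact: sqr_ge0. Qed.

Lemma measurable_resP : measurable_fun setT resP.
Proof.
have -> : resP = fun f => l2ip P (eF f) (eF f) - \sum_k l2ip P (eF f) (e k) ^+ 2.
  by apply/funext => f; exact: resPE.
apply: measurable_funB; first exact: measurable_Q.
apply: measurable_sum => k; apply: measurable_funX; apply: clf_measurable.
by apply: coef_clf; case: oe.
Qed.

End Residual.

(** Orthonormalise the first [n] terms of a dense sequence: the residuals tend to zero at every [f]
    and are dominated by the squared norm, integrable by [integral_Q]. This takes the place of a
    Karhunen-Loeve expansion. *)
Lemma finite_rank (eta : R) : 0 < eta -> exists N (e : 'I_N -> Rd R d -> R),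
  orth e /\ (\int[mu]_f (resP e f)%:E <= eta%:E)%E.
Proof.
move=> eta0; have [s Hs] := dense_sequence cS dS.
have H n : exists N (e : 'I_N -> Rd R d -> R), orth e /\ forall j, (j < n)%N -> resP e (s j) = 0.
  have [N [e [_ oe _ H0]]] := gram_schmidt lSP HP (fun i : 'I_n => eF_L2 (s i)).
  by exists N, e; split => // j jn; exact: (H0 (Ordinal jn)).
pose N n := sval (cid (H n)); pose e n : 'I_(N n) -> Rd R d -> R := sval (cid (svalP (cid (H n)))).
have oe n : orth (e n) by case: (svalP (cid (svalP (cid (H n))))).
have e0 n j : (j < n)%N -> resP (e n) (s j) = 0.
  by case: (svalP (cid (svalP (cid (H n))))) => _; exact.
have lim f : resP (e n) f @[n --> \oo] --> (0 : R).
  apply/cvgrPdist_lt => eps eps0.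
  pose K := `|C| + 1; have K0 : 0 < K by rewrite ltr_wpDl.
  have /(Hs f)[k Hk] : 0 < Num.sqrt (eps / K) by rewrite sqrtr_gt0 divr_gt0.
  have {}Hk : K * `|f - s k| ^+ 2 < eps.
    rewrite -ltr_pdivlMl // mulrC -[ltRHS]sqr_sqrtr; last by rewrite ltW // divr_gt0.
    by rewrite ltr_pXn2r ?nnegrE ?sqrtr_ge0.
  near=> n.
  rewrite sub0r normrN ger0_norm ?resP_ge0 //; apply: le_lt_trans Hk.
  (* Once [n > k], the vector [s k] is spanned up to norm zero and competes with the projection of
     [f]. *)
  apply: (@le_trans _ _ (l2ip P (eF f - eF (s k)) (eF f - eF (s k)))).
    apply: (nrm_res_null_le lSP HP (oe n)) => //; apply: e0.
    by near: n; exact: nbhs_infty_gt.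
  rewrite -eFB (le_trans (eF_bound _)) // ler_wpM2r ?sqr_ge0 //.
  by rewrite (le_trans (ler_norm C)) // lerDl.
have LQ : L1 mu (fun f => l2ip P (eF f) (eF f)).
  apply/integrableP; split; first by apply/measurable_EFinP; exact: measurable_Q.
  by under eq_integral do rewrite /= ger0_norm ?(ip_ge0 HP) //; exact: integral_Q.
have [|||||Lf _ cv] := @dominated_convergence _ _ _ mu setT measurableT
  (fun n => EFin \o resP (e n)) (cst 0%E) (EFin \o (fun f => l2ip P (eF f) (eF f))).
- by move=> n; apply/measurable_EFinP; exact: measurable_resP.
- exact: measurable_cst.
- by apply: aeW => f _; apply: cvg_EFin; [exact: nearW|exact: lim].
- exact: LQ.
- by apply: aeW => f n _; rewrite /= ger0_norm ?resP_ge0 // lee_fin resP_le.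
rewrite integral_cst // mul0e in cv.
have [n _ Hn] : \forall n \near \oo, (\int[mu]_f (resP (e n) f)%:E < eta%:E)%E.
  have LR n : L1 mu (resP (e n)).
    apply: L1_le LQ; first exact: measurable_resP.
    by move=> f; rewrite ger0_norm ?resP_ge0 // resP_le.
  have cv' : \int[mu]_f resP (e n) f @[n --> \oo] --> (0 : R).
    by apply: fine_cvg; exact: cv.
  have : \forall n \near \oo, \int[mu]_f resP (e n) f < eta by apply: (cvgr_lt 0) => //; exact: cv'.
  by apply: filterS => n; rewrite -lte_fin RintegralK.
by exists (N n), (e n); split => //; apply: ltW; apply: Hn => /=.
Unshelve. all: by end_near. Qed.

Section Algorithm.
Variables (n : nat) (L : 'I_n -> F -> R) (phi : Rd R n -> Rd R d -> R).
Hypotheses (cL : forall i, clf (L i)) (phi_L2 : forall y, L2 P (phi y))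
  (phi_meas : forall g, L2 P g -> forall r : R,
     measurable [set y : Rd R n | l2ip P (phi y - g) (phi y - g) < r]).

(** The assumption on [phi] concerns balls; polarization transfers it to scalar products. *)
Lemma measurable_phi g : L2 P g -> measurable_fun setT (fun y => l2ip P (phi y) g).
Proof.
move=> Lg.
have mq h : L2 P h -> measurable_fun setT (fun y => l2ip P (phi y - h) (phi y - h)).
  move=> Lh; pose q y := l2ip P (phi y - h) (phi y - h).
  have -> : (fun y => l2ip P (phi y - h) (phi y - h)) = \- (fun y => - q y).
    by apply/funext => y /=; rewrite opprK.
  apply: measurable_funN; apply: measurable_gt_fun => a.
  by have := phi_meas Lh (- a); congr measurable; apply/seteqP; split => y /=; rewrite ltrNr.
have L0 : L2 P 0 by case: lSP.
have -> : (fun y => l2ip P (phi y) g) = fun y => 2^-1 * (l2ip P (phi y - 0) (phi y - 0)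
    + l2ip P g g - l2ip P (phi y - g) (phi y - g)).
  apply/funext => y; rewrite subr0 (nrmB lSP HP (phi_L2 y) Lg); by field.
apply: measurable_funM => //; apply: measurable_funB; last exact: mq.
by apply: measurable_funD => //; exact: mq.
Qed.

(** Coefficient by coefficient: the residual of [M k] after projection is uncorrelated with every
    [L i], so adding a function of the observations cannot lower its second moment. Bessel's
    inequality bounds the sum over [k] by the error of [phi]. *)
Lemma regression N (e : 'I_N -> Rd R d -> R) : orth e ->
  exists r (l : 'I_r -> Fb F -> R), [/\ (r <= n)%N, orthm l, forall j, clf (l j) &
   (\sum_k (l2ip mu ((fun f => l2ip P (eF f) (e k)) - projm l (fun f => l2ip P (eF f) (e k)))
      ((fun f => l2ip P (eF f) (e k)) - projm l (fun f => l2ip P (eF f) (e k))))%:E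
    <= \int[mu]_f (l2ip P (eF f - phi (\row_i L i f)) (eF f - phi (\row_i L i f)))%:E)%E].
Proof.
move=> oe; have [r [l [rn ol Pl null]]] := gram_schmidt lSm Hm (fun i => clf_L2 (cL i)).
have cl : forall j, clf (l j) by apply: Pl => //; exact: clf_lin_closed.
exists r, l; split => //.
have Le k : L2 P (e k) by case: oe.
pose M k : Fb F -> R := fun f => l2ip P (eF f) (e k).
have cM k : clf (M k) by exact: coef_clf.
have LM k : L2 mu (M k) by exact: clf_L2.
pose pM k := projm l (M k).
have cpM k : clf (pM k) by apply: (lin_closed_sum _ _ (@clf_lin_closed R F)).
pose Rk k := M k - pM k.
have cRk k : clf (Rk k) by apply: (lin_closedB (@clf_lin_closed R F)).
pose y f : Rd R n := \row_i L i f.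
pose c k f := l2ip P (eF f - phi (y f)) (e k).
have key k : ((l2ip mu (Rk k) (Rk k))%:E <= \int[mu]_f (c k f ^+ 2)%:E)%E.
  rewrite l2ipK; last exact: clf_L2.
  (* The added function is the linear prediction minus that of [phi]; together with [Rk k] it makes
     up the [k]-th coefficient of the error of [phi]. *)
  have := @uncorr_no_prediction_meas _ _ _ mu (@clf R F) (@clf_lin_closed R F)
    (fun v => @gaussian_clf R F mu v gmu) (Rk k) (cRk k) (fun f => pM k f - l2ip P (phi (y f)) (e k)).
  have -> : (fun f => ((Rk k f + (pM k f - l2ip P (phi (y f)) (e k))) ^+ 2)%:E) =
      (fun f => (c k f ^+ 2)%:E).
    apply/funext => f; congr ((_ ^+ 2)%:E); rewrite /c (ipBl lSP HP) //.
    by rewrite addrA /Rk [(M k - pM k) f]/(M k f - pM k f) subrK.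
  apply; apply: measurable_funB.
    apply: uncorr_measurable; [exact: clf_lin_closed|by move=> v; exact: gaussian_clf|exact: cRk|].
    split; first exact: cpM.
    exact: (res_orth_comb lSm Hm ol).
  apply: (measurableT_comp (measurable_phi (Le k))).
  apply: measurable_Rd => i; rewrite /coord.
  under eq_fun do rewrite mxE.
  apply: uncorr_measurable; [exact: clf_lin_closed|by move=> v; exact: gaussian_clf|exact: cRk|].
  split; first exact: cL.
  by apply: (res_orth_null lSm Hm ol (LM k) (clf_L2 (cL i)) (null i)).
have mc k : measurable_fun setT (c k).
  have -> : c k = fun f => M k f - l2ip P (phi (y f)) (e k).
    by apply/funext => f; rewrite /c (ipBl lSP HP).
  apply: measurable_funB; first exact: clf_measurable.
  apply: (measurableT_comp (measurable_phi (Le k))).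
  apply: measurable_Rd => i; rewrite /coord.
  under eq_fun do rewrite mxE.
  exact: clf_measurable.
apply: (@le_trans _ _ (\sum_k \int[mu]_f (c k f ^+ 2)%:E)%E); first by apply: lee_sum => k _; exact: key.
rewrite -ge0_integral_sum //; last 2 first.
- by move=> k; apply/measurable_EFinP/measurable_funX.
- by move=> k f _; rewrite lee_fin sqr_ge0.
apply: le_ge0_integral => f.
  by rewrite sume_ge0 // => k _; rewrite lee_fin sqr_ge0.
rewrite sumEFin lee_fin; apply: (bessel lSP HP oe).
by apply: (lin_closedB lSP).
Qed.

End Algorithm.

(** Polarization again: squared distances in [L2 mu] are measurable in [x] by Tonelli. *)
Lemma measurable_pe_ip v : clf v -> measurable_fun setT (fun x => l2ip mu (pe x) v).
Proof.
move=> cv; have Lv : L2 mu v by exact: clf_L2.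
have Ld x : L2 mu (pe x - v) by apply: (lin_closedB lSm) => //; exact: pe_L2.
have mq : measurable_fun setT (fun x => l2ip mu (pe x - v) (pe x - v)).
  apply/measurable_EFinP.
  have mh : measurable_fun setT (fun q : Fb F * Rd R d => eF q.1 q.2 - v q.1).
    apply: measurable_funB; first exact: eF_joint.
    by apply: measurableT_comp => //; exact: clf_measurable.
  have := measurable_sq_x mh; congr measurable_fun; apply/funext => x /=.
  by rewrite l2ipK.
have -> : (fun x => l2ip mu (pe x) v) = fun x => 2^-1 * (l2ip mu (pe x) (pe x)
    + l2ip mu v v - l2ip mu (pe x - v) (pe x - v)).
  by apply/funext => y; rewrite (nrmB lSm Hm (pe_L2 y) Lv); field.
apply: measurable_funM => //; apply: measurable_funB => //.
by apply: measurable_funD => //; exact: measurable_s2.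
Qed.

Lemma L1_s2 : L1 P (fun x => l2ip mu (pe x) (pe x)).
Proof.
apply/integrableP; split; first by apply/measurable_EFinP; exact: measurable_s2.
by under eq_integral do rewrite /= (ger0_norm (ip_ge0 Hm (pe_L2 _))); exact: second_moment.
Qed.

Lemma L2_pe_ip v : clf v -> L2 P (fun x => l2ip mu (pe x) v).
Proof.
move=> cv; have Lv : L2 mu v by exact: clf_L2.
apply: L2I; first exact: measurable_pe_ip.
apply: (@L1_le _ _ _ P _ (fun x => l2ip mu v v * l2ip mu (pe x) (pe x))).
- by apply: measurable_funX; exact: measurable_pe_ip.
- by move=> x; rewrite ger0_norm ?sqr_ge0 // mulrC (ip_CS lSm Hm) //; exact: pe_L2.
- by apply: L1Z; exact: L1_s2.
Qed.

Lemma measurable_comb N (e : 'I_N -> Rd R d -> R) (M : 'I_N -> Fb F -> R) :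
  (forall k, L2 P (e k)) -> (forall k, clf (M k)) ->
  measurable_fun setT (fun q : Fb F * Rd R d => eF q.1 q.2 - \sum_k M k q.1 * e k q.2).
Proof.
move=> Le cM; apply: measurable_funB; first exact: eF_joint.
apply: measurable_sum => k; apply: measurable_funM; apply: measurableT_comp => //.
  exact: clf_measurable.
by case: (Le k).
Qed.

Lemma pe_combE N (e : 'I_N -> Rd R d -> R) (M : 'I_N -> Fb F -> R) x f :
  (pe x - \sum_k e k x *: M k) f = eF f x - \sum_k M k f * e k x.
Proof.
rewrite fctE fct_sumE; congr (_ - _); by apply: eq_bigr => k _; rewrite mulrC.
Qed.

(** The duality on which the reduction rests. Exchanging integrals, the error of the linear
    algorithm with functionals [M k] and outputs [e k] becomes the mean squared distance from [pe x]
    to a combination of the [M k]. *)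
Lemma sqrK N (e : 'I_N -> Rd R d -> R) (M : 'I_N -> Fb F -> R) :
  (forall k, L2 P (e k)) -> (forall k, clf (M k)) ->
  (\int[mu]_f (l2ip P (eF f - \sum_k M k f *: e k) (eF f - \sum_k M k f *: e k))%:E =
   \int[P]_x (l2ip mu (pe x - \sum_k e k x *: M k) (pe x - \sum_k e k x *: M k))%:E)%E.
Proof.
move=> Le cM.
have LM k : L2 mu (M k) by exact: clf_L2.
transitivity (\int[mu]_f \int[P]_x ((eF f x - \sum_k M k f * e k x) ^+ 2)%:E)%E.
  apply: eq_integral => f _; rewrite l2ipK.
    by apply: eq_integral => x _; rewrite fctE fct_sumE.
  by apply: (lin_closedB lSP) => //; exact: (lin_closed_sum _ _ lSP).
rewrite (tonelli (measurable_comb Le cM)); apply: eq_integral => x _; rewrite l2ipK.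
  by apply: eq_integral => f _ /=; rewrite pe_combE.
apply: (lin_closedB lSm); first exact: pe_L2.
exact: (lin_closed_sum _ _ lSm).
Qed.

Lemma measurable_sqx N (e : 'I_N -> Rd R d -> R) (M : 'I_N -> Fb F -> R) :
  (forall k, L2 P (e k)) -> (forall k, clf (M k)) ->
  measurable_fun setT (fun x => l2ip mu (pe x - \sum_k e k x *: M k) (pe x - \sum_k e k x *: M k)).
Proof.
move=> Le cM; have LM k : L2 mu (M k) by exact: clf_L2.
apply/measurable_EFinP.
have := measurable_sq_x (measurable_comb Le cM).
congr measurable_fun; apply/funext => x /=; rewrite l2ipK.
  by apply: eq_integral => f _ /=; rewrite pe_combE.
apply: (lin_closedB lSm); first exact: pe_L2.
exact: (lin_closed_sum _ _ lSm).
Qed.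

Lemma int_orth_comb N (e : 'I_N -> Rd R d -> R) (v : 'I_N -> Fb F -> R) :
  orth e -> (forall k, L2 mu (v k)) ->
  let q x := l2ip mu (\sum_k e k x *: v k) (\sum_k e k x *: v k) in
  L1 P q /\ \int[P]_x q x = \sum_k l2ip mu (v k) (v k).
Proof.
move=> [Le oe] Lv q.
have qE : q = fun x => \sum_k \sum_j l2ip mu (v k) (v j) * (e k x * e j x).
  apply/funext => x; rewrite /q (ip_suml lSm Hm) //; last exact: (lin_closed_sum _ _ lSm).
  apply: eq_bigr => k _; rewrite (ip_sumr lSm Hm) // mulr_sumr.
  by apply: eq_bigr => j _; ring.
have L1e k j : L1 P (fun x => e k x * e j x) by exact: L2_mul.
have L1e' k j : L1 P (fun x => l2ip mu (v k) (v j) * (e k x * e j x)) by exact: L1Z.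
have L1s k : L1 P (fun x => \sum_j l2ip mu (v k) (v j) * (e k x * e j x)).
  by apply: L1_sum.
split; first by rewrite qE; exact: L1_sum.
rewrite qE Rintegral_suml //; apply: eq_bigr => k _; rewrite Rintegral_suml //.
have IE j : \int[P]_x (l2ip mu (v k) (v j) * (e k x * e j x)) = l2ip mu (v k) (v j) * (k == j)%:R.
  rewrite -oe; exact: (RintegralZl _ measurableT (L1e k j)).
under eq_bigr do rewrite IE.
rewrite (bigD1 k) //= big1 ?addr0 ?eqxx ?mulr1 // => j jk.
by rewrite eq_sym (negbTE jk) mulr0.
Qed.

Hypothesis PD : P (~` D) = 0%E.

Lemma std_from_all n (L : 'I_n -> F -> R) (phi : Rd R n -> Rd R d -> R) (tau : R) : 0 < tau ->
  (forall i, clf (L i)) -> (forall y, L2 P (phi y)) ->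
  (forall g, L2 P g -> forall r : R,
     measurable [set y : Rd R n | l2ip P (phi y - g) (phi y - g) < r]) ->
  (\int[mu]_f (l2ip P (eF f - phi (\row_i L i f)) (eF f - phi (\row_i L i f)))%:E <= tau%:E)%E ->
  exists m (X : 'I_m -> Rd R d) (c : 'I_m -> Rd R d -> R),
    [/\ (m <= n.*2)%N, forall i, D (X i), forall i, L2 P (c i) &
    (\int[mu]_f (l2ip P (eF f - \sum_i eF f (X i) *: c i) (eF f - \sum_i eF f (X i) *: c i))%:E
      <= (112 * tau)%:E)%E].
Proof.
move=> tau0 cL phi_L2 phi_meas err.
have [N [e [oe He]]] := finite_rank tau0.
have [r [l [rn ol cl Hr]]] := regression cL phi_L2 phi_meas oe.
have {Hr} Hr := le_trans Hr err.
have Le k : L2 P (e k) by case: oe.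
have Ll k : L2 mu (l k) by exact: clf_L2.
pose M k : Fb F -> R := fun f => l2ip P (eF f) (e k).
have cM k : clf (M k) by exact: coef_clf.
have LM k : L2 mu (M k) by exact: clf_L2.
pose Rk k := M k - projm l (M k).
have LR k : L2 mu (Rk k) by exact: (res_in lSm ol).
have HR : \sum_k l2ip mu (Rk k) (Rk k) <= tau by rewrite -lee_fin -sumEFin.
pose rr x := l2ip mu (pe x - \sum_k e k x *: M k) (pe x - \sum_k e k x *: M k).
have Sr x : L2 mu (pe x - \sum_k e k x *: M k).
  by apply: (lin_closedB lSm); [exact: pe_L2|exact: (lin_closed_sum _ _ lSm)].
have rr0 x : 0 <= rr x by exact: (ip_ge0 Hm).
have mr : measurable_fun setT rr by exact: measurable_sqx.
have Ir : (\int[P]_x (rr x)%:E <= tau%:E)%E by rewrite -sqrK.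
have Lr : L1 P rr.
  apply/integrableP; split; first exact/measurable_EFinP.
  under eq_integral do rewrite /= ger0_norm //.
  by apply: le_lt_trans Ir _; exact: ltry.
have IrR : \int[P]_x rr x <= tau by rewrite -lee_fin RintegralK.
have [Lq Iq] := int_orth_comb oe LR.
set q := (fun x => l2ip mu _ _) in Lq Iq.
pose K2 x := l2ip mu (pe x - projm l (pe x)) (pe x - projm l (pe x)).
have K20 x : 0 <= K2 x by apply: (ip_ge0 Hm); exact: (res_in lSm ol (pe_L2 x)).
have mK : measurable_fun setT K2.
  have -> : K2 = fun x => l2ip mu (pe x) (pe x) - \sum_j l2ip mu (pe x) (l j) ^+ 2.
    by apply/funext => x; rewrite (nrm_proj lSm Hm ol (pe_L2 x)) addrK.
  apply: measurable_funB; first exact: measurable_s2.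
  by apply: measurable_sum => j; apply: measurable_funX; exact: measurable_pe_ip.
have LK : L1 P K2.
  apply: L1_le mK _ L1_s2 => x; rewrite ger0_norm // (nrm_proj lSm Hm ol (pe_L2 x)).
  by rewrite lerDl sumr_ge0 // => j _; exact: sqr_ge0.
(* The projection of the finite-rank field competes with that of [pe x]; its error splits into the
   error of the field and the unpredicted parts [Rk]. Each has mean at most [tau], whence the level
   [4 * tau] below and [28 * 4 = 112]. *)
have K2le x : K2 x <= 2 * rr x + 2 * q x.
  pose c j := \sum_k e k x * l2ip mu (M k) (l j).
  apply: le_trans (nrm_res_le lSm Hm ol c (pe_L2 x)) _.
  have -> : pe x - \sum_j c j *: l j = (pe x - \sum_k e k x *: M k) + \sum_k e k x *: Rk k.
    rewrite -addrA; congr (_ + _).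
    have -> : \sum_k e k x *: Rk k = \sum_k e k x *: M k - \sum_k e k x *: projm l (M k).
      by rewrite -sumrB; apply: eq_bigr => k _; exact: scalerBr.
    rewrite addKr; congr (- _).
    rewrite /c; under eq_bigr do rewrite scaler_suml.
    rewrite exchange_big /=; apply: eq_bigr => k _; rewrite scaler_sumr.
    by apply: eq_bigr => j _; rewrite scalerA.
  by apply: (nrmD_le lSm Hm) => //; exact: (lin_closed_sum _ _ lSm).
have IK : \int[P]_x K2 x <= 4 * tau.
  apply: (@le_trans _ _ (\int[P]_x (2 * rr x + 2 * q x))).
    by apply: le_Rintegral => //; apply: (L1D (L1Z 2 Lr) (L1Z 2 Lq)).
  by rewrite (Rint_lin 2 2 Lr Lq) Iq; lra.
have tau4 : 0 < 4 * tau by rewrite mulr_gt0.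
have [|m [X [A [B [mr' DX [LB IB] HB]]]]] := sampling lSm Hm mD PD tau4 ol pe_L2 LM
  (fun k j => L2_mul (Le k) (Le j)) LK IK Lr _; first by apply: le_trans IrR _; lra.
pose c i x := \sum_j A i j * l2ip mu (pe x) (pe (X j)).
have cE i : c i = \sum_j A i j *: (fun x => l2ip mu (pe x) (pe (X j))).
  by apply/funext => x; rewrite fct_sumE.
have Lc i : L2 P (c i).
  rewrite cE; apply: (lin_closed_sum _ _ lSP) => j; apply: L2_pe_ip; exact: pe_clf.
exists m, X, c; split => //.
  by rewrite (leq_trans mr') // leq_double.
(* Read backwards, with point evaluations as the functionals, the residual in [L2 mu] is the error
   of an algorithm using function values. *)
rewrite (sqrK Lc (M := fun i => pe (X i)) (fun i => pe_clf (X i))).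
apply: (@le_trans _ _ (\int[P]_x (B x)%:E)%E).
  apply: ge0_le_integral => //.
  - move=> x _; rewrite lee_fin; apply: (ip_ge0 Hm); apply: (lin_closedB lSm); first exact: pe_L2.
    by apply: (lin_closed_sum _ _ lSm) => i; exact: pe_L2.
  - by apply/measurable_EFinP; apply: measurable_sqx => // i; exact: pe_clf.
  - by apply/measurable_EFinP; exact: (L1_mfun LB).
  - by move=> x _; rewrite lee_fin; exact: HB.
by rewrite -RintegralK // lee_fin; lra.
Qed.

End Problem.

(** * Return to the weighted space on [D] *)

Section FixedDimension.
Context (R : realType) (d : nat).
Variables (D : set (Rd R d)) (rho : Rd R d -> R) (lam : {measure set (Rd R d) -> \bar R}).
Hypotheses (mD : measurable D) (mrho : measurable_fun D rho)
  (rho0 : forall x, D x -> 0 <= rho x).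

Local Notation ext := (zext D).

Section Density.
Variable P : probability (Rd R d) R.
Hypothesis PE : forall g : Rd R d -> \bar R, measurable_fun setT g ->
  (forall x, 0 <= g x)%E -> (\int[P]_x g x = \int[lam]_x (g x * densD D rho x))%E.

Let lSP := L2_lin_closed P.
Let HP := l2_pre_ip P.

Lemma ext_l2ip h : L2 P h -> l2ip P (ext h) (ext h) = l2ip P h h.
Proof.
move=> Lh; have Le := L2_ext mD Lh; apply: EFin_inj; rewrite !l2ipK //.
case: Lh => mh _; case: Le => me _.
rewrite !PE.
- apply: eq_integral => x _; rewrite /densD /zext.
  by case: ifP => // _; rewrite !mule0.
- by apply/measurable_EFinP/measurable_funX.
- by move=> x; rewrite lee_fin sqr_ge0.
- by apply/measurable_EFinP/measurable_funX.
- by move=> x; rewrite lee_fin sqr_ge0.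
Qed.

Lemma G2_l2ip h : inG D rho lam h -> G2 D rho lam h = (l2ip P (ext h) (ext h))%:E.
Proof.
move=> ih; rewrite (G2E mD PE); last by case: ih.
by rewrite l2ipK //; exact: (inG_L2 mD PE ih).
Qed.

Lemma inGB g h : inG D rho lam g -> inG D rho lam h -> inG D rho lam (fun x => g x - h x).
Proof.
move=> ig ih; have m := inG_B ig ih; split => //.
rewrite (G2E mD PE) // extB.
have := lin_closedB lSP (inG_L2 mD PE ig) (inG_L2 mD PE ih).
by case.
Qed.

Lemma G2B_l2ip g h : inG D rho lam g -> inG D rho lam h ->
  G2 D rho lam (fun x => g x - h x) = (l2ip P (ext g - ext h) (ext g - ext h))%:E.
Proof. by move=> ig ih; rewrite G2_l2ip ?extB //; exact: inGB. Qed.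

Lemma ext_idem h : ext (ext h) = ext h.
Proof. by apply/funext => x; rewrite /zext; case: (x \in D). Qed.

Lemma G_measurable_l2ip n (phi : Rd R n -> Rd R d -> R) : G_measurable D rho lam phi ->
  forall g, L2 P g -> forall r : R,
    measurable [set y : Rd R n | l2ip P (ext (phi y) - g) (ext (phi y) - g) < r].
Proof.
move=> [ip mp] g Lg r; have ig : inG D rho lam g by exact: (L2_inG mD PE Lg).
have := mp g ig r; congr measurable; apply/seteqP.
have E y : G2 D rho lam (fun x => phi y x - g x) = (l2ip P (ext (phi y) - g) (ext (phi y) - g))%:E.
  rewrite (G2B_l2ip (ip y) ig); congr (_%:E).
  (* [g] may differ from zero outside [D], a null set of [P]. *)
  rewrite -[RHS]ext_l2ip; last exact: (lin_closedB lSP (inG_L2 mD PE (ip y)) Lg).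
  by rewrite !(extB _ (ext (phi y))) ext_idem.
by split => y /=; rewrite E lte_fin.
Qed.

Definition lin_alg m (c : 'I_m -> Rd R d -> R) (y : Rd R m) : Rd R d -> R :=
  fun x => \sum_i coord y i * c i x.

Lemma lin_algE m (c : 'I_m -> Rd R d -> R) y : lin_alg c y = \sum_i coord y i *: c i.
Proof. by apply/funext => x; rewrite fct_sumE. Qed.

Lemma lin_alg_L2 m (c : 'I_m -> Rd R d -> R) y : (forall i, L2 P (c i)) -> L2 P (lin_alg c y).
Proof. by move=> Lc; rewrite lin_algE; exact: (lin_closed_sum _ _ lSP). Qed.

Lemma lin_alg_ext m (c : 'I_m -> Rd R d -> R) y : ext (lin_alg c y) = \sum_i coord y i *: ext (c i).
Proof.
apply/funext => x; rewrite fct_sumE; have [Dx|Dx] := pselect (D x).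
  rewrite ext_in //; apply: eq_bigr => i _.
  by rewrite [RHS]/(coord y i * ext (c i) x) ext_in.
rewrite ext_out // big1 // => i _.
by rewrite [LHS]/(coord y i * ext (c i) x) (ext_out _ Dx); exact: mulr0.
Qed.

(** The squared distance to [g] is a polynomial of degree at most two in the observations. *)
Lemma lin_alg_measurable m (c : 'I_m -> Rd R d -> R) : (forall i, L2 P (c i)) ->
  G_measurable D rho lam (lin_alg c).
Proof.
move=> Lc; have iL y : inG D rho lam (lin_alg c y).
  by apply: (L2_inG mD PE); exact: lin_alg_L2.
split => // g ig r.
have Lg := inG_L2 mD PE ig.
have Le i : L2 P (ext (c i)) by exact: (L2_ext mD (Lc i)).
pose q y := \sum_i \sum_j coord y i * (coord y j * l2ip P (ext (c i)) (ext (c j)))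
   - 2 * (\sum_i coord y i * l2ip P (ext (c i)) (ext g)) + l2ip P (ext g) (ext g).
have E y : G2 D rho lam (fun x => lin_alg c y x - g x) = (q y)%:E.
  rewrite (G2B_l2ip (iL y) ig) lin_alg_ext; congr (_%:E).
  have Ls : L2 P (\sum_i coord y i *: ext (c i)) by exact: (lin_closed_sum _ _ lSP).
  rewrite (nrmB lSP HP Ls Lg) /q; congr (_ - 2 * _ + _).
    rewrite (ip_suml lSP HP) //; apply: eq_bigr => i _.
    by rewrite (ip_sumr lSP HP) // mulr_sumr.
  by rewrite (ip_suml lSP HP).
have mq : measurable_fun setT q.
  apply: measurable_funD => //; apply: measurable_funB.
    apply: measurable_sum => i; apply: measurable_sum => j.
    apply: measurable_funM; first exact: measurable_coord.
    by apply: measurable_funM => //; exact: measurable_coord.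
  apply: measurable_funM => //; apply: measurable_sum => i.
  by apply: measurable_funM => //; exact: measurable_coord.
have := mq measurableT _ (measurable_itv `]-oo, r[); rewrite setTI.
by congr measurable; apply/seteqP; split => y /=; rewrite in_itv /= E lte_fin.
Qed.

End Density.

Context (F : completeNormedModType R) (ev : F -> Rd R d -> R) (mu : probability (Fb F) R).
Variables (S : set F) (C : R).
Hypotheses (rho1 : (\int[lam]_(x in D) (rho x)%:E = 1)%E)
  (cS : countable S) (dS : closure S = setT)
  (ev_lin : forall (a : R) (f g : F) x, ev (a *: f + g) x = a * ev f x + ev g x)
  (ev_cont : forall x, D x -> continuous (fun f : F => ev f x))
  (ev_G : forall f, inG D rho lam (ev f))
  (ev_bound : forall f : F, (G2 D rho lam (ev f) <= (C * `|f| ^+ 2)%:E)%E)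
  (gmu : centered_gaussian mu).

Lemma std_algorithm n (L : 'I_n -> F -> R) (phi : Rd R n -> Rd R d -> R) (tau : R) : 0 < tau ->
  (forall i, clf (L i)) -> G_measurable D rho lam phi ->
  (\int[mu]_f G2 D rho lam (fun x => (ev f x - phi (\row_i L i f) x)%R) <= tau%:E)%E ->
  exists m (X : 'I_m -> Rd R d) (c : 'I_m -> Rd R d -> R),
    [/\ (m <= n.*2)%N, forall i, D (X i), G_measurable D rho lam (lin_alg c) &
    (\int[mu]_f G2 D rho lam (fun x => (ev f x - lin_alg c (\row_i ev f (X i)) x)%R)
      <= (112 * tau)%:E)%E].
Proof.
move=> tau0 cL gphi err.
have q1 : (\int[lam]_x densD D rho x = 1)%E by rewrite densD_int.
have [P PE] := density_probability (densD_measurable mD mrho) (densD_ge0 rho0) q1.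
pose eF : Fb F -> Rd R d -> R := fun f => ext (ev f).
have eF_lin (a : R) (f g : F) : eF (a *: f + g) = a *: eF f + eF g.
  apply/funext => x; rewrite /eF /zext !fctE; case: ifP => _; first exact: ev_lin.
  by rewrite scaler0 addr0.
have eF_cont x : continuous (fun f : F => eF f x).
  rewrite /eF /zext; case: (boolP (x \in D)) => [/set_mem|_]; first exact: ev_cont.
  exact: cst_continuous.
have eF_L2 f : L2 P (eF f) by exact: (inG_L2 mD PE).
have eF_bound (f : F) : l2ip P (eF f) (eF f) <= C * `|f| ^+ 2.
  by rewrite -lee_fin; apply: le_trans (ev_bound f); rewrite (G2_l2ip PE).
have [ip _] := gphi.
have [|m [X [c [mn DX Lc Hc]]]] := std_from_all mD cS dS eF_lin eF_cont eF_L2 eF_bound gmu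
   (P_compl mD PE) tau0 cL (fun y => inG_L2 mD PE (ip y)) (G_measurable_l2ip PE gphi) _.
  apply: le_trans err; rewrite le_eqVlt; apply/orP; left; apply/eqP.
  by apply: eq_integral => f _; rewrite (G2B_l2ip PE).
exists m, X, c; split => //; first exact: (lin_alg_measurable PE).
apply: le_trans Hc; rewrite le_eqVlt; apply/orP; left; apply/eqP.
apply: eq_integral => f _.
have Lv : L2 P (lin_alg c (\row_i ev f (X i))) by exact: lin_alg_L2.
rewrite (G2B_l2ip PE) //; last exact: (L2_inG mD PE).
congr (_%:E).
rewrite -[RHS](ext_l2ip PE); last first.
  by apply: (lin_closedB (L2_lin_closed P)) => //; apply: (lin_closed_sum _ _ (L2_lin_closed P)).
have -> : \sum_i eF f (X i) *: c i = lin_alg c (\row_i ev f (X i)).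
  rewrite lin_algE; apply: eq_bigr => i _; congr (_ *: _).
  by rewrite /eF ext_in // /coord mxE.
by rewrite !(extB _ (eF f)) ext_idem.
Qed.

End FixedDimension.

(** * Tractability *)

Lemma sqrte_lt_sqr (R : realType) (x : \bar R) (t : R) :
  (sqrte x < t%:E)%E -> (x <= (t ^+ 2)%:E)%E.
Proof.
case: x => [r| |] //=; last by rewrite leNye.
rewrite lte_fin lee_fin => rt; have [r0|r0] := ltP r 0.
  by rewrite (le_trans (ltW r0)) // sqr_ge0.
rewrite -[leLHS]sqr_sqrtr // ler_pXn2r ?nnegrE ?sqrtr_ge0 ?ltW //.
exact: le_lt_trans (sqrtr_ge0 _) rt.
Qed.

Lemma sqrte_le (R : realType) (x : \bar R) (t : R) : 0 <= t ->
  (x <= (t ^+ 2)%:E)%E -> (sqrte x <= t%:E)%E.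
Proof.
move=> t0; case: x => [r| |] //=; rewrite ?lee_fin // => rt.
by rewrite -[leRHS](ger0_norm t0) -sqrtr_sqr ler_wsqrtr.
Qed.

Section Tractability.
Variables (R : realType)
  (D : forall d : nat, set (Rd R d)) (rho : forall d : nat, Rd R d -> R)
  (lam : forall d : nat, {measure set (Rd R d) -> \bar R})
  (F : nat -> completeNormedModType R) (ev : forall d : nat, F d -> Rd R d -> R)
  (mu : forall d : nat, probability (Fb (F d)) R).
Hypothesis app : APP_setting D rho lam ev mu.

Lemma e_avg_std_of_all n d (eps : R) : (0 < d)%N -> 0 < eps ->
  (e_avg D rho lam ev mu Lall n d <= eps%:E)%E ->
  exists m, (m <= n.*2)%N /\ (e_avg D rho lam ev mu Lstd m d <= (22 * eps)%:E)%E.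
Proof.
move=> d0 eps0 He.
have [[_ [mD _]] [[mrho [rho0 rho1]] [[sep [evl [_ evc]]] [[evG [C evb]] g]]]] := app d0.
have [S [cS dS]] := sep.
(* The infimum need not be attained; since [eps] is positive, some algorithm has error below
   [2 * eps]. *)
have : (e_avg D rho lam ev mu Lall n d < (2 * eps)%:E)%E.
  by apply: le_lt_trans He _; rewrite lte_fin; lra.
move=> /ereal_inf_lt [_ [A HA <-] /sqrte_lt_sqr errA].
(* [112 * 2 ^ 2 = 448] is at most [22 ^ 2 = 484]. *)
have le22 (x : \bar R) : (x <= (112 * (2 * eps) ^+ 2)%:E)%E -> (sqrte x <= (22 * eps)%:E)%E.
  move=> Hx; apply: sqrte_le; first by rewrite mulr_ge0 // ltW.
  by apply: le_trans Hx _; rewrite lee_fin; nra.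
have tau0 : 0 < (2 * eps) ^+ 2 by rewrite exprn_gt0 // mulr_gt0.
case: HA => [[n0 A0]|[n0 [L [phi [cL gphi EA]]]]].
  (* The algorithm without observations belongs to both classes. *)
  exists 0%N; split => //; apply: (le_trans (ereal_inf_lbound _)).
    by exists A => //; left.
  apply: le22; apply: le_trans errA _; rewrite lee_fin; lra.
rewrite EA in errA.
have [m [X [c [mn DX gc err]]]] :=
  std_algorithm mD mrho rho0 rho1 cS dS evl evc evG evb g tau0 cL gphi errA.
exists m; split => //.
pose B (f : F d) := lin_alg c (\row_i ev f (X i)).
apply: (@le_trans _ _ (sqrte (err2 D rho lam ev mu B))); last exact: le22.
apply: ereal_inf_lbound; exists B => //.
(* With no nodes, the empty sum is the zero algorithm prescribed for [m = 0]. *)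
have [m0|m0] := posnP m; [left|right]; split => //.
  apply/funext => f; apply/funext => x; rewrite /B /lin_alg.
  by rewrite big1 // => i; exfalso; have := ltn_ord i; rewrite {2}m0.
exists (fun i f => ev f (X i)), (lin_alg c); split => // i.
by exists (X i).
Qed.

Lemma e_avg_all_le_std n d : (0 < d)%N ->
  (e_avg D rho lam ev mu Lall n d <= e_avg D rho lam ev mu Lstd n d)%E.
Proof.
move=> d0; have [_ [_ [[_ [evl [_ evc]]] _]]] := app d0.
apply: ereal_inf_le_tmp => _ [A HA <-]; exists A => //.
case: HA => [[n0 A0]|[n0 [L [phi [cL gphi EA]]]]]; [by left|right; split => //].
exists L, phi; split => // i; have [x [Dx ->]] := cL i.
by split => [a f g|]; [exact: evl|exact: evc].
Qed.

Lemma nABS_std_of_all (eps X : R) d : (0 < d)%N -> 0 < eps ->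
  nABS_le D rho lam ev mu Lall (22^-1 * eps) d X -> nABS_le D rho lam ev mu Lstd eps d (2 * X).
Proof.
move=> d0 eps0 [n [nX He]]; have eps1 : 0 < 22^-1 * eps by rewrite mulr_gt0.
have [m [mn Hm]] := e_avg_std_of_all d0 eps1 He.
exists m; split; last by move: Hm; rewrite mulrA divff // mul1r.
apply: (@le_trans _ _ (n.*2%:R)); first by rewrite ler_nat.
by rewrite -mul2n natrM ler_wpM2l.
Qed.

Lemma nABS_all_of_std (eps X : R) d : (0 < d)%N ->
  nABS_le D rho lam ev mu Lstd eps d X -> nABS_le D rho lam ev mu Lall eps d X.
Proof.
move=> d0 [n [nX He]]; exists n; split => //.
by apply: le_trans He; exact: e_avg_all_le_std.
Qed.

(** A factor [22] in [eps] and a factor [2] in the count alter only [C], so each [p] is admissible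
    for both classes or for neither; equality of the exponents is immediate from this. *)
Lemma ALG_SPT_with_std p : ALG_SPT_with D rho lam ev mu Lall p <-> ALG_SPT_with D rho lam ev mu Lstd p.
Proof.
split => -[p0 [C [C0 H]]]; split => //; last first.
  by exists C; split => // d d0 eps Heps; apply: nABS_all_of_std => //; exact: H.
exists (2 * (C * 22^-1 `^ (- p))); split; first by rewrite !mulr_gt0 // powR_gt0.
move=> d d0 eps /andP[eps0 eps1].
rewrite -!mulrA -powRM ?ltW //; apply: nABS_std_of_all => //; apply: H => //.
by rewrite mulr_gt0 //=; lra.
Qed.

Lemma ALG_PT_std : ALG_PT D rho lam ev mu Lall <-> ALG_PT D rho lam ev mu Lstd.
Proof.
split => -[C [p [q [C0 p0 q0 H]]]]; last first.
  by exists C, p, q; split => // d d0 eps Heps; apply: nABS_all_of_std => //; exact: H.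
exists (2 * (C * 22^-1 `^ (- p))), p, q; split => //; first by rewrite !mulr_gt0 // powR_gt0.
move=> d d0 eps /andP[eps0 eps1].
have -> : 2 * (C * 22^-1 `^ (- p)) * d%:R `^ q * eps `^ (- p) =
    2 * (C * d%:R `^ q * (22^-1 * eps) `^ (- p)).
  by rewrite powRM ?ltW //; ring.
by apply: nABS_std_of_all => //; apply: H => //; rewrite mulr_gt0 //=; lra.
Qed.

End Tractability.

Theorem theorem4p1 (R : realType)
  (D : forall d : nat, set (Rd R d)) (rho : forall d : nat, Rd R d -> R)
  (lam : forall d : nat, {measure set (Rd R d) -> \bar R})
  (F : nat -> completeNormedModType R) (ev : forall d : nat, F d -> Rd R d -> R)
  (mu : forall d : nat, probability (Fb (F d)) R) :
  APP_setting D rho lam ev mu ->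
  (ALG_PT D rho lam ev mu Lall <-> ALG_PT D rho lam ev mu Lstd) /\
  (ALG_SPT D rho lam ev mu Lall <-> ALG_SPT D rho lam ev mu Lstd) /\
  (ALG_SPT D rho lam ev mu Lall ->
     ALG_p_ABS D rho lam ev mu Lall = ALG_p_ABS D rho lam ev mu Lstd).
Proof.
move=> app; have H p := ALG_SPT_with_std app p.
split; first exact: ALG_PT_std.
split; first by split => -[p Hp]; exists p; apply/H.
by move=> _; congr inf; apply/seteqP; split => p /H.
Qed.
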